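(* There is an algorithm that uses polynomial space and that, given as input an undirected graph $G$ on $n$ vertices with an edge-weight function $\mathrm{cost}\colon E(G)\to\mathbb{N}$, a set of terminals $K\subseteq V(G)$, and a multiway cut $S$ for $K$ in $G$, outputs a minimum-weight Steiner tree for $K$ in $G$ in time $2^{\mathcal{O}(|S|\log|S|)}\cdot \mathrm{poly}(n)$.
   Context: A Steiner tree for a terminal set $K$ in $G$ is a connected subgraph (tree) of $G$ containing all vertices of $K$; its weight is the sum of $\mathrm{cost}(e)$ over its edges. A (node) multiway cut for $K$ is a vertex set $S\subseteq V(G)$ (which may contain terminals) such that every connected component of $G-S$ contains at most one vertex of $K$. Edge weights may be encoded in binary. *)

(* Defs.v *)
(* Plain MathComp; everything is in nat_scope. *)
From mathcomp Require Import all_boot.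

Set Implicit Arguments.
Unset Strict Implicit.
Unset Printing Implicit Defensive.

(** * Graphs

    A graph on the vertices 0, ..., n-1 is its set of edges, an edge being the
    set of its two endpoints. *)

Definition is_graph n (E : {set {set 'I_n}}) : Prop :=
  forall e, e \in E -> #|e| = 2.

Definition adj n (E : {set {set 'I_n}}) : rel 'I_n :=
  fun u v => [set u; v] \in E.

Definition adj_minus n (E : {set {set 'I_n}}) (S : {set 'I_n}) : rel 'I_n :=
  fun u v => [&& u \notin S, v \notin S & adj E u v].

(** The vertex set of the connected component of [u] in [G - S],
    for [u \notin S]. *)
Definition component n (E : {set {set 'I_n}}) (S : {set 'I_n}) (u : 'I_n) :
    {set 'I_n} :=
  [set v | connect (adj_minus E S) u v].

Definition multiway_cut n (E : {set {set 'I_n}}) (K S : {set 'I_n}) : Prop :=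
  forall u, u \notin S -> #|component E S u :&: K| <= 1.

Definition subgraph n (E : {set {set 'I_n}})
    (V : {set 'I_n}) (F : {set {set 'I_n}}) : Prop :=
  F \subset E /\ (forall e, e \in F -> e \subset V).

Definition is_tree n (V : {set 'I_n}) (F : {set {set 'I_n}}) : Prop :=
  [/\ V != set0,
      forall u v, u \in V -> v \in V -> connect (adj F) u v
    & forall p : seq 'I_n, 2 < size p -> ~ ucycle (adj F) p].

Definition steiner_tree n (E : {set {set 'I_n}}) (K : {set 'I_n})
    (V : {set 'I_n}) (F : {set {set 'I_n}}) : Prop :=
  [/\ subgraph E V F, is_tree V F & K \subset V].

Definition weight n (cost : {set 'I_n} -> nat) (F : {set {set 'I_n}}) : nat :=
  \sum_(e in F) cost e.

Definition min_steiner_tree n (E : {set {set 'I_n}}) (cost : {set 'I_n} -> nat)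
    (K : {set 'I_n}) (V : {set 'I_n}) (F : {set {set 'I_n}}) : Prop :=
  steiner_tree E K V F /\
  (forall V' F', steiner_tree E K V' F' -> weight cost F <= weight cost F').

(** * Model of computation

    A random access machine with structured control flow: a program uses a
    fixed finite set of registers and an indirectly addressed memory, and each
    operation on words costs one unit of time.  The word length is not fixed by
    the machine; it is bounded, together with the number of memory cells, by
    the predicate [fits] below. *)

Inductive binop := OpAdd | OpSub | OpMul | OpDiv | OpMod | OpEq | OpLt.

Inductive expr :=
  | EConst of nat
  | EReg of nat
  | ELoad of expr
  | EBin of binop & expr & expr.

Inductive cmd :=
  | CSkip
  | CSet of nat & expr     (* register := value *)
  | CStore of expr & expr  (* memory[address] := value *)
  | CSeq of cmd & cmd
  | CIf of expr & cmd & cmd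
  | CWhile of expr & cmd.

Record state := State { regs : nat -> nat; ram : nat -> nat }.

Definition upd (f : nat -> nat) (a x : nat) : nat -> nat :=
  fun b => if b == a then x else f b.

(** [OpSub] is truncated; [x %/ 0 = 0] and [x %% 0 = x]. *)
Definition eval_binop (o : binop) (x y : nat) : nat :=
  match o with
  | OpAdd => x + y
  | OpSub => x - y
  | OpMul => x * y
  | OpDiv => x %/ y
  | OpMod => x %% y
  | OpEq => x == y
  | OpLt => x < y
  end.

Fixpoint eval (s : state) (e : expr) : nat :=
  match e with
  | EConst x => x
  | EReg r => regs s r
  | ELoad a => ram s (eval s a)
  | EBin o e1 e2 => eval_binop o (eval s e1) (eval s e2)
  end.

Fixpoint eval_time (e : expr) : nat :=
  match e with
  | EConst _ | EReg _ => 1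
  | ELoad a => (eval_time a).+1
  | EBin _ e1 e2 => (eval_time e1 + eval_time e2).+1
  end.

(** At most [cells] memory cells are in use, and every stored word has at most
    [bits] bits.  (Intermediate results of an expression are longer by at most
    a factor that depends only on the program.) *)
Definition fits (cells bits : nat) (s : state) : Prop :=
  [/\ forall a, cells <= a -> ram s a = 0,
      forall a, ram s a < 2 ^ bits
    & forall r, regs s r < 2 ^ bits].

(** [exec cells bits p s t s']: started in [s], the program [p] halts in [s']
    after [t] time units, and every state written on the way fits. *)
Inductive exec (cells bits : nat) : cmd -> state -> nat -> state -> Prop :=
  | exec_skip s : exec cells bits CSkip s 1 s
  | exec_set s r e :
      let s' := State (upd (regs s) r (eval s e)) (ram s) in
      fits cells bits s' ->
      exec cells bits (CSet r e) s (eval_time e).+1 s'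
  | exec_store s ea ev :
      let s' := State (regs s) (upd (ram s) (eval s ea) (eval s ev)) in
      fits cells bits s' ->
      exec cells bits (CStore ea ev) s (eval_time ea + eval_time ev).+1 s'
  | exec_seq p q s1 s2 s3 t1 t2 :
      exec cells bits p s1 t1 s2 -> exec cells bits q s2 t2 s3 ->
      exec cells bits (CSeq p q) s1 (t1 + t2) s3
  | exec_if_true e p q s s' t :
      eval s e != 0 -> exec cells bits p s t s' ->
      exec cells bits (CIf e p q) s (eval_time e + t).+1 s'
  | exec_if_false e p q s s' t :
      eval s e = 0 -> exec cells bits q s t s' ->
      exec cells bits (CIf e p q) s (eval_time e + t).+1 s'
  | exec_while_end e p s :
      eval s e = 0 -> exec cells bits (CWhile e p) s (eval_time e).+1 s
  | exec_while_step e p s1 s2 s3 t1 t2 :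
      eval s1 e != 0 -> exec cells bits p s1 t1 s2 ->
      exec cells bits (CWhile e p) s2 t2 s3 ->
      exec cells bits (CWhile e p) s1 (eval_time e + t1 + t2).+1 s3.

(** Input cells are placed in memory from address 0; everything else is 0. *)
Definition init_state (input : seq nat) : state :=
  State (fun=> 0) (nth 0 input).

Definition runs (cells bits : nat) (p : cmd) (input : seq nat) (t : nat)
    (s : state) : Prop :=
  fits cells bits (init_state input) /\
  exec cells bits p (init_state input) t s.

(** * Input and output of the algorithm *)

Definition vertex_table n (A : {set 'I_n}) : seq nat :=
  [seq nat_of_bool (v \in A) | v <- enum 'I_n].

(** Matrices are listed row by row. *)
Definition edge_table n (E : {set {set 'I_n}}) : seq nat :=
  [seq nat_of_bool (adj E u v) | u <- enum 'I_n, v <- enum 'I_n].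

Definition cost_table n (E : {set {set 'I_n}}) (cost : {set 'I_n} -> nat) :
    seq nat :=
  [seq (if adj E u v then cost [set u; v] else 0)
     | u <- enum 'I_n, v <- enum 'I_n].

Definition encode_input n (E : {set {set 'I_n}}) (cost : {set 'I_n} -> nat)
    (K S : {set 'I_n}) : seq nat :=
  n :: vertex_table K ++ vertex_table S ++ edge_table E ++ cost_table E cost.

Definition encode_tree n (V : {set 'I_n}) (F : {set {set 'I_n}}) : seq nat :=
  1 :: vertex_table V ++ edge_table F.

Definition memory_starts_with (m : nat -> nat) (l : seq nat) : Prop :=
  forall i, i < size l -> m i = nth 0 l i.

(** There is no Steiner tree if the terminals lie in different components of the
    graph (or [n = 0], as trees are nonempty); this is reported by a 0 in the
    first output cell. *)
Definition outputs_min_steiner_tree n (E : {set {set 'I_n}})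
    (cost : {set 'I_n} -> nat) (K : {set 'I_n}) (m : nat -> nat) : Prop :=
  (exists V F, min_steiner_tree E cost K V F /\
               memory_starts_with m (encode_tree V F)) \/
  ((forall V F, ~ steiner_tree E K V F) /\ m 0 = 0).

(** * Resource bounds *)

(** Every polynomial over nat is dominated by [poly_bound c] for some [c]. *)
Definition poly_bound (c x : nat) : nat := c * x ^ c + c.

(** Number of bits of the largest edge weight. *)
Definition weight_bits n (E : {set {set 'I_n}}) (cost : {set 'I_n} -> nat) :
    nat :=
  (trunc_log 2 (\max_(e in E) cost e)).+1.

(** [2 ^ (c * k log k) * poly(n)], [k] being the size of the multiway cut;
    rounding the logarithm down only tightens the bound. *)
Definition time_bound (c k n : nat) : nat :=
  2 ^ (c * (k * trunc_log 2 k)) * poly_bound c n.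

(** The space, [cells] words of [bits] bits, is polynomial in the length of an
    input whose weights are written in binary.  Words are only polynomially (in
    [n]) longer than a weight, so that counting word operations, hence a time
    bound that does not mention the weights, is meaningful. *)
Definition cell_bound (c n : nat) : nat := poly_bound c n.

Definition word_bound (c n : nat) (E : {set {set 'I_n}})
    (cost : {set 'I_n} -> nat) : nat :=
  poly_bound c n * weight_bits E cost.

(* Main.v *)
(** The weight of an optimal tree is computed by enumeration; an optimal tree is
    then obtained by deleting every edge whose deletion does not raise this
    weight, since the edges that remain are exactly those of an optimal tree.

    If [|K| <= 1] the weight is 0.  Otherwise an optimal tree [T] meets [S]:
    root it there and cut it at its vertices in [S].  A piece lies in one
    component of [G - S], so it contains at most one terminal outside [S].  The
    pieces that touch [S] only once can be replaced by shortest paths from their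
    terminal to [S] in [T], whereas the others, after suppressing vertices of
    degree 2, form a shape with O(|S|) nodes.  This shape, with its nodes
    labelled by [S] but without the identity of the terminals in the pieces, is
    a program of O(|S|) instructions for a stack machine, which computes the cost
    of each piece as a function of the terminal ("slot") attached to it.  What
    remains is to assign terminals to the slots: a piece only has to consider
    the terminals that rank among its first h ones, h being the number of pieces,
    because otherwise one of these is free and an exchange does not increase the
    total cost.  Hence there are [|S| ^ O(|S|)] guesses, each of which is
    evaluated in polynomial time and space.  A wrong guess does no harm, as
    every value is the cost of a connected subgraph containing [K]. *)

Require Import Defs.
From mathcomp Require Import all_boot zify.

Set Implicit Arguments.
Unset Strict Implicit.
Unset Printing Implicit Defensive.

(** * Structured programs and their compilation *)

(** Guessing the terminals themselves would cost about |K| ^ |S| trials, so a piece stays open until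
    it is cut off: its table is a function of two vertices, the one at which the piece is reached
    and the one that fills its slot. A single slot per piece suffices, because a piece has at most
    one terminal outside [S]; hence a table has n ^ 2 entries and a stack of O(|S|) tables fits in
    polynomial space. No table depends on terminals chosen earlier. The code alone therefore fixes
    all charge functions, and the choice of terminals is an assignment problem with one cost
    function per slot, as the exchange argument requires.

    Soundness and completeness meet in [value]. Soundness handles edge sets that connect given
    vertices at bounded cost: they can be united without regard to cycles, and a tree is extracted
    only at the very end. Completeness compares costs only, so the compiler may drop parts of the
    tree as long as their edges pay for what replaces them.

    The machine has neither arrays nor counted loops, so the program is written in a small language
    with both, whose weakest preconditions also control word sizes and addresses and whose running
    time is read off the syntax. *)

Inductive ex :=
  | Cst of nat
  | Rg of nat
  | Ld of nat & ex
  | Op of binop & ex & ex.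

Inductive prog :=
  | Skip
  | Set_ of nat & ex
  | Sto of nat & ex & ex
  | In of nat & ex
  | Out of ex & ex
  | Seq of prog & prog
  | If of ex & prog & prog
  | For of nat & nat & prog.

(** The memory is split into raw cells [rw], which hold the input and later the output, and arrays
    [ar], which live behind them. *)
Record st := St { rg : nat -> nat; ar : nat -> nat -> nat; rw : nat -> nat }.

Definition setr s r x := St (upd (rg s) r x) (ar s) (rw s).
Definition seta s a i x :=
  St (rg s) (fun b => if b == a then upd (ar s b) i x else ar s b) (rw s).
Definition setw s i x := St (rg s) (ar s) (upd (rw s) i x).

Fixpoint ev s e :=
  match e with
  | Cst c => c
  | Rg r => rg s r
  | Ld a i => ar s a (ev s i)
  | Op o e1 e2 => eval_binop o (ev s e1) (ev s e2)
  end.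

(** Arrays are interleaved, cell [i] of array [a] being at offset [narr * i + a]: all of them can
    grow without their lengths being known at compile time. Any number above the array numbers in
    use would do. *)
Definition narr := 16.

Fixpoint cex e :=
  match e with
  | Cst c => EConst c
  | Rg r => EReg r
  | Ld a i => ELoad (EBin OpAdd (EReg 0)
                       (EBin OpAdd (EBin OpMul (EConst narr) (cex i)) (EConst a)))
  | Op o e1 e2 => EBin o (cex e1) (cex e2)
  end.

Definition cadr a i :=
  EBin OpAdd (EReg 0) (EBin OpAdd (EBin OpMul (EConst narr) (cex i)) (EConst a)).

Fixpoint to_cmd p :=
  match p with
  | Skip => CSkip
  | Set_ r e => CSet r (cex e)
  | Sto a i e => CStore (cadr a i) (cex e)
  | In r i => CSet r (ELoad (cex i))
  | Out i e => CStore (cex i) (cex e)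
  | Seq p q => CSeq (to_cmd p) (to_cmd q)
  | If e p q => CIf (cex e) (to_cmd p) (to_cmd q)
  | For r b p =>
      CSeq (CSet r (EConst 0))
        (CWhile (EBin OpLt (EReg r) (EReg b))
           (CSeq (to_cmd p) (CSet r (EBin OpAdd (EReg r) (EConst 1)))))
  end.

Fixpoint mr p : seq nat :=
  match p with
  | Skip | Sto _ _ _ | Out _ _ => [::]
  | Set_ r _ | In r _ => [:: r]
  | Seq p q | If _ p q => mr p ++ mr q
  | For r _ p => r :: mr p
  end.

Fixpoint ma p : seq nat :=
  match p with
  | Skip | Set_ _ _ | Out _ _ | In _ _ => [::]
  | Sto a _ _ => [:: a]
  | Seq p q | If _ p q => ma p ++ ma q
  | For _ _ p => ma p
  end.

Fixpoint mo p : bool :=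
  match p with
  | Out _ _ => true
  | Seq p q | If _ p q => mo p || mo q
  | For _ _ p => mo p
  | _ => false
  end.

Fixpoint okx e :=
  match e with
  | Ld a i => (a < narr) && okx i
  | Op _ e1 e2 => okx e1 && okx e2
  | _ => true
  end.

(** Register 0 holds the address where the arrays start and is never assigned. A loop body changes
    neither the counter nor the bound, so the number of iterations is known on entry. *)
Fixpoint okp p :=
  match p with
  | Skip => true
  | Set_ r e | In r e => (r != 0) && okx e
  | Sto a i e => [&& a < narr, okx i & okx e]
  | Out i e => okx i && okx e
  | Seq p q => okp p && okp q
  | If e p q => [&& okx e, okp p & okp q]
  | For r b p => [&& r != 0, r != b, r \notin mr p, b \notin mr p & okp p]
  end.

(** [env] bounds the registers used as loop bounds. Adding up both branches of a conditional keeps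
    this an expression in sums and products. The 6 pays for resetting the counter and for the last
    test, the 8 for the test and the increment of one iteration. *)
Fixpoint tm (env : nat -> nat) p :=
  match p with
  | Skip => 1
  | Set_ _ e => (eval_time (cex e)).+1
  | Sto a i e => (eval_time (cadr a i) + eval_time (cex e)).+1
  | In _ i => (eval_time (cex i)).+2
  | Out i e => (eval_time (cex i) + eval_time (cex e)).+1
  | Seq p q => tm env p + tm env q
  | If e p q => (eval_time (cex e) + (tm env p + tm env q)).+1
  | For _ b p => 6 + env b * (8 + tm env p)
  end.

Definition frame p s s' :=
  [/\ forall r, r \notin mr p -> rg s' r = rg s r,
      forall a i, a \notin ma p -> ar s' a i = ar s a i
    & ~~ mo p -> forall i, rw s' i = rw s i].

Lemma frame_refl p s : frame p s s.
Proof. by split. Qed.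

(** * Weakest preconditions with resource bounds, and correctness of the compilation *)

Section WP.

Variables (off lmax M : nat) (env : nat -> nat).

(** Reading by [In] and counting in a loop carry no size condition: a value read is already in
    memory and fits, and a counter never exceeds its bound register. *)
Fixpoint wp p (Q : st -> Prop) s : Prop :=
  match p with
  | Skip => Q s
  | Set_ r e => ev s e < M /\ Q (setr s r (ev s e))
  | Sto a i e => [/\ ev s i < lmax, ev s e < M & Q (seta s a (ev s i) (ev s e))]
  | In r i => ev s i < off /\ Q (setr s r (rw s (ev s i)))
  | Out i e => [/\ ev s i < off, ev s e < M & Q (setw s (ev s i) (ev s e))]
  | Seq p q => wp p (wp q Q) s
  | If e p q => if ev s e != 0 then wp p Q s else wp q Q s
  | For r b p =>
      rg s b <= env b /\
      exists I : nat -> st -> Prop,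
      [/\ I 0 (setr s r 0),
          forall i s', i < rg s b -> rg s' r = i -> rg s' b = rg s b -> I i s' ->
            wp p (fun s'' => I i.+1 (setr s'' r i.+1)) s'
        & forall s', rg s' r = rg s b -> I (rg s b) s' -> Q s']
  end.

Lemma wp_mono p (Q Q' : st -> Prop) s :
  (forall s', Q s' -> Q' s') -> wp p Q s -> wp p Q' s.
Proof.
elim: p Q Q' s => [|r e|a i e|r i|i e|p IHp q IHq|e p IHp q IHq|r b p IHp] Q Q' s QQ' /=.
- exact: QQ'.
- by case=> ? /QQ'.
- by case=> ? ? /QQ'.
- by case=> ? /QQ'.
- by case=> ? ? /QQ'.
- by apply: IHp => s'; apply: IHq.
- by case: ifP => _; [apply: IHp|apply: IHq].
- case=> hb [I [I0 IS IQ]]; split=> //; exists I; split=> // s' h /(IQ _ h); exact: QQ'.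
Qed.

Lemma frame_cat1 p q s s' s2 : frame p s s' -> frame q s' s2 -> frame (Seq p q) s s2.
Proof.
case=> r1 a1 o1 [r2 a2 o2]; split=> /= [r|a i|].
- by rewrite mem_cat negb_or => /andP[h1 h2]; rewrite r2 ?r1.
- by rewrite mem_cat negb_or => /andP[h1 h2]; rewrite a2 ?a1.
- by rewrite negb_or => /andP[h1 h2] i; rewrite o2 ?o1.
Qed.

Lemma frame_for r b p s s' s2 i : frame (For r b p) s s' -> frame p s' s2 ->
  frame (For r b p) s (setr s2 r i).
Proof.
case=> r1 a1 o1 [r2 a2 o2]; split=> /= [r0|a j|].
- rewrite inE negb_or => /andP[h1 h2]; rewrite /upd (negbTE h1) r2 ?r1 //=.
  by rewrite inE negb_or h1.
- by move=> h; rewrite a2 ?a1.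
- by move=> h j; rewrite o2 ?o1.
Qed.

(** Thanks to this, invariants only have to mention what a program changes. *)
Lemma wp_frame p Q s : wp p Q s -> wp p (fun s' => Q s' /\ frame p s s') s.
Proof.
elim: p Q s => [|r e|a i e|r i|i e|p IHp q IHq|e p IHp q IHq|r b p IHp] Q s /=.
- by move=> h; split.
- case=> h1 h2; split=> //; split=> //; split=> //= r0; rewrite inE /upd => /negbTE ->//.
- case=> h1 h2 h3; split=> //; split=> //; split=> //= a0 i0; rewrite inE /upd => /negbTE -> //.
- case=> h1 h2; split=> //; split=> //; split=> //= r0; rewrite inE /upd => /negbTE ->//.
- by case=> h1 h2 h3; split=> //; split=> //; split.
- move=> /IHp; apply: wp_mono => s' [/IHq h f]; move: h.
  by apply: wp_mono => s2 [? f2]; split=> //; apply: frame_cat1 f2.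
- case: ifP => _.
    move=> /IHp; apply: wp_mono => s' [? [f1 f2 f3]]; split=> //; split=> /= [r|a j|].
    + by rewrite mem_cat negb_or => /andP[h1 h2]; rewrite f1.
    + by rewrite mem_cat negb_or => /andP[h1 h2]; rewrite f2.
    + by rewrite negb_or => /andP[h1 h2] i; rewrite f3.
  move=> /IHq; apply: wp_mono => s' [? [f1 f2 f3]]; split=> //; split=> /= [r|a j|].
    + by rewrite mem_cat negb_or => /andP[h1 h2]; rewrite f1.
    + by rewrite mem_cat negb_or => /andP[h1 h2]; rewrite f2.
    + by rewrite negb_or => /andP[h1 h2] i; rewrite f3.
- case=> hb [I [I0 IS IQ]]; split=> //.
  exists (fun i s' => I i s' /\ frame (For r b p) s s'); split.
  + by split=> //; apply: frame_for (frame_refl _ _) (frame_refl p s).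
  + move=> i s' hi hr hb' [Ii Fi]; have := IHp _ _ (IS i s' hi hr hb' Ii).
    by apply: wp_mono => s2 [I2 F2]; split=> //; apply: frame_for F2.
  + by move=> s' h [/(IQ _ h) ? ?].
Qed.

Lemma wp_seq p q (Q R : st -> Prop) s :
  wp p R s -> (forall s', R s' -> frame p s s' -> wp q Q s') -> wp (Seq p q) Q s.
Proof. by move=> /wp_frame h1 h2 /=; apply: wp_mono h1 => s' [h f]; apply: h2. Qed.

Lemma wp_conseq p (Q R : st -> Prop) s :
  wp p R s -> (forall s', R s' -> frame p s s' -> Q s') -> wp p Q s.
Proof. by move=> /wp_frame h1 h2 /=; apply: wp_mono h1 => s' [h f]; apply: h2. Qed.

Lemma wp_for r b p (I : nat -> st -> Prop) Q s :
  rg s b <= env b ->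
  I 0 (setr s r 0) ->
  (forall i s', i < rg s b -> rg s' r = i -> rg s' b = rg s b -> I i s' ->
     frame (For r b p) s s' -> wp p (fun s'' => I i.+1 (setr s'' r i.+1)) s') ->
  (forall s', rg s' r = rg s b -> I (rg s b) s' -> frame (For r b p) s s' -> Q s') ->
  wp (For r b p) Q s.
Proof.
move=> hb I0 IS IQ /=; split=> //.
exists (fun i s' => I i s' /\ frame (For r b p) s s'); split.
- by split=> //; apply: frame_for (frame_refl _ _) (frame_refl p s).
- move=> i s' hi hr hb' [Ii Fi]; have := wp_frame (IS i s' hi hr hb' Ii Fi).
  by apply: wp_mono => s2 [I2 F2]; split=> //; apply: frame_for F2.
- by move=> s' h [/(IQ _ h) ? ?]; auto.
Qed.

Variables (cells bits : nat).
Hypothesis hM : M <= 2 ^ bits.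
Hypothesis hcells : off + narr * lmax <= cells.

Definition sim s (c : state) :=
  [/\ forall r, regs c r = rg s r,
      forall a i, a < narr -> ram c (off + (narr * i + a)) = ar s a i,
      forall i, i < off -> ram c i = rw s i & rg s 0 = off].

Lemma cexP s c e : sim s c -> okx e -> eval c (cex e) = ev s e.
Proof.
case=> h1 h2 h3 h4; elim: e => //= [a i IH /andP[ha hi]|o e1 IH1 e2 IH2 /andP[/IH1 -> /IH2 ->] //].
by rewrite h1 h4 IH // h2.
Qed.

Lemma sim_setr s c r x : r != 0 -> sim s c ->
  sim (setr s r x) (State (upd (regs c) r x) (ram c)).
Proof.
move=> r0 [h1 h2 h3 h4]; split=> //= [r'|]; rewrite /upd ?h1 //.
by rewrite eq_sym (negbTE r0).
Qed.

Lemma fits_setr c r x : x < M -> fits cells bits c ->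
  fits cells bits (State (upd (regs c) r x) (ram c)).
Proof.
move=> hx [f1 f2 f3]; split=> //= r'; rewrite /upd; case: ifP => // _.
exact: leq_trans hx hM.
Qed.

Lemma fits_sto c a x : a < cells -> x < M -> fits cells bits c ->
  fits cells bits (State (regs c) (upd (ram c) a x)).
Proof.
move=> ha hx [f1 f2 f3]; split=> //= a'; rewrite /upd.
  case: eqP => [-> h|_]; [lia|exact: f1].
by case: ifP => // _; exact: leq_trans hx hM.
Qed.

Theorem to_cmd_ok p Q s c : okp p -> wp p Q s -> sim s c -> fits cells bits c ->
  exists t c' s', [/\ exec cells bits (to_cmd p) c t c', t <= tm env p,
     sim s' c', fits cells bits c' & Q s'].
Proof.
move=> ok w; have : wp p (fun s' => Q s' /\ frame p s s') s by exact: wp_frame.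
move=> {w}; suff H : okp p -> forall Q, wp p Q s -> sim s c -> fits cells bits c ->
  exists t c' s', [/\ exec cells bits (to_cmd p) c t c', t <= tm env p,
     sim s' c', fits cells bits c' & Q s'].
  by move=> /(H ok){}H hs hf; have [t [c' [s' [? ? ? ? []]]]] := H hs hf; exists t, c', s'.
move=> {ok Q}.
elim: p s c => [|r e|a i e|r i|i e|p IHp q IHq|e p IHp q IHq|r b p IHp] s c /= ok Q w hs hf.
- by exists 1, c, s; split=> //; constructor.
- case/andP: ok => r0 oke; case: w => w1 w2.
  exists (eval_time (cex e)).+1, (State (upd (regs c) r (eval c (cex e))) (ram c)), (setr s r (ev s e)).
  rewrite (cexP hs oke); split=> //.
  + by rewrite -(cexP hs oke); apply: exec_set; rewrite (cexP hs oke); apply: fits_setr.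
  + exact: sim_setr.
  + exact: fits_setr.
- case/and3P: ok => ha oki oke; case: w => w1 w2 w3.
  have ea : eval c (cadr a i) = off + (narr * ev s i + a).
    by rewrite /= (cexP hs oki); case: hs => h1 _ _ h4; rewrite h1 h4.
  have hcl : off + (narr * ev s i + a) < cells by move: ha hcells w1; rewrite /narr; lia.
  have hf' := fits_sto hcl w2 hf.
  eexists _, _, (seta s a (ev s i) (ev s e)); split; last exact: w3.
  + apply: exec_store; rewrite (cexP hs oke) ea; exact: hf'.
  + done.
  + rewrite (cexP hs oke) ea; case: hs => h1 h2 h3 h4; split=> //= [a' i' ha'|i' hi'].
      rewrite /upd; case: (eqVneq a' a) => [->|na].
        rewrite (_ : (off + _ == _) = (i' == ev s i)) ?h2 //.
        by rewrite eqn_add2l eqn_add2r eqn_mul2l.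
      (* Array numbers are residues modulo [narr], so distinct arrays never share a cell. *)
      rewrite (_ : (off + _ == _) = false) ?h2 //; apply/eqP => h.
      by move: ha' ha na h; rewrite /narr; lia.
    by rewrite /upd ltn_eqF ?h3 //; lia.
  + by rewrite (cexP hs oke) ea.
- case/andP: ok => r0 oke; case: w => w1 w2.
  have ee : eval c (ELoad (cex i)) = rw s (ev s i).
    by rewrite /= (cexP hs oke); case: hs => _ _ h3 _; rewrite h3.
  have hf' : fits cells bits (State (upd (regs c) r (rw s (ev s i))) (ram c)).
    case: hf => f1 f2 f3; split=> //= r'; rewrite /upd; case: ifP => // _.
    by case: hs => _ _ h3 _; rewrite -h3.
  eexists _, _, (setr s r (rw s (ev s i))); split; last exact: w2.
  + by apply: exec_set; rewrite ee.
  + done.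
  + by rewrite ee; apply: sim_setr.
  + by rewrite ee.
- case/andP: ok => oki oke; case: w => w1 w2 w3.
  have ea : eval c (cex i) = ev s i by rewrite (cexP hs oki).
  have hcl : ev s i < cells by lia.
  have hf' := fits_sto hcl w2 hf.
  eexists _, _, (setw s (ev s i) (ev s e)); split; last exact: w3.
  + apply: exec_store; rewrite (cexP hs oke) ea; exact: hf'.
  + done.
  + rewrite (cexP hs oke) ea; case: hs => h1 h2 h3 h4; split=> //= [a' i' ha'|i' hi'].
      by rewrite /upd gtn_eqF ?h2 //; lia.
    by rewrite /upd h3.
  + by rewrite (cexP hs oke) ea.
- case/andP: ok => okp' okq.
  have [t1 [c1 [s1 [x1 l1 hs1 hf1 w1]]]] := IHp _ _ okp' _ w hs hf.
  have [t2 [c2 [s2 [x2 l2 hs2 hf2 w2]]]] := IHq _ _ okq _ w1 hs1 hf1.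
  exists (t1 + t2), c2, s2; split=> //; [exact: exec_seq x1 x2|lia].
- case/and3P: ok => oke okp' okq; case: ifP w => he w.
    have [t1 [c1 [s1 [x1 l1 hs1 hf1 w1]]]] := IHp _ _ okp' _ w hs hf.
    exists (eval_time (cex e) + t1).+1, c1, s1; split=> //; first by apply: exec_if_true; last exact: x1; rewrite (cexP hs oke).
    by lia.
  have [t1 [c1 [s1 [x1 l1 hs1 hf1 w1]]]] := IHq _ _ okq _ w hs hf.
  exists (eval_time (cex e) + t1).+1, c1, s1; split=> //.
    by apply: exec_if_false; last exact: x1; rewrite (cexP hs oke); apply/eqP/negbFE.
  lia.
- case/and5P: ok => r0 rb rp bp okp'; case: w => hb [I [I0 IS IQ]].
  set N := rg s b.
  have hN : N < 2 ^ bits by case: hf => _ _ f3; case: hs => h1 _ _ _; rewrite /N -h1.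
  have hfr x c0 : x <= N -> fits cells bits c0 ->
      fits cells bits (State (upd (regs c0) r x) (ram c0)).
    move=> hx [f1 f2 f3]; split=> //= r'; rewrite /upd; case: ifP => // _.
    exact: leq_ltn_trans hx hN.
  set body := CSeq _ (CSet r (EBin OpAdd _ _)).
  (* Induction on the number [d] of iterations that are left. *)
  have H d : forall i s' c', d + i = N -> rg s' r = i -> rg s' b = N -> I i s' ->
      sim s' c' -> fits cells bits c' ->
      exists t c2 s2, [/\ exec cells bits (CWhile (EBin OpLt (EReg r) (EReg b)) body) c' t c2,
        t <= 4 + d * (8 + tm env p), sim s2 c2, fits cells bits c2 & Q s2].
    elim: d => [|d IH] i s' c' hd hr hb' Ii hs' hf'.
      exists 4, c', s'; split=> //.
      + apply: exec_while_end => /=; case: hs' => h1 _ _ _.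
        by rewrite !h1 hr hb' -hd ltnn.
      + by apply: IQ => //; rewrite -/N -hd ?hr //; move: hd; rewrite add0n => ->.
    have hi : i < N by lia.
    (* The frame of the body shows that counter and bound have survived it. *)
    have [t1 [c1 [s1 [x1 l1 hs1 hf1 [w1 fr1]]]]] := IHp _ _ okp' _ (wp_frame (IS i s' hi hr hb' Ii)) hs' hf'.
    case: fr1 => fr1 _ _.
    have e1 : rg s1 r = i by rewrite fr1.
    have e2 : rg s1 b = N by rewrite fr1.
    set c1' := State (upd (regs c1) r i.+1) (ram c1).
    have ee : eval c1 (EBin OpAdd (EReg r) (EConst 1)) = i.+1.
      by rewrite /=; case: hs1 => -> _ _ _; rewrite e1 addn1.
    have hf1' : fits cells bits c1' by apply: hfr.
    have e3 : rg (setr s1 r i.+1) b = N by rewrite /= /upd eq_sym (negbTE rb).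
    have [t2 [c2 [s2 [x2 l2 hs2 hf2 w2]]]] := IH i.+1 (setr s1 r i.+1) c1'
        ltac:(lia) ltac:(by rewrite /= /upd eqxx) e3 w1 (sim_setr i.+1 r0 hs1) hf1'.
    have xb : exec cells bits body c' (t1 + 4) c1'.
      apply: exec_seq x1 _; rewrite /c1' -ee; apply: exec_set.
      by rewrite ee.
    exists (3 + (t1 + 4) + t2).+1, c2, s2; split=> //.
    + apply: exec_while_step; [|exact: xb|exact: x2] => /=; case: hs' => h1 _ _ _.
      by rewrite !h1 hr hb' hi.
    + by rewrite mulSn; lia.
  have hs0 := sim_setr 0 r0 hs.
  have hf0 := hfr 0 _ (leq0n _) hf.
  have e3 : rg (setr s r 0) b = N by rewrite /= /upd eq_sym (negbTE rb).
  have [t2 [c2 [s2 [x2 l2 hs2 hf2 w2]]]] := H N 0 (setr s r 0) _ (addn0 _) ltac:(by rewrite /= /upd eqxx) e3 I0 hs0 hf0.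
  exists (2 + t2), c2, s2; split=> //.
  + by apply: exec_seq x2; apply: exec_set.
  + have : N * (8 + tm env p) <= env b * (8 + tm env p) by rewrite leq_mul2r hb orbT.
    lia.
Qed.

End WP.

(** * Connections of bounded cost *)

Section Connections.

Variables (n : nat).
Implicit Types (A E F : {set {set 'I_n}}) (X Y K V : {set 'I_n}).

Lemma adjC E u v : adj E u v = adj E v u.
Proof. by rewrite /adj setUC. Qed.

Lemma adj_sub E F u v : E \subset F -> adj E u v -> adj F u v.
Proof. by move=> /subsetP; apply. Qed.

Lemma connect_adj_sub E F u v :
  E \subset F -> connect (adj E) u v -> connect (adj F) u v.
Proof. by move=> EF; apply: connect_sub => x y /(adj_sub EF)/connect1. Qed.

Lemma connect_adjC E u v : connect (adj E) u v = connect (adj E) v u.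
Proof. by apply: sym_connect_sym => x y; exact: adjC. Qed.

Lemma weight_sub cost A F : A \subset F -> weight cost A <= weight cost F.
Proof. by move=> h; rewrite /weight [leqRHS](big_setID A) /= (setIidPr h) leq_addr. Qed.

Lemma weightU cost A F : weight cost (A :|: F) <= weight cost A + weight cost F.
Proof.
rewrite {1}/weight (big_setID A) /= setUK leq_add2l.
by rewrite setDUl setDv set0U; apply: weight_sub; exact: subsetDl.
Qed.

Definition joined A X := forall x y, x \in X -> y \in X -> connect (adj A) x y.

Variables (E : {set {set 'I_n}}) (cost : {set 'I_n} -> nat) (BIG : nat).

(* From [BIG] on, a cost stands for "no connection". *)
Definition cheap (c : nat) X : Prop :=
  c < BIG -> exists A, [/\ A \subset E, weight cost A <= c & joined A X].

Lemma cheap_sub c c' X Y : c <= c' -> Y \subset X -> cheap c X -> cheap c' Y.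
Proof.
move=> cc /subsetP YX h hc; case: h => [|A [AE Ac AX]]; first exact: leq_ltn_trans hc.
by exists A; split=> // [|x y /YX hx /YX hy]; [exact: leq_trans cc|exact: AX].
Qed.

Lemma cheap1 x : cheap 0 [set x].
Proof.
move=> _; exists set0; split; rewrite ?sub0set // ?/weight ?big_set0 //.
by move=> y z; rewrite !inE => /eqP -> /eqP ->.
Qed.

(** Two connecting edge sets with a common vertex are united. Cycles may arise, which is why [cheap]
    does not ask for a tree. *)
Lemma cheap_glue x c1 c2 X Y : x \in X -> x \in Y ->
  cheap c1 X -> cheap c2 Y -> cheap (c1 + c2) (X :|: Y).
Proof.
move=> xX xY h1 h2 hc.
case: h1 => [|A [AE Ac AX]]; first lia.
case: h2 => [|F [FE Fc FY]]; first lia.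
exists (A :|: F); split.
- by rewrite subUset AE.
- by apply: leq_trans (weightU _ _ _) _; apply: leq_add.
have H y : y \in X :|: Y -> connect (adj (A :|: F)) x y.
  rewrite inE => /orP[yX|yY].
    by apply: connect_adj_sub (AX _ _ xX yX); exact: subsetUl.
  by apply: connect_adj_sub (FY _ _ xY yY); exact: subsetUr.
move=> y z hy hz; apply: connect_trans (H z hz).
by rewrite connect_adjC; exact: H.
Qed.

Definition cmat (u v : 'I_n) := if adj E u v then cost [set u; v] else BIG.

Lemma cmatC u v : cmat u v = cmat v u.
Proof. by rewrite /cmat adjC setUC. Qed.

Lemma cheap_cmat u v : cheap (cmat u v) [set u; v].
Proof.
rewrite /cmat; case: ifP => [uv _|_]; last by rewrite /cheap ltnn.
exists [set [set u; v]]; split; first by rewrite sub1set.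
- by rewrite /weight big_set1.
have h : connect (adj [set [set u; v]]) u v by apply: connect1; rewrite /adj set11.
move=> x y; rewrite !inE => /orP[] /eqP -> /orP[] /eqP -> //.
by rewrite connect_adjC.
Qed.

Lemma cycle_edge_connected F p (x y : 'I_n) :
  ucycle (adj F) [:: x, y & p] -> 0 < size p ->
  connect (adj (F :\ [set x; y])) x y.
Proof.
case/andP=> /= /andP[_ pth] /andP[xp /andP[yp _]] sp.
rewrite connect_adjC; apply/connectP.
move: xp; rewrite inE negb_or => /andP[xy xp].
(* the walk y, p, x avoids the edge {x, y} *)
exists (rcons p x); last by rewrite last_rcons.
case: p sp pth yp xp => // z p _.
rewrite rcons_cons /= => /andP[yz pth]; rewrite !inE !negb_or => /andP[nyz yp] /andP[nxz xp].
apply/andP; split.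
  rewrite /adj in_setD1 [X in _ && X]yz andbT; apply/eqP => /setP/(_ x).
  by rewrite !inE eqxx (negbTE xy) (negbTE nxz).
elim: p z nyz nxz yp xp pth {yz} => [|w p IH] z nyz nxz /=.
  move=> _ _; rewrite !andbT => zx; rewrite /adj in_setD1 [X in _ && X]zx andbT.
  apply/eqP => /setP/(_ y); rewrite !inE eqxx (negbTE nyz).
  by rewrite eq_sym (negbTE xy).
rewrite !inE !negb_or => /andP[nyw yp] /andP[nxw xp] /andP[zw pth].
rewrite IH // andbT /adj in_setD1 [X in _ && X]zw andbT.
apply/eqP => /setP/(_ y); rewrite !inE eqxx (negbTE nyz) (negbTE nyw).
by rewrite orbT.
Qed.

(** An inclusion-minimal edge set spanning the component of [x] is a tree, since an edge on a cycle
    could be dropped. *)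
Lemma cheap_steiner c X K x : cheap c X -> c < BIG -> x \in X -> K \subset X ->
  exists V F, steiner_tree E K V F /\ weight cost F <= c.
Proof.
move=> h hc xX KX; case: (h hc) => A [AE Ac AX].
pose V := [set v | connect (adj A) x v].
pose P F := [&& F \subset A, [forall e in F, e \subset V]
              & [forall v in V, connect (adj F) x v]].
have Pex : exists F, P F.
  exists [set e in A | e \subset V]; apply/and3P; split.
  - by apply/subsetP => e; rewrite inE => /andP[].
  - by apply/forall_inP => e; rewrite inE => /andP[].
  apply/forall_inP => v; rewrite inE => /connectP[p].
  elim/last_ind: p v => [v _ ->|p z IH v]; first exact: connect0.
  rewrite rcons_path last_rcons => /andP[pth hz] ->.
  apply: connect_trans (IH _ pth erefl) _; apply: connect1.
  rewrite /adj inE [X in X && _]hz; apply/subsetP => w; rewrite !inE => /orP[] /eqP ->.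
    by apply/connectP; exists p.
  by apply/connectP; exists (rcons p z); rewrite ?rcons_path ?pth ?last_rcons.
have [F /minsetP[/and3P[FA /forall_inP FV /forall_inP Fc] Fmin]] := ex_minset Pex.
exists V, F; split; last exact: leq_trans (weight_sub _ FA) Ac.
split.
- by split=> //; exact: subset_trans FA AE.
- split.
  + by apply/set0Pn; exists x; rewrite inE connect0.
  + move=> u v uV vV; apply: connect_trans (Fc v vV).
    by rewrite connect_adjC; apply: Fc.
  + move=> [|a [|b p]] //= sp cyc.
    have ab : [set a; b] \in F by case/andP: cyc => /= /andP[].
    suff PF : P (F :\ [set a; b]).
      have /setP/(_ [set a; b]) := Fmin _ PF (subsetDl _ _).
      by rewrite !inE eqxx ab.
    have cab := cycle_edge_connected cyc sp.
    apply/and3P; split.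
    * exact: subset_trans (subsetDl _ _) FA.
    * by apply/forall_inP => e; rewrite inE => /andP[_]; exact: FV.
    apply/forall_inP => v /Fc; apply: connect_sub => u w uw.
    case: (eqVneq [set u; w] [set a; b]) => [euw|nuw]; last first.
      by apply: connect1; rewrite /adj in_setD1 nuw.
    have : u \in [set a; b] by rewrite -euw !inE eqxx.
    have : w \in [set a; b] by rewrite -euw !inE eqxx orbT.
    rewrite !inE => /orP[] /eqP -> /orP[] /eqP -> //.
    by rewrite connect_adjC.
by apply/subsetP => t tK; rewrite inE; apply: AX => //; exact: (subsetP KX).
Qed.

End Connections.

Arguments cheap_glue {n E cost BIG} x {c1 c2 X Y} _ _ _ _.

(** * The stack machine and its soundness *)

Ltac mem_cases y :=
  rewrite ?inE ?mem_cat ?inE ?mem_cat ?inE ?in_nil;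
  repeat match goal with
  | |- context [y == ?z] => case: (y == z)
  | |- context [y \in ?z] => case: (y \in z)
  end; rewrite ?orbT ?andbF.

Section Machine.

Variables (n : nat) (D : 'I_n -> 'I_n -> nat) (BIG : nat).

(** The table maps [v] and [t] to the cost of reaching the component from [v] when [t] fills its
    slot; the flag tells whether there is a slot. *)
Definition entry := (('I_n -> 'I_n -> nat) * bool)%type.
Definition instr := (nat * 'I_n)%type.

(** The min-plus step of the Dreyfus-Wagner recursion: both components meet in [u], to which [v] is
    linked by a shortest path. *)
Definition mergetab (F G : 'I_n -> 'I_n -> nat) v t :=
  \big[minn/BIG]_u (D v u + F u t + G u t).

(* Opcodes: 0 = leaf, 1 = cut (then leaf), 2 = slot, 3 = merge. *)
Definition step (st : seq entry) (i : instr) : seq entry :=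
  if i.1 < 2 then (fun v _ => D v i.2, false) :: (if i.1 == 1 then behead st else st)
  else if i.1 == 2 then (D, true) :: st
  else if st is e1 :: e2 :: st' then (mergetab e1.1 e2.1, e1.2 || e2.2) :: st'
  else st.

(** A cost as a function of the vertex chosen for the slot, and whether this choice connects that
    vertex. Only a cut charges anything. *)
Definition charge := (('I_n -> nat) * bool)%type.

Definition charge_of (st : seq entry) (i : instr) : charge :=
  if i.1 == 1 then if st is e :: _ then (e.1 i.2, e.2) else (fun=> 0, false)
  else (fun=> 0, false).

Fixpoint charges st (c : seq instr) : seq charge :=
  if c is i :: c' then charge_of st i :: charges (step st i) c' else [::].

Definition charged (cs : seq charge) (xs : seq 'I_n) : nat :=
  \sum_(p <- zip cs xs) p.1.1 p.2.

Definition served (cs : seq charge) (xs : seq 'I_n) : seq 'I_n :=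
  [seq p.2 | p <- zip cs xs & p.1.2].

Definition labels (c : seq instr) : seq 'I_n := [seq i.2 | i <- c & i.1 < 2].

(** What is saved when [t] fills a slot, since otherwise [t] has to be linked to its nearest label.
    It vanishes outside [K], so slots may be offered to all vertices alike. *)
Definition profit (K : {set 'I_n}) (c : seq instr) t :=
  if t \in K then \big[minn/BIG]_(s <- labels c) D s t else 0.

(** [e] is the entry left on the stack. A slot still open in it is filled by [x] itself, so the
    formula is meaningful for every code that ends with one entry. *)
Definition value K (c : seq instr) (xs : seq 'I_n) (e : entry) (x : 'I_n) : nat :=
  let cs := charges [::] c in
  charged cs xs + e.1 x x + \sum_(t | t \notin served cs xs) profit K c t.

Lemma size_charges st c : size (charges st c) = size c.
Proof. by elim: c st => //= i c IH st; rewrite IH. Qed.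

Lemma charges_cat st c1 c2 :
  charges st (c1 ++ c2) = charges st c1 ++ charges (foldl step st c1) c2.
Proof. by elim: c1 st => //= i c IH st; rewrite IH. Qed.

Lemma charged_cat cs1 cs2 xs1 xs2 : size cs1 = size xs1 ->
  charged (cs1 ++ cs2) (xs1 ++ xs2) = charged cs1 xs1 + charged cs2 xs2.
Proof. by move=> h; rewrite /charged zip_cat // big_cat. Qed.

Lemma served_cat cs1 cs2 xs1 xs2 : size cs1 = size xs1 ->
  served (cs1 ++ cs2) (xs1 ++ xs2) = served cs1 xs1 ++ served cs2 xs2.
Proof. by move=> h; rewrite /served zip_cat // filter_cat map_cat. Qed.

Lemma labels_cat c1 c2 : labels (c1 ++ c2) = labels c1 ++ labels c2.
Proof. by rewrite /labels filter_cat map_cat. Qed.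

Lemma bigmin_le_init (I : Type) (r : seq I) b (F : I -> nat) :
  \big[minn/b]_(i <- r) F i <= b.
Proof. by elim/big_rec: _ => // i x _ h; rewrite geq_min h orbT. Qed.

Lemma bigmin_le_seq (I : eqType) (r : seq I) b (F : I -> nat) i :
  i \in r -> \big[minn/b]_(i <- r) F i <= F i.
Proof.
elim: r => // j r IH; rewrite inE big_cons geq_min => /orP[/eqP ->|/IH ->].
  by rewrite leqnn.
by rewrite orbT.
Qed.

Lemma bigmin_leP (I : finType) b (F : I -> nat) i : \big[minn/b]_i F i <= F i.
Proof. by apply: bigmin_le_seq; rewrite mem_index_enum. Qed.

Lemma bigmin_attained (I : eqType) (r : seq I) b (F : I -> nat) :
  \big[minn/b]_(i <- r) F i < b ->
  exists2 i, i \in r & \big[minn/b]_(i <- r) F i = F i.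
Proof.
elim: r => [|j r IH]; rewrite ?big_nil ?ltnn // big_cons => h.
move: h; case: (leqP (F j) (\big[minn/b]_(i <- r) F i)) => hj h.
  by exists j; first exact: mem_head.
have [i ir ->] := IH h.
by exists i; rewrite ?inE ?ir ?orbT.
Qed.

(** * Every value is the cost of a connection *)

Section Soundness.

Variables (E : {set {set 'I_n}}) (cost : {set 'I_n} -> nat).
Notation cheap := (cheap E cost BIG).
Hypothesis HD : forall u v, cheap (D u v) [set u; v].

(* The component built by [e] contains [X] and has been charged [c] so far;
   reaching it from [v] and connecting the slot to [t] costs [e.1 v t] more. *)
Definition sound_entry (e : entry) c X :=
  forall v t, cheap (e.1 v t + c) (v |: (if e.2 then t |: X else X)).

(** Components of different entries need not be connected to each other; only their charges and
    vertex sets add up. *)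
Fixpoint sound_stack (s : seq entry) c (X : {set 'I_n}) : Prop :=
  if s is e :: s' then
    exists c1 X1 c2 X2, [/\ c = c1 + c2, X = X1 :|: X2, sound_entry e c1 X1
                          & sound_stack s' c2 X2]
  else X = set0.

Lemma sound_leaf s : sound_entry (fun v _ => D v s, false) 0 [set s].
Proof. by move=> v t /=; rewrite addn0. Qed.

(** A cut links the top component to the label [l] at the price of its charge, and the leaf [l] then
    represents it on the stack. Hence nothing that has been connected is ever lost. *)
Lemma sound_step s c X i x : sound_stack s c X ->
  sound_stack (step s i) (c + (charge_of s i).1 x)
    (X :|: [set y in (if i.1 < 2 then [:: i.2] else [::]) ++
                     (if (charge_of s i).2 then [:: x] else [::])]).
Proof.
case: i => o l; rewrite /step /charge_of /=.
case: (ltnP o 2) => ho.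
  case: (eqVneq o 1) => o1; last first.
    rewrite addn0 cats0 => hs; exists 0, [set l], c, X; split=> //=.
    - by rewrite setUC; congr (_ :|: _); apply/setP => y; rewrite !inE.
    - exact: sound_leaf.
  case: s => [|e s] /= => [->|].
    exists 0, [set l], (c + 0), set0; split=> //=.
    - by apply/setP => y; rewrite !inE orbF.
    - exact: sound_leaf.
  case=> c1 [X1 [c2 [X2 [-> -> he hs]]]].
  exists (c1 + e.1 l x), (X1 :|: [set y in l :: (if e.2 then [:: x] else [::])]), c2, X2.
  split=> //; first lia.
  - by rewrite setUAC.
  move=> v t /=; have H := cheap_glue l _ _ (@HD v l) (he l x).
  apply: cheap_sub (H _ _); first lia.
  - by apply/subsetP => y; case: e.2; mem_cases y.
  - by rewrite !inE eqxx orbT.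
  - by rewrite !inE eqxx.
case: (eqVneq o 2) => o2 /=.
  rewrite (_ : o == 1 = false) ?o2 //= addn0 => hs.
  exists 0, set0, c, X; split=> //.
    by apply/setP => y; rewrite !inE orbF.
  by move=> v t /=; rewrite addn0 setU0.
have -> : (o == 1) = false by apply/eqP; lia.
rewrite /= addn0.
have -> : X :|: [set y in [::]] = X by apply/setP => y; rewrite !inE orbF.
case: s => [|e1 [|e2 s]] //=.
case=> c1 [X1 [_ [_ [-> -> h1 [c2 [X2 [c3 [X3 [-> -> h2 hs]]]]]]]]].
exists (c1 + c2), (X1 :|: X2), c3, X3; split; rewrite ?addnA ?setUA //.
move=> v t /= hlt.
have hm : mergetab e1.1 e2.1 v t < BIG by lia.
(* Below [BIG] the minimum is attained, which yields the vertex where the components meet. *)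
have [u _ hu] := bigmin_attained hm.
move: hlt; rewrite /mergetab hu.
have h12 := cheap_glue u _ _ (h1 u t) (h2 u t).
have h := cheap_glue u _ _ (@HD v u) (h12 _ _).
suff : cheap (D v u + e1.1 u t + e2.1 u t + (c1 + c2))
         (v |: (if e1.2 || e2.2 then t |: (X1 :|: X2) else X1 :|: X2)) by [].
apply: cheap_sub (h _ _ _ _); first lia.
- by apply/subsetP => y; case: e1.2; case: e2.2; mem_cases y.
all: by rewrite !inE eqxx ?orbT.
Qed.

Lemma sound_run s c X k xs : size xs = size k -> sound_stack s c X ->
  sound_stack (foldl step s k) (c + charged (charges s k) xs)
    (X :|: [set y in labels k ++ served (charges s k) xs]).
Proof.
elim: k s c X xs => [|i k IH] s c X [|x xs] //=.
  rewrite /charged big_nil addn0 => _.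
  by have -> : X :|: [set y in [::]] = X by apply/setP => y; rewrite !inE orbF.
case=> hsz /(sound_step i x)/(IH _ _ _ _ hsz).
rewrite /charged /= big_cons -addnA -setUA.
congr (sound_stack _ _ (_ :|: _)); apply/setP => y.
rewrite /labels /served /=.
by case: (i.1 < 2); case: (charge_of s i).2; mem_cases y.
Qed.

(** All labels belong to the final component, so an unserved terminal can be linked to the label
    that realises its profit. *)
Lemma cheap_value K c xs e x : size xs = size c -> foldl step [::] c = [:: e] ->
  cheap (value K c xs e x) (x |: K).
Proof.
move=> hsz he.
have := sound_run (c := 0) hsz (erefl : sound_stack [::] _ set0).
rewrite he add0n set0U => -[c1 [X1 [c2 [X2 [e1 e2 hs /= e3]]]]].
rewrite {}e3 setU0 in e2; rewrite -{}e2 in hs.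
rewrite /value; set cs := charges _ _ in e1 hs *.
set Y := [set y in _] in hs.
have YP y : (y \in Y) = (y \in labels c) || (y \in served cs xs) by rewrite inE mem_cat.
clearbody Y.
have h0 : cheap (charged cs xs + e.1 x x) (x |: Y).
  apply: cheap_sub (hs x x); first lia.
  by case: e.2 => //; rewrite setUA setUid.
(* The sum is generalised to a list [r], so that the terminals are linked one by one. *)
have H (r : seq 'I_n) : cheap (charged cs xs + e.1 x x +
     \sum_(t <- r | t \notin served cs xs) profit K c t) (x |: (Y :|: [set t in r | (t \in K) && (t \notin served cs xs)])).
  elim: r => [|t r IH].
    rewrite big_nil addn0; apply: cheap_sub h0 => //; apply/subsetP => y.
    by mem_cases y.
  rewrite big_cons; case: ifP => ht; last first.
    apply: cheap_sub IH => //; apply/subsetP => y; rewrite !inE.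
    case: (eqVneq y t) => [->|] //=; rewrite ht andbF orbF.
    by move=> /orP[->//|->]; rewrite orbT.
  rewrite {1}/profit; case: ifP => tK; last first.
    apply: cheap_sub IH => //; apply/subsetP => y; rewrite !inE.
    case: (eqVneq y t) => [->|] //=; rewrite tK orbF.
    by move=> /orP[->//|->]; rewrite orbT.
  move=> hlt; have [|s sl hm] := @bigmin_attained _ (labels c) BIG (fun s => D s t).
    by apply: leq_ltn_trans hlt; rewrite addnCA leq_addr.
  move: hlt; rewrite hm.
  suff : cheap (D s t + (charged cs xs + e.1 x x + \sum_(j <- r | j \notin served cs xs) profit K c j))
     (x |: (Y :|: [set t0 in t :: r | (t0 \in K) && (t0 \notin served cs xs)])).
    by rewrite /cheap addnCA.
  have sY : s \in Y by rewrite YP sl.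
  apply: cheap_sub (cheap_glue s _ _ (@HD s t) IH) => //.
  - apply/subsetP => y; rewrite !inE.
    case: (y == t); rewrite ?orbT //= orbF.
    by move=> ->; rewrite orbT.
  - by rewrite !inE eqxx.
  - by rewrite !inE sY orbT.
apply: cheap_sub (H (index_enum _)); first by [].
apply/subsetP => y; rewrite !inE YP => /orP[->//|yK].
rewrite mem_index_enum yK /=.
by case: (y \in served _ _); rewrite ?orbT.
Qed.

End Soundness.
End Machine.

(** * Compiling a tree to the stack machine *)

(* [Graft T1 T2] hangs the root of [T2] below the root of [T1]. *)
Inductive gtree n := Leaf of 'I_n | Graft of gtree n & gtree n.

Section Trees.

Variable n : nat.
Implicit Types (T : gtree n) (E F : {set {set 'I_n}}).

Fixpoint root T := match T with Leaf v => v | Graft T1 _ => root T1 end.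

Fixpoint verts T :=
  match T with Leaf v => [:: v] | Graft T1 T2 => verts T1 ++ verts T2 end.

Fixpoint edges T :=
  match T with
  | Leaf v => [::]
  | Graft T1 T2 => [set root T1; root T2] :: edges T1 ++ edges T2
  end.

Fixpoint attach T x y :=
  match T with
  | Leaf v => Graft (Leaf v) (Leaf y)
  | Graft T1 T2 =>
      if x \in verts T1 then Graft (attach T1 x y) T2 else Graft T1 (attach T2 x y)
  end.

Lemma root_verts T : root T \in verts T.
Proof. by elim: T => [v|T1 IH1 T2 _] /=; rewrite ?mem_head // mem_cat IH1. Qed.

Lemma root_attach T x y : root (attach T x y) = root T.
Proof. by elim: T => [v|T1 IH1 T2 IH2] //=; case: ifP. Qed.

Lemma verts_attach T x y : perm_eq (verts (attach T x y)) (y :: verts T).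
Proof.
apply/permP => p; elim: T => [v|T1 IH1 T2 IH2] /=; first lia.
by case: ifP => _; rewrite /= !count_cat ?IH1 ?IH2 /=; lia.
Qed.

Lemma edges_attach T x y : x \in verts T ->
  perm_eq (edges (attach T x y)) ([set x; y] :: edges T).
Proof.
move=> xT; apply/permP => p; elim: T xT => [v|T1 IH1 T2 IH2] /=.
  by rewrite inE => /eqP ->.
rewrite mem_cat; case: ifP => /= [x1 _|_ x2]; rewrite root_attach !count_cat.
  by rewrite IH1 //=; lia.
by rewrite IH2 //=; lia.
Qed.

Lemma edges_verts T e z : e \in edges T -> z \in e -> z \in verts T.
Proof.
elim: T => //= T1 IH1 T2 IH2; rewrite inE mem_cat mem_cat => /or3P[/eqP ->|h1|h2].
- by rewrite !inE => /orP[] /eqP ->; rewrite root_verts ?orbT.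
- by move=> /(IH1 h1) ->.
- by move=> /(IH2 h2) ->; rewrite orbT.
Qed.

Lemma connect_crossing (e : rel 'I_n) (P : pred 'I_n) x y :
  connect e x y -> P x -> ~~ P y -> exists u v, [/\ P u, ~~ P v & e u v].
Proof.
move=> /connectP[p pth ->]; elim: p x pth => [x _ /= -> //|z p IH x /= /andP[xz pth] Px].
case: (boolP (P z)) => [Pz /(IH _ pth Pz)//|Pz _].
by exists x, z.
Qed.

(** By connectivity some edge leaves the vertex set reached so far, and its far end is attached.
    Distinctness of the edges will bound the cost of the tree by the weight of [F]. *)
Lemma spanning_gtree F (V : {set 'I_n}) s :
  (forall e, e \in F -> e \subset V) -> joined F V -> s \in V ->
  exists T, [/\ root T = s, uniq (verts T), verts T =i V, uniq (edges T)
              & {subset edges T <= F}].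
Proof.
move=> FV FJ sV.
have grow i : i < #|V| -> exists T, [/\ root T = s, uniq (verts T) /\ size (verts T) = i.+1,
    {subset verts T <= V}, uniq (edges T) & {subset edges T <= F}].
  elim: i => [_|i IH hi]; first by exists (Leaf s); split=> //= x; rewrite inE => /eqP ->.
  have [|T [rT [uT sT] TV ue eF]] := IH; first exact: ltnW.
  have [u uV uT'] : exists2 u, u \in V & u \notin verts T.
    apply/exists_inP; apply: contraLR hi; rewrite negb_exists_in => /forall_inP h.
    rewrite -leqNgt -sT -(card_uniqP uT); apply: subset_leq_card.
    by apply/subsetP => x xV; have := h x xV; rewrite negbK.
  have [x [y [xT yT xy]]] := connect_crossing (P := [in verts T]) (FJ s u sV uV)
    ltac:(by rewrite /= -rT root_verts) uT'.
  have yV : y \in V by apply: (subsetP (FV _ xy)); rewrite !inE eqxx orbT.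
  have pv := verts_attach T x y; have pe := edges_attach y xT.
  exists (attach T x y); split.
  - by rewrite root_attach.
  - by rewrite (perm_uniq pv) (perm_size pv) /= sT uT andbT yT.
  - by move=> z; rewrite (perm_mem pv) inE => /orP[/eqP ->|/TV].
  - rewrite (perm_uniq pe) /= ue andbT; apply/negP => /edges_verts h.
    by move/negP: yT; apply; apply: h; rewrite !inE eqxx orbT.
  - by move=> z; rewrite (perm_mem pe) inE => /orP[/eqP ->|/eF].
have V0 : 0 < #|V| by apply/card_gt0P; exists s.
have [|T [rT [uT sT] TV ue eF]] := grow #|V|.-1; first by rewrite prednK.
exists T; split=> // x; apply/idP/idP => [/TV //|xV].
have := subset_cardP (A := mem (verts T)) (B := mem V).
rewrite (card_uniqP uT) sT prednK // => /(_ erefl) h.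
have TVs : mem (verts T) \subset mem V by apply/subsetP => z /TV.
by move/h: TVs => /(_ x) ->.
Qed.

(** * From a Steiner tree to a short code of no larger value *)

Section Compile.

Variables (E : {set {set 'I_n}}) (cost : {set 'I_n} -> nat) (K S : {set 'I_n}).
(** [dst t] will be the distance from [t] to the vertices of [S] in the tree; [s0] labels the
    instructions whose label has no effect. *)
Variables (D : 'I_n -> 'I_n -> nat) (BIG : nat) (dst : 'I_n -> nat) (s0 : 'I_n).

Hypothesis cutS : multiway_cut E K S.
Hypothesis s0S : s0 \in S.
Hypothesis D0 : forall u, D u u = 0.
Hypothesis Dtri : forall u v w, D u v <= D u w + D w v.
Hypothesis DE : forall u v, adj E u v -> D u v <= cost [set u; v].

Notation step := (step D BIG).
Notation charges := (charges D BIG).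

Definition gcost T := \sum_(e <- edges T) cost e.

Fixpoint inside T :=
  match T with
  | Leaf _ => true
  | Graft T1 T2 => [&& adj E (root T1) (root T2), inside T1 & inside T2]
  end.

Lemma edges_inside T : {subset edges T <= E} -> inside T.
Proof.
elim: T => //= T1 IH1 T2 IH2 h; apply/and3P; split.
- by apply: h; rewrite mem_head.
- by apply: IH1 => e he; apply: h; rewrite inE mem_cat he orbT.
- by apply: IH2 => e he; apply: h; rewrite inE mem_cat he !orbT.
Qed.

Lemma gcost_graft T1 T2 :
  gcost (Graft T1 T2) = cost [set root T1; root T2] + (gcost T1 + gcost T2).
Proof. by rewrite /gcost /= big_cons big_cat. Qed.

Definition unserved (r ys : seq 'I_n) := \sum_(t <- r | (t \in K) && (t \notin ys)) dst t.

Lemma unserved_sub r ys zs : {subset ys <= zs} -> unserved r zs <= unserved r ys.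
Proof.
move=> h; rewrite /unserved big_mkcond [leqRHS]big_mkcond; apply: leq_sum => t _.
case: (t \in K) => //=; case: (boolP (t \in ys)) => [/h ->//|_].
by case: ifP.
Qed.

Lemma unserved_cat r1 r2 ys : unserved (r1 ++ r2) ys = unserved r1 ys + unserved r2 ys.
Proof. by rewrite /unserved big_cat. Qed.

Lemma unserved_one r t : uniq r -> unserved r [::] <= dst t + unserved r [:: t].
Proof.
move=> ur; rewrite /unserved; case: (boolP (t \in r)) => tr; last first.
  apply: leq_trans (leq_addl _ _); rewrite big_mkcond [leqRHS]big_mkcond.
  rewrite [leqLHS]big_seq [leqRHS]big_seq /=; apply: leq_sum => u ur'; rewrite !inE andbT.
  by case: eqP => [e|_]; rewrite ?andbT //; move: tr; rewrite -e ur'.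
rewrite big_mkcond [X in _ + X]big_mkcond !(bigD1_seq t) //= !inE eqxx andbF add0n.
apply: leq_add; first by case: ifP.
apply: leq_sum => u nut; rewrite !inE nut.
by case: (u \in K).
Qed.

(* The machine state built from [T]: [pend] holds the terminal (if any) that
   still has to be connected through the slot of the top entry. *)
Record built T c cs (xs : seq 'I_n) (e : entry n) (pend : seq 'I_n) : Prop := Built {
  b_cs : size cs = size c;
  b_xs : size xs = size c;
  b_run : forall st, foldl step st c = e :: st /\ charges st c = cs;
  b_lip : forall u v t, e.1 u t <= D u v + e.1 v t;
  b_flag : e.2 = (pend != [::]);
  b_pend1 : size pend <= 1;
  b_uniq : uniq (served cs xs ++ pend);
  b_sub : {subset served cs xs ++ pend <= verts T};
  b_pendK : forall t, t \in pend -> t \in K /\ connect (adj_minus E S) (root T) t;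
  b_root : root T \in S -> pend = [::];
  b_ops : all (fun i => (i.1 < 4) && (i.2 \in S)) c;
  b_lab : forall s, s \in S -> s \in verts T -> s \in labels c;
  b_cost : forall t, pend = [::] \/ pend = [:: t] ->
    e.1 (root T) t + charged cs xs + unserved (verts T) (served cs xs ++ pend) <= gcost T
}.

(** A potential argument. An open slot pays for two instructions, the slot itself and its merge. The
    reserve of 4 is what a cut consumes: it adds two instructions and loses the credit of the slot
    it closes. A leaf needs one instruction and the reserve, hence the 5 per vertex of [S]. *)
Definition short T (c : seq (instr n)) (pend : seq 'I_n) :=
  size c + 4 <= 5 * count (mem S) (verts T) + 2 * size pend.

Lemma mergetab_le f g v t : mergetab D BIG f g v t <= f v t + g v t.
Proof. by apply: leq_trans (bigmin_leP _ _ v) _; rewrite D0. Qed.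

Lemma mergetab_lip f g u v t :
  mergetab D BIG f g u t <= D u v + mergetab D BIG f g v t.
Proof.
rewrite {2}/mergetab; case: (leqP BIG (\big[minn/BIG]_x (D v x + f x t + g x t))) => [h|h].
  by apply: leq_trans (bigmin_le_init _ _ _) _; apply: leq_trans h (leq_addl _ _).
have [x _ ->] := bigmin_attained h.
apply: leq_trans (bigmin_leP _ _ x) _.
by rewrite !addnA !leq_add2r.
Qed.


Definition near T := forall s, s \in S -> s \in verts T -> forall t, dst t <= D s t.

Lemma built_leaf v : v \in S -> near (Leaf v) ->
  built (Leaf v) [:: (0, v)] [:: (fun=> 0, false)] [:: v] (fun x _ => D x v, false) [::].
Proof.
move=> vS nv; split=> //=.
- by rewrite vS.
- move=> t _; rewrite D0 /charged /= big_seq1 /unserved /= big_cons big_nil.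
  case: ifP => // _; rewrite !addn0.
  by move: (nv v vS (mem_head _ _) v); rewrite D0 leqn0 => /eqP ->.
Qed.

Lemma built_slot v : v \notin S -> v \in K ->
  built (Leaf v) [:: (2, s0)] [:: (fun=> 0, false)] [:: s0] (D, true) [:: v].
Proof.
move=> vS vK; split=> //=.
- by move=> t; rewrite inE => /eqP ->; rewrite vK connect0.
- by rewrite (negbTE vS).
- by rewrite s0S.
- by move=> s sS; rewrite inE => /eqP sv; rewrite -sv sS in vS.
- move=> t [//|[<-]]; rewrite D0 /charged /= big_seq1 /unserved /= big_cons big_nil.
  by rewrite !inE eqxx andbF.
Qed.

(** A part free of [S] and [K] above the old root needs no instruction: by [b_lip] the table grows
    by at most the distance between the roots, and the new edge pays for that. *)
Lemma built_up T1 T2 c cs xs e pend : built T2 c cs xs e pend ->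
  adj E (root T1) (root T2) -> root T1 \notin S ->
  (forall v, v \in verts T1 -> (v \notin S) && (v \notin K)) ->
  built (Graft T1 T2) c cs xs e pend.
Proof.
case=> h1 h2 h3 h4 h5 h6 h7 h8 h9 h10 h11 h12 h13 a12 nS T1e; split=> //=.
- by move=> t /h8; rewrite mem_cat => ->; rewrite orbT.
- move=> t tp; have [tK ct] := h9 t tp; split=> //.
  apply: connect_trans ct; apply: connect1; rewrite /adj_minus nS a12 andbT /=.
  by apply: contraTN tp => /h10 ->.
- by move=> h; rewrite h in nS.
- move=> s sS; rewrite mem_cat => /orP[/T1e|]; last exact: h12.
  by rewrite sS.
- move=> t /h13; rewrite gcost_graft unserved_cat.
  have -> : unserved (verts T1) (served cs xs ++ pend) = 0.
    rewrite /unserved big_seq_cond big1 // => u /andP[/T1e/andP[_ /negbTE ->]] //.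
  by have := DE a12; have := h4 (root T1) (root T2) t; lia.
Qed.

(** A part free of [S] leaves no trace in the code if its own edges pay for serving its terminals
    directly. *)
Lemma built_left T1 T2 c cs xs e pend : built T1 c cs xs e pend ->
  (forall v, v \in verts T2 -> v \notin S) ->
  unserved (verts T2) [::] <= cost [set root T1; root T2] + gcost T2 ->
  built (Graft T1 T2) c cs xs e pend.
Proof.
case=> h1 h2 h3 h4 h5 h6 h7 h8 h9 h10 h11 h12 h13 T2e hT2; split=> //=.
- by move=> t /h8; rewrite mem_cat => ->.
- move=> s sS; rewrite mem_cat => /orP[|/T2e]; first exact: h12.
  by rewrite sS.
- move=> t /h13; rewrite gcost_graft unserved_cat.
  have : unserved (verts T2) (served cs xs ++ pend) <= unserved (verts T2) [::].
    exact: unserved_sub.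
  by lia.
Qed.

Lemma pend_comp T c cs xs e pend t : built T c cs xs e pend -> t \in pend -> root T \notin S.
Proof. by move=> h tp; apply: contraTN tp => /(b_root h) ->. Qed.

(** At most one side has a pending terminal, for two of them would lie in the component of [root T1]
    in [G - S]. This is where the compiler relies on the multiway cut. *)
Lemma built_merge T1 T2 c1 cs1 xs1 e1 pend1 c2 cs2 xs2 e2 pend2 :
  built T1 c1 cs1 xs1 e1 pend1 -> built T2 c2 cs2 xs2 e2 pend2 ->
  adj E (root T1) (root T2) -> root T1 \notin S -> uniq (verts T1 ++ verts T2) ->
  built (Graft T1 T2) (c1 ++ c2 ++ [:: (3, s0)]) (cs1 ++ cs2 ++ [:: (fun=> 0, false)])
    (xs1 ++ xs2 ++ [:: s0]) (mergetab D BIG e2.1 e1.1, e2.2 || e1.2) (pend1 ++ pend2).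
Proof.
move=> b1 b2 a12 nS; rewrite cat_uniq => /and3P[_ /hasPn dis _].
have csx1 : size cs1 = size xs1 by rewrite (b_cs b1) (b_xs b1).
have csx2 : size cs2 = size xs2 by rewrite (b_cs b2) (b_xs b2).
have up t : t \in pend2 -> connect (adj_minus E S) (root T1) t.
  move=> tp; have [_] := b_pendK b2 tp; apply: connect_trans; apply: connect1.
  by rewrite /adj_minus nS a12 (pend_comp b2 tp).
have sub1 t : t \in pend1 -> t \in verts T1.
  by move=> h; apply: (b_sub b1); rewrite mem_cat h orbT.
have sub2 t : t \in pend2 -> t \in verts T2.
  by move=> h; apply: (b_sub b2); rewrite mem_cat h orbT.
have one : pend1 = [::] \/ pend2 = [::].
  case E1 : pend1 => [|t1 p1]; first by left.
  case E2 : pend2 => [|t2 p2]; first by right.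
  have h1 : t1 \in pend1 by rewrite E1 mem_head.
  have h2 : t2 \in pend2 by rewrite E2 mem_head.
  have := cutS nS; rewrite (cardsD1 t1) (cardsD1 t2) !inE (up _ h2).
  have [-> ->] := b_pendK b1 h1; have [-> _] := b_pendK b2 h2.
  rewrite andbT; case: eqP => [e12|//].
  by have := dis _ (sub2 _ h2); rewrite e12 /= (sub1 _ h1).
have sv : served (cs1 ++ cs2 ++ [:: (fun=> 0, false)]) (xs1 ++ xs2 ++ [:: s0]) =
    served cs1 xs1 ++ served cs2 xs2.
  by rewrite !served_cat // /served /= cats0.
split.
- by rewrite !size_cat (b_cs b1) (b_cs b2).
- by rewrite !size_cat (b_xs b1) (b_xs b2).
- move=> st; rewrite !foldl_cat !charges_cat.
  have [-> ->] := b_run b1 st; have [-> ->] := b_run b2 (e1 :: st).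
  by [].
- by move=> u v t /=; exact: mergetab_lip.
- by rewrite /= (b_flag b1) (b_flag b2); case: (pend1) => [|? ?]; case: (pend2).
- by case: one => ->; rewrite ?cats0; [exact: (b_pend1 b2)|exact: (b_pend1 b1)].
- rewrite sv.
  have pp : perm_eq ((served cs1 xs1 ++ served cs2 xs2) ++ pend1 ++ pend2)
     ((served cs1 xs1 ++ pend1) ++ (served cs2 xs2 ++ pend2)).
    by apply/permP => p; rewrite !count_cat; lia.
  rewrite (perm_uniq pp) cat_uniq (b_uniq b1) (b_uniq b2) andbT /=.
  apply/hasPn => t /(b_sub b2)/dis; apply: contraNN; exact: (b_sub b1).
- move=> t; rewrite sv /= !mem_cat => /orP[/orP[]|/orP[]] h.
  + by rewrite (b_sub b1) // mem_cat h.
  + by rewrite (b_sub b2) ?orbT // mem_cat h.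
  + by rewrite sub1.
  + by rewrite sub2 ?orbT.
- move=> t; rewrite mem_cat => /orP[/(b_pendK b1)//|h]; split; last exact: up.
  by case: (b_pendK b2 h).
- by move=> h; rewrite /= h in nS.
- by rewrite !all_cat (b_ops b1) (b_ops b2) /= s0S.
- move=> s sS; rewrite /= !labels_cat !mem_cat => /orP[/(b_lab b1 sS) ->|/(b_lab b2 sS) ->] //.
  by rewrite orbT.
- move=> t ht; rewrite /= sv gcost_graft unserved_cat !charged_cat //.
  have c1' : e1.1 (root T1) t + charged cs1 xs1 + unserved (verts T1) (served cs1 xs1 ++ pend1) <= gcost T1.
    apply: (b_cost b1); case: one ht => ->; rewrite ?cats0; last by [].
    by move=> _; left.
  have c2' : e2.1 (root T2) t + charged cs2 xs2 + unserved (verts T2) (served cs2 xs2 ++ pend2) <= gcost T2.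
    apply: (b_cost b2); case: one ht => ->; rewrite ?cats0; first by [].
    by move=> _; left.
  have u1 : unserved (verts T1) ((served cs1 xs1 ++ served cs2 xs2) ++ pend1 ++ pend2) <=
     unserved (verts T1) (served cs1 xs1 ++ pend1).
    by apply: unserved_sub => x; rewrite !mem_cat => /orP[] ->; rewrite ?orbT.
  have u2 : unserved (verts T2) ((served cs1 xs1 ++ served cs2 xs2) ++ pend1 ++ pend2) <=
     unserved (verts T2) (served cs2 xs2 ++ pend2).
    by apply: unserved_sub => x; rewrite !mem_cat => /orP[] ->; rewrite ?orbT.
  have c0 : charged [:: (fun=> 0, false)] [:: s0] = 0 by rewrite /charged /= big_seq1.
  have := mergetab_le e2.1 e1.1 (root T1) t.
  have := b_lip b2 (root T1) (root T2) t; have := DE a12.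
  by move: c1' c2' u1 u2; rewrite c0; lia.
Qed.

(** Below a root in [S] the piece is closed: its pending terminal fills the slot, [s0] standing in
    if there is none. The leaf pushed by the cut is merged back into the first entry; since that
    leaf is [root T1], this is free at the root. *)
Lemma built_cut T1 T2 c1 cs1 xs1 e1 c2 cs2 xs2 e2 pend2 :
  built T1 c1 cs1 xs1 e1 [::] -> built T2 c2 cs2 xs2 e2 pend2 ->
  adj E (root T1) (root T2) -> root T1 \in S -> uniq (verts T1 ++ verts T2) ->
  built (Graft T1 T2) (c1 ++ c2 ++ [:: (1, root T1); (3, s0)])
    (cs1 ++ cs2 ++ [:: (e2.1 (root T1), e2.2); (fun=> 0, false)])
    (xs1 ++ xs2 ++ [:: head s0 pend2; s0])
    (mergetab D BIG (fun x _ => D x (root T1)) e1.1, e1.2) [::].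
Proof.
move=> b1 b2 a12 rS; rewrite cat_uniq => /and3P[_ /hasPn dis _].
have csx1 : size cs1 = size xs1 by rewrite (b_cs b1) (b_xs b1).
have csx2 : size cs2 = size xs2 by rewrite (b_cs b2) (b_xs b2).
have sv : served (cs1 ++ cs2 ++ [:: (e2.1 (root T1), e2.2); (fun=> 0, false)])
    (xs1 ++ xs2 ++ [:: head s0 pend2; s0]) = served cs1 xs1 ++ served cs2 xs2 ++ pend2.
  rewrite !served_cat // /served /= (b_flag b2).
  by have := b_pend1 b2; case: (pend2) => [|? []].
have u1 := b_uniq b1; have s1 := b_sub b1; have k1 := b_cost b1.
rewrite cats0 in u1 s1 k1.
split.
- by rewrite !size_cat (b_cs b1) (b_cs b2).
- by rewrite !size_cat (b_xs b1) (b_xs b2).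
- move=> st; rewrite !foldl_cat !charges_cat.
  have [-> ->] := b_run b1 st; have [-> ->] := b_run b2 (e1 :: st).
  by [].
- by move=> u v t /=; exact: mergetab_lip.
- by rewrite /= (b_flag b1).
- by [].
- rewrite cats0 sv cat_uniq u1 (b_uniq b2) andbT /=.
  apply/hasPn => t /(b_sub b2)/dis; apply: contraNN; exact: s1.
- move=> t; rewrite cats0 sv /= mem_cat => /orP[/s1|/(b_sub b2)] h; rewrite mem_cat h ?orbT //.
- by [].
- by [].
- by rewrite !all_cat (b_ops b1) (b_ops b2) /= s0S rS.
- move=> s sS; rewrite /= !labels_cat !mem_cat => /orP[/(b_lab b1 sS) ->|/(b_lab b2 sS) ->] //.
  by rewrite orbT.
- move=> t _; rewrite /= cats0 sv gcost_graft unserved_cat !charged_cat //.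
  have {}k1 := k1 t (or_introl erefl).
  have c2' : e2.1 (root T2) (head s0 pend2) + charged cs2 xs2 + unserved (verts T2) (served cs2 xs2 ++ pend2) <= gcost T2.
    by apply: (b_cost b2); have := b_pend1 b2; case: (pend2) => [|? []]; auto.
  have v1 : unserved (verts T1) (served cs1 xs1 ++ served cs2 xs2 ++ pend2) <=
     unserved (verts T1) (served cs1 xs1).
    by apply: unserved_sub => x; rewrite !mem_cat => ->.
  have v2 : unserved (verts T2) (served cs1 xs1 ++ served cs2 xs2 ++ pend2) <=
     unserved (verts T2) (served cs2 xs2 ++ pend2).
    by apply: unserved_sub => x; rewrite !mem_cat => /orP[] ->; rewrite ?orbT.
  have c0 : charged [:: (e2.1 (root T1), e2.2); (fun=> 0, false)] [:: head s0 pend2; s0] =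
     e2.1 (root T1) (head s0 pend2) by rewrite /charged /= big_cons big_seq1 /= addn0.
  have := mergetab_le (fun x _ => D x (root T1)) e1.1 (root T1) t; rewrite /= D0.
  have := b_lip b2 (root T1) (root T2) (head s0 pend2); have := DE a12.
  by move: k1 c2' v1 v2; rewrite c0; lia.
Qed.

(** [Bare] and [Slot] trees contain no vertex of [S], so they have nothing to pay for instructions
    with; they are kept apart from those satisfying [short]. *)
Variant compiled T : Prop :=
  | Bare of (forall v, v \in verts T -> (v \notin S) && (v \notin K))
  | Slot t of (forall v, v \in verts T -> v \notin S) &
      built T [:: (2, s0)] [:: (fun=> 0, false)] [:: s0] (D, true) [:: t]
  | Full c cs xs e pend of built T c cs xs e pend & short T c pend.

Lemma count_noS T : (forall v, v \in verts T -> v \notin S) -> count (mem S) (verts T) = 0.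
Proof. by move=> h; apply/eqP; rewrite -leqn0 leqNgt -has_count; apply/hasPn. Qed.

Lemma compile T : uniq (verts T) -> inside T -> near T -> compiled T.
Proof.
elim: T => [v _ _ nv|T1 IH1 T2 IH2].
  case: (boolP (v \in S)) => vS.
    by apply: Full (built_leaf vS nv) _; rewrite /short /= vS.
  case: (boolP (v \in K)) => vK.
    by apply: Slot (built_slot vS vK) => u; rewrite inE => /eqP ->.
  by apply: Bare => u; rewrite inE => /eqP ->; rewrite vS.
move=> /= u12 /and3P[a12 i1 i2] n12.
have [u1 u2] : uniq (verts T1) /\ uniq (verts T2).
  by move: u12; rewrite cat_uniq => /and3P[].
have n1 : near T1 by move=> s sS h; apply: n12; rewrite //= mem_cat h.
have n2 : near T2 by move=> s sS h; apply: n12; rewrite //= mem_cat h orbT.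
have bareS T : (forall v, v \in verts T -> (v \notin S) && (v \notin K)) ->
  forall v, v \in verts T -> v \notin S by move=> h v /h/andP[].
have bareU T : (forall v, v \in verts T -> (v \notin S) && (v \notin K)) ->
    unserved (verts T) [::] = 0.
  by move=> h; rewrite /unserved big_seq_cond big1 // => u /andP[/h/andP[_ /negbTE ->]].
have {}IH1 := IH1 u1 i1 n1; have {}IH2 := IH2 u2 i2 n2.
case: (boolP (root T1 \in S)) => rS.
  case: IH1 => [h|t h _|c1 cs1 xs1 e1 pend1 b1 l1].
  - by have := h _ (root_verts T1); rewrite rS.
  - by have := h _ (root_verts T1); rewrite rS.
  have p1 : pend1 = [::] := b_root b1 rS.
  rewrite {}p1 in b1 l1.
  case: IH2 => [h|t h b2|c2 cs2 xs2 e2 pend2 b2 l2].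
  - apply: Full (built_left b1 (bareS _ h) _) _; first by rewrite bareU.
    by move: l1; rewrite /short /= count_cat; lia.
  (* This piece touches [S] only at [root T1]. Its terminal is left unserved, and the edge together
     with the path to the terminal pays for [dst]. *)
  - apply: Full (built_left b1 h _) _; last by move: l1; rewrite /short /= count_cat; lia.
    apply: leq_trans (unserved_one t u2) _.
    have := b_cost b2 (or_intror erefl); rewrite /= /charged /= big_seq1 /served /= addn0.
    have := n1 _ rS (root_verts T1) t; have := DE a12.
    by have := Dtri (root T1) t (root T2); lia.
  - apply: Full (built_cut b1 b2 a12 rS u12) _.
    have := b_pend1 b2.
    by move: l1 l2; rewrite /short /= !size_cat count_cat /=; lia.
case: IH1 => [h|t h b1|c1 cs1 xs1 e1 pend1 b1 l1].
- case: IH2 => [h'|t h' b2|c2 cs2 xs2 e2 pend2 b2 l2].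
  + by apply: Bare => v; rewrite mem_cat => /orP[/h|/h'].
  + apply: (@Slot _ t _ (built_up b2 a12 rS h)) => v /=.
    by rewrite mem_cat => /orP[/(bareS _ h)|/h'].
  + apply: Full (built_up b2 a12 rS h) _.
    by move: l2; rewrite /short /= count_cat; lia.
- case: IH2 => [h'|t' h' b2|c2 cs2 xs2 e2 pend2 b2 l2].
  + apply: (@Slot _ t _ (built_left b1 (bareS _ h') _)); last by rewrite bareU.
    by move=> v /=; rewrite mem_cat => /orP[/h|/(bareS _ h')].
  (* Two slots would amount to two pending terminals. *)
  + by have := b_pend1 (built_merge b1 b2 a12 rS u12).
  + have b := built_merge b1 b2 a12 rS u12; apply: (Full b).
    move: l2 (b_pend1 b); rewrite /short /= !size_cat count_cat (count_noS h) /=; lia.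
- case: IH2 => [h'|t' h' b2|c2 cs2 xs2 e2 pend2 b2 l2].
  + apply: Full (built_left b1 (bareS _ h') _) _; first by rewrite bareU.
    by move: l1; rewrite /short /= count_cat; lia.
  + have b := built_merge b1 b2 a12 rS u12; apply: (Full b).
    move: l1 (b_pend1 b); rewrite /short /= !size_cat count_cat (count_noS h') /=; lia.
  + have b := built_merge b1 b2 a12 rS u12; apply: (Full b).
    by move: l1 l2; rewrite /short /= !size_cat count_cat /=; lia.
Qed.

End Compile.
End Trees.

(** * Choosing slots by rank *)

Section Ranks.

Variables (n : nat) (pi : 'I_n -> nat).

(* [t] is ranked by [g t - pi t], ties being broken by the index. *)
Definition prec (g : 'I_n -> nat) (u t : 'I_n) : bool :=
  (g u + pi t) * n + u < (g t + pi u) * n + t.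

Definition rank g t := #|[set u | prec g u t]|.

(** Ranks are a bijection onto the numbers below [n], so the default [d] is returned exactly for
    [n <= r]. *)
Definition sel d g r := odflt d [pick t | rank g t == r].

Lemma precE g u t :
  prec g u t = (g u + pi t < g t + pi u) || ((g u + pi t == g t + pi u) && (u < t)).
Proof.
rewrite /prec; have := ltn_ord u; have := ltn_ord t.
move: (g u + pi t) (g t + pi u) => a b ht hu; apply/idP/idP; last first.
  case/orP=> [h|/andP[/eqP -> h]]; last lia.
  by have : a.+1 * n <= b * n; [rewrite leq_mul2r h orbT|lia].
move=> h; case: ltngtP => //= [h'|ab]; last by move: h; rewrite ab; lia.
by have : b.+1 * n <= a * n; [rewrite leq_mul2r h' orbT|lia].
Qed.

Lemma rank_mono g u t : prec g u t -> rank g u < rank g t.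
Proof.
move=> h; apply: proper_card; apply/properP; split; last first.
  by exists u; rewrite !inE // precE; lia.
by apply/subsetP => v; rewrite !inE; move: h; rewrite !precE; lia.
Qed.

Lemma prec_total g u t : u != t -> prec g u t || prec g t u.
Proof. by rewrite !precE => h; have : (u : nat) != t := h; lia. Qed.

Lemma rank_inj g : injective (rank g).
Proof.
move=> u t h; apply/eqP; apply: contraT => /(prec_total g)/orP[]/rank_mono; lia.
Qed.

Lemma rank_ltn g t : rank g t < n.
Proof.
rewrite /rank -[X in _ < X]card_ord -cardsT; apply: proper_card.
by apply/properP; split; [exact: subsetT|exists t; rewrite !inE // /prec ltnn].
Qed.

Lemma sel_rank d g t : sel d g (rank g t) = t.
Proof.
rewrite /sel; case: pickP => [u /eqP/rank_inj //|/(_ t)]; by rewrite eqxx.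
Qed.

(** Pigeonhole: exactly [L] vertices have rank below [L]. *)
Lemma low_rank_avoiding g (A : {set 'I_n}) L : #|A| < L -> L <= n ->
  exists2 t, rank g t < L & t \notin A.
Proof.
move=> AL Ln; pose r t := Ordinal (rank_ltn g t).
have rinj : injective r by move=> u t /(congr1 val)/= /rank_inj.
pose f (j : 'I_L) := invF rinj (widen_ord Ln j).
have finj : injective f.
  by move=> i j /(can_inj (f_invF rinj))/(congr1 val)/= /val_inj.
have : ~~ (f @: [set: 'I_L] \subset A).
  apply: contraL AL => /subset_leq_card.
  by rewrite card_imset // cardsT card_ord -leqNgt.
case/subsetPn => t /imsetP[j _ ->] h; exists (f j) => //.
have : r (f j) = widen_ord Ln j by rewrite /f f_invF.
by move/(congr1 val) => /= ->.
Qed.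

(** * The exchange argument *)

Section Exchange.

Variables (L : nat) (g : 'I_L -> 'I_n -> nat) (b : pred 'I_L).

Definition free (x : 'I_L -> 'I_n) := [set t | [forall i, b i ==> (x i != t)]].

Definition outlay (x : 'I_L -> 'I_n) := \sum_i g i (x i) + \sum_(t in free x) pi t.

(** Among the assignments that are no more expensive, one with the least sum of ranks is taken. If a
    slot had rank at least [L], the at most [L - 1] other slots could not occupy all of its first
    [L] vertices; moving it to a free one of these lowers its rank and does not raise the outlay. *)
Lemma exchange (x : 'I_L -> 'I_n) : {in b &, injective x} ->
  exists y : 'I_L -> 'I_n, [/\ {in b &, injective y}, outlay y <= outlay x
    & forall i, b i -> rank (g i) (y i) < L].
Proof.
move=> xinj.
pose P (y : {ffun 'I_L -> 'I_n}) :=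
  [forall i, forall j, b i ==> b j ==> (y i == y j) ==> (i == j)] && (outlay y <= outlay x).
have Pinj (y : {ffun 'I_L -> 'I_n}) : P y -> {in b &, injective y}.
  case/andP=> /forallP h _ i j bi bj /eqP e.
  have /forallP/(_ j) := h i.
  by move: bi bj; rewrite !unfold_in => -> ->; rewrite e => /eqP.
have P0 : P [ffun i => x i].
  apply/andP; split.
    apply/forallP => i; apply/forallP => j; apply/implyP => bi; apply/implyP => bj.
    by rewrite !ffunE; apply/implyP => /eqP/xinj ->.
  rewrite /outlay (eq_bigr (fun i => g i (x i))) => [|i _]; last by rewrite ffunE.
  rewrite leq_add2l (eq_bigl [in free x]) // => t; rewrite !inE.
  by apply: eq_forallb => i; rewrite ffunE.
case: (arg_minnP (fun y : {ffun 'I_L -> 'I_n} => \sum_(i | b i) rank (g i) (y i)) P0) => y Py ymin.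
exists y; split; [exact: Pinj|by case/andP: Py|].
move=> i0 b0; rewrite ltnNge; apply/negP => hL.
have Ln : L <= n by apply: leq_trans hL (ltnW (rank_ltn _ _)).
pose A := [set y i | i in [pred i | b i && (i != i0)]].
have AL : #|A| < L.
  apply: leq_ltn_trans (leq_imset_card _ _) _.
  rewrite -[X in _ < X]card_ord; apply: proper_card; apply/properP; split.
    exact: subset_predT.
  by exists i0; rewrite // !inE eqxx andbF.
have [t tL tA] := low_rank_avoiding (g i0) AL Ln.
have tx : t != y i0 by apply: contraTneq hL => <-; rewrite -ltnNge.
have tfree i : b i -> y i != t.
  move=> bi; case: (eqVneq i i0) => [->|ni]; first by rewrite eq_sym.
  apply: contraNneq tA => <-; apply/imsetP; exists i => //.
  by rewrite inE /= ni [b i]bi.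
pose z : {ffun 'I_L -> 'I_n} := [ffun i => if i == i0 then t else y i].
have yinj := Pinj y Py.
have hz : P z.
  apply/andP; split.
    apply/forallP => i; apply/forallP => j; apply/implyP => bi; apply/implyP => bj.
    rewrite !ffunE; case: (eqVneq i i0) => [ei|ni]; case: (eqVneq j i0) => [ej|nj].
    - by rewrite ei ej !eqxx ?implybT.
    - by rewrite eq_sym (negbTE (tfree j bj)).
    - by rewrite (negbTE (tfree i bi)).
    - by apply/implyP => /eqP/yinj ->.
  have Fz : free z = y i0 |: (free y :\ t).
    apply/setP => u; rewrite !inE; apply/forallP/idP => [h|].
      case: (eqVneq u (y i0)) => //= nu; apply/andP; split.
        by have /implyP/(_ b0) := h i0; rewrite ffunE eqxx eq_sym.
      apply/forallP => i; apply/implyP => bi; have /implyP/(_ bi) := h i.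
      by rewrite ffunE; case: (eqVneq i i0) => [-> _|//]; rewrite eq_sym.
    case/orP=> [/eqP -> i|/andP[ut /forallP h] i].
      apply/implyP => bi; rewrite ffunE; case: (eqVneq i i0) => [_|ni] //.
      by apply: contraNneq ni => /yinj ->.
    by rewrite ffunE; case: (eqVneq i i0) => [->|_]; [rewrite eq_sym ut implybT|exact: h].
  have tF : t \in free y by rewrite inE; apply/forallP => i; apply/implyP; exact: tfree.
  have xF : y i0 \notin free y :\ t.
    rewrite !inE negb_and negb_forall; apply/orP; right; apply/existsP; exists i0.
    by rewrite [b i0]b0 eqxx.
  have hp : prec (g i0) t (y i0).
    have /orP[//|/rank_mono] := prec_total (g i0) tx; lia.
  (* [y i0] becomes free and [t] ceases to be so; all other terms agree on both sides. *)
  case/andP: Py => _; apply: leq_trans; rewrite /outlay Fz big_setU1 //=.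
  rewrite (bigD1 i0) //= [X in _ <= X + _](bigD1 i0) //= ffunE eqxx.
  rewrite (big_setD1 _ tF) /=.
  rewrite (eq_bigr (fun i => g i (y i))) => [|i /negbTE ni]; last by rewrite ffunE ni.
  have hw : g i0 t + pi (y i0) <= g i0 (y i0) + pi t.
    by move: hp; rewrite precE => /orP[/ltnW //|/andP[/eqP -> _]].
  by rewrite addnACA [leqRHS]addnACA leq_add2r.
have := ymin z hz; rewrite (bigD1 i0) //= [X in _ <= X](bigD1 i0) //= ffunE eqxx.
rewrite [X in _ <= _ + X](eq_bigr (fun i => rank (g i) (y i))) => [|i /andP[_ /negbTE ni]]; last by rewrite ffunE ni.
by rewrite leq_add2r leqNgt (leq_trans tL hL).
Qed.

End Exchange.
End Ranks.

(** * Completeness of the enumeration *)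

Lemma uniq_map_inj (T1 T2 : eqType) (f : T1 -> T2) s :
  uniq (map f s) -> {in s &, injective f}.
Proof.
elim: s => //= a s IH /andP[as' us] x y; rewrite !inE.
move=> /orP[/eqP ->|xs] /orP[/eqP ->|ys] // e.
- by case/mapP: as'; exists y.
- by case/mapP: as'; exists x.
- exact: IH.
Qed.

Section Completeness.

Variables (n : nat) (D : 'I_n -> 'I_n -> nat) (BIG : nat).

Definition ranked := (instr n * nat)%type.

(** Picks can be computed from code and ranks alone, because the charges of a code do not depend on
    the vertices chosen before. *)
Definition picks pi (k : seq ranked) : seq 'I_n :=
  [seq sel pi p.2.1.2 p.1.1 p.2.2 | p <- zip (charges D BIG [::] (unzip1 k)) k].

Definition nocharge : charge n := (fun=> 0, false).

(** * Charges and served terminals as families indexed by positions *)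

Section Positions.

Variables (s0 : 'I_n) (cs : seq (charge n)).

Lemma zip_positions xs : size xs = size cs ->
  zip cs xs = [seq (nth nocharge cs i, nth s0 xs i) | i : 'I_(size cs) <- enum 'I_(size cs)].
Proof.
move=> h; rewrite -zip_map; congr zip.
  by rewrite -[LHS](mkseq_nth nocharge) /mkseq -val_enum_ord -map_comp.
by rewrite -[LHS](mkseq_nth s0) h /mkseq -val_enum_ord -map_comp.
Qed.

Lemma charged_positions xs : size xs = size cs ->
  charged cs xs = \sum_(i < size cs) (nth nocharge cs i).1 (nth s0 xs i).
Proof. by move=> /zip_positions h; rewrite /charged h big_map big_enum. Qed.

Lemma served_positions xs : size xs = size cs ->
  served cs xs = [seq nth s0 xs i | i : 'I_(size cs) <- enum 'I_(size cs) & (nth nocharge cs i).2].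
Proof. by move=> /zip_positions h; rewrite /served h filter_map -map_comp. Qed.

Lemma free_served xs : size xs = size cs ->
  free (fun i : 'I_(size cs) => (nth nocharge cs i).2) (fun i => nth s0 xs i) =
  [set t | t \notin served cs xs].
Proof.
move=> /served_positions ->; apply/setP => t; rewrite !inE; apply/forallP/idP.
  move=> h; apply/mapP => -[i]; rewrite mem_filter => /andP[bi _] e.
  by have /implyP/(_ bi) := h i; rewrite e eqxx.
move=> h i; apply/implyP => bi; apply: contraNneq h => <-.
by apply/mapP; exists i; rewrite // mem_filter bi mem_enum.
Qed.

End Positions.

(* Without a slot the table does not depend on the slot argument. *)
Definition const_entry (e : entry n) := ~~ e.2 -> forall v t t', e.1 v t = e.1 v t'.

Fixpoint const_stack (s : seq (entry n)) : Prop :=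
  if s is e :: s' then const_entry e /\ const_stack s' else True.

Lemma const_step s i : const_stack s -> const_stack (step D BIG s i).
Proof.
rewrite /step; case: ifP => _.
  by move=> h; split=> //; case: ifP => // _; case: s h => // e s [].
case: ifP => _; first by move=> h; split.
case: s => [|e1 [|e2 s]] //= [h1 [h2 h3]]; split=> //; rewrite /const_entry /= negb_or => /andP[f1 f2] v t t'.
by apply: eq_bigr => u _; rewrite (h1 f1 u t t') (h2 f2 u t t').
Qed.

Lemma const_charges s c j t t' : const_stack s ->
  ~~ (nth nocharge (charges D BIG s c) j).2 ->
  (nth nocharge (charges D BIG s c) j).1 t = (nth nocharge (charges D BIG s c) j).1 t'.
Proof.
elim: c s j => [|i c IH] s j /= h; first by rewrite nth_nil.
case: j => [|j] /=; last by apply: IH; exact: const_step.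
rewrite /charge_of; case: ifP => // _; case: s h => //= e s [he _] f.
exact: he.
Qed.

(** The exchange argument is applied with the positions of the code as indices, so ranks stay below
    the length of the code. Where there is no slot the charge is constant, and rank 0 is as good as
    any. *)
Lemma rerank K (c : seq (instr n)) xs e x : size xs = size c -> 0 < size c ->
  uniq (served (charges D BIG [::] c) xs) ->
  exists k : seq ranked, [/\ unzip1 k = c, all (fun p => p.2 < size c) k
    & value D BIG K c (picks (profit D BIG K c) k) e x <= value D BIG K c xs e x].
Proof.
move=> hxs hc us; set pi := profit D BIG K c.
set cs := charges D BIG [::] c in us *.
have hcs : size cs = size c by rewrite size_charges.
have hxs' : size xs = size cs by rewrite hcs.
pose b (i : 'I_(size cs)) := (nth nocharge cs i).2.
pose g (i : 'I_(size cs)) := (nth nocharge cs i).1.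
have binj : {in b &, injective (fun i : 'I_(size cs) => nth x xs i)}.
  move=> i j bi bj; rewrite (served_positions x hxs') in us; move: us => /uniq_map_inj.
  by apply; rewrite mem_filter mem_enum andbT.
have [y [yinj yle yrk]] := exchange pi g binj.
pose r (i : 'I_(size cs)) := if b i then rank pi (g i) (y i) else 0.
pose k : seq ranked := zip c [seq r i | i <- enum 'I_(size cs)].
have szr : size [seq r i | i <- enum 'I_(size cs)] = size c by rewrite size_map size_enum_ord.
have k1 : unzip1 k = c by rewrite unzip1_zip // szr.
exists k; split=> //.
  apply/allP => p /(map_f snd); rewrite -/(unzip2 k) unzip2_zip ?szr //.
  case/mapP => i _ ->; rewrite /r; case: ifP => // bi.
  by rewrite -hcs; exact: yrk.
have szk : size (picks pi k) = size cs.
  by rewrite /picks size_map size_zip k1 -/cs hcs size_zip szr !minnn.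
have pk (i : 'I_(size cs)) : nth x (picks pi k) (val i) = sel pi (nth (0, x) c (val i)).2 (g i) (r i).
  have hi := ltn_ord i; have hic : i < size c by rewrite -hcs.
  rewrite /picks (nth_map (nocharge, ((0, x), 0))); last first.
    by rewrite size_zip k1 -/cs /k size_zip szr !leq_min hi hic.
  rewrite k1 -/cs nth_zip /=; last by rewrite /k size_zip szr hcs minnn.
  rewrite /k nth_zip ?szr //=; congr (sel _ _ _ _).
  by rewrite (nth_map i) ?size_enum_ord // nth_ord_enum.
have pkb (i : 'I_(size cs)) : b i -> nth x (picks pi k) (val i) = y i.
  by move=> bi; rewrite pk /r bi sel_rank.
(* The cost of the final entry is common to both sides and cancels. *)
rewrite /value -/cs -/pi -addnA [leqRHS]addnAC addnCA addnC leq_add2r.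
have -> : charged cs xs + \sum_(t | t \notin served cs xs) pi t = outlay pi g b (fun i => nth x xs i).
  by rewrite /outlay (free_served x hxs') (charged_positions x hxs') big_set.
apply: leq_trans yle; rewrite -/cs in szk *.
rewrite -[X in _ + X]big_set -(free_served x szk) (charged_positions x szk) /outlay.
have -> : free b (fun i => nth x (picks pi k) i) = free b y.
  by apply/setP => t; rewrite !inE; apply: eq_forallb => i; case: (boolP (b i)) => // /pkb ->.
rewrite leq_add2r; apply: leq_sum => i _.
case: (boolP (b i)) => [/pkb -> //|nb].
by rewrite (const_charges (nth x (picks pi k) i) (y i) (s := [::])).
Qed.

End Completeness.

Lemma bigmin_sub (I : eqType) (r s : seq I) b (F : I -> nat) :
  {subset s <= r} -> \big[minn/b]_(i <- r) F i <= \big[minn/b]_(i <- s) F i.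
Proof.
move=> sr; have := bigmin_le_init s b F; rewrite leq_eqVlt => /orP[/eqP ->|].
  exact: bigmin_le_init.
by case/bigmin_attained => i /sr ir ->; exact: bigmin_le_seq.
Qed.

(** * Some code attains the optimum *)

Section OptimalCode.

Variables (n : nat) (E : {set {set 'I_n}}) (cost : {set 'I_n} -> nat) (K S : {set 'I_n}).
Variables (D : 'I_n -> 'I_n -> nat) (BIG : nat).

Hypothesis cutS : multiway_cut E K S.
Hypothesis D0 : forall u, D u u = 0.
Hypothesis Dtri : forall u v w, D u v <= D u w + D w v.
Hypothesis DE : forall u v, adj E u v -> D u v <= cost [set u; v].

(** A tree avoiding [S] would put two terminals into one component of [G - S]. *)
Lemma steiner_meets_cut V F : steiner_tree E K V F -> 1 < #|K| ->
  exists2 s, s \in S & s \in V.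
Proof.
case=> [[FE FV] [V0 Vc _] KV] /card_gt1P[t1 [t2 [t1K t2K t12]]].
apply/exists_inP; apply: contraT; rewrite negb_exists_in => /forall_inP h.
have nS v : v \in V -> v \notin S by apply: contraL => /h.
have t1V := subsetP KV _ t1K; have t2V := subsetP KV _ t2K.
have cc : connect (adj_minus E S) t1 t2.
  apply: connect_sub (Vc _ _ t1V t2V) => x y xy; apply: connect1.
  have xyV := FV _ xy.
  rewrite /adj_minus (adj_sub FE xy) !nS //; apply: (subsetP xyV); by rewrite !inE eqxx ?orbT.
have := cutS (nS _ t1V); rewrite (cardsD1 t1) (cardsD1 t2) !inE connect0 t1K cc t2K.
by rewrite andbT eq_sym t12.
Qed.

Lemma complete V F : steiner_tree E K V F -> 1 < #|K| ->
  exists (k : seq (ranked n)) (e : entry n) (x : 'I_n),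
  [/\ size k = 5 * #|S| /\ last x [seq p.1.2 | p <- k] = x,
      all (fun p => [&& p.1.1 < 4, p.1.2 \in S & p.2 < 5 * #|S|]) k,
      foldl (step D BIG) [::] (unzip1 k) = [:: e]
    & value D BIG K (unzip1 k) (picks D BIG (profit D BIG K (unzip1 k)) k) e x <= weight cost F].
Proof.
move=> VF K2; have [s0 s0S s0V] := steiner_meets_cut VF K2.
case: VF => [[FE FV] [_ Vc _] KV].
have [T [rT uT TV ue eF]] := spanning_gtree FV Vc s0V.
have TE : inside E T by apply: edges_inside => z /eF; exact: (subsetP FE).
(* The minimum is restricted to [V], since only the vertices of [S] in the tree are known to be
   labels of the code. *)
pose dst t := \big[minn/BIG]_(s <- enum (S :&: V)) D s t.
have nr : near S D dst T.
  move=> s sS sT t; apply: bigmin_le_seq; by rewrite mem_enum inE sS -TV.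
have := compile BIG cutS s0S D0 Dtri DE uT TE nr.
case=> [h|t h _|c cs xs e pend b sh].
- by have := h _ (root_verts T); rewrite rT s0S.
- by have := h _ (root_verts T); rewrite rT s0S.
have p0 : pend = [::] by apply: (b_root b); rewrite rT.
rewrite {}p0 {pend} in b sh.
have cS : count (mem S) (verts T) <= #|S|.
  rewrite -size_filter -(card_uniqP (filter_uniq _ uT)); apply: subset_leq_card.
  by apply/subsetP => z; rewrite mem_filter => /andP[].
pose d := 5 * #|S| - size c.
have h5 : size c + 4 <= 5 * #|S|.
  by apply: leq_trans sh _; rewrite muln0 addn0 leq_mul2l.
have hd : size c + d = 5 * #|S| by rewrite /d; lia.
(* The reserve of 4 in [short] leaves room for padding. At least one padding instruction makes [s0],
   the root of the tree, the last label, at which the program evaluates the final entry. *)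
have d0 : 0 < d by rewrite /d; lia.
(* Merging has no effect on a stack with a single entry. *)
pose c' := c ++ nseq d (3, s0); pose xs' := xs ++ nseq d s0.
have run1 : foldl (step D BIG) [:: e] (nseq d (3, s0)) = [:: e].
  by elim: (d) => //= d' IH.
have chp : charges D BIG [:: e] (nseq d (3, s0)) = nseq d (nocharge n).
  by elim: (d) => //= d' ->.
have [run0 ch0] := b_run b [::].
have run' : foldl (step D BIG) [::] c' = [:: e] by rewrite foldl_cat run0 run1.
have ch' : charges D BIG [::] c' = cs ++ nseq d (nocharge n).
  by rewrite charges_cat run0 ch0 chp.
have csx : size cs = size xs by rewrite (b_cs b) (b_xs b).
have sv : served (charges D BIG [::] c') xs' = served cs xs.
  rewrite ch' served_cat // (_ : served (nseq _ _) _ = [::]) ?cats0 //.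
  by elim: (d) => //= d' IH; rewrite /served /=.
have chg : charged (charges D BIG [::] c') xs' = charged cs xs.
  rewrite ch' charged_cat // (_ : charged (nseq _ _) _ = 0) ?addn0 //.
  by elim: (d) => [|d' IH]; rewrite /charged /= ?big_nil // big_cons /= -/(charged _ _) IH.
have szc : size c' = 5 * #|S| by rewrite size_cat size_nseq.
have [|||k [k1 krk kval]] := @rerank n D BIG K c' xs' e s0.
- by rewrite !size_cat !size_nseq (b_xs b).
- by rewrite szc; lia.
- by rewrite sv; have := b_uniq b; rewrite cats0.
have szk : size k = 5 * #|S| by rewrite -szc -k1 size_map.
exists k, e, s0; rewrite k1 in kval *; split=> //.
- split=> //; have -> : [seq p.1.2 | p <- k] = [seq i.2 | i <- c'].
    by rewrite -k1 -map_comp.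
  rewrite /c' map_cat last_cat map_nseq /=.
  by case: (d) d0 => // d' _; rewrite (last_nth s0) size_nseq -[RHS](if_same (d' < d'.+1)) -(nth_nseq s0).
- apply/allP => p pk; rewrite -szc (allP krk p pk) andbT.
  have : p.1 \in c' by rewrite -k1 map_f.
  rewrite mem_cat mem_nseq => /orP[|/andP[_ /eqP ->]] /=; last by rewrite s0S.
  by move/(allP (b_ops b)).
apply: leq_trans kval _; rewrite /value sv chg.
have h1 := b_cost b (t := s0) (or_introl erefl); rewrite cats0 rT in h1.
have h2 : gcost cost T <= weight cost F.
  rewrite /gcost /weight (big_uniq _ ue) /= big_mkcond [leqRHS]big_mkcond.
  by apply: leq_sum => z _; case: (boolP (z \in edges T)) => [/eF ->|].
have h3 : \sum_(t | t \notin served cs xs) profit D BIG K c' t <= unserved K dst (verts T) (served cs xs).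
  rewrite /unserved [leqRHS]big_mkcond (big_uniq _ uT) /= big_mkcond [leqRHS]big_mkcond /=.
  apply: leq_sum => t _; case: ifP => // ts.
  rewrite /profit; case: ifP => tK //.
  rewrite TV (subsetP KV _ tK) /=; apply: bigmin_sub => s.
  rewrite mem_enum inE => /andP[sS sV]; rewrite labels_cat mem_cat.
  by rewrite (b_lab b) // TV.
by move: h1 h2 h3; lia.
Qed.

End OptimalCode.

(** * The program *)

Declare Scope ex_scope.
Delimit Scope ex_scope with X.
Bind Scope ex_scope with ex.
Notation "a + b" := (Op OpAdd a b) : ex_scope.
Notation "a - b" := (Op OpSub a b) : ex_scope.
Notation "a * b" := (Op OpMul a b) : ex_scope.
Notation "a / b" := (Op OpDiv a b) : ex_scope.
Notation "a 'mod' b" := (Op OpMod a b) (at level 40, no associativity) : ex_scope.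
Notation "a == b" := (Op OpEq a b) : ex_scope.
Notation "a < b" := (Op OpLt a b) : ex_scope.
Notation "# c" := (Cst c) (at level 8, format "# c") : ex_scope.
Arguments Ld _%_nat _%_X.
Arguments Set_ _%_nat _%_X.
Arguments Sto _%_nat _%_X _%_X.
Arguments In _%_nat _%_X.
Arguments Out _%_X _%_X.
Arguments If _%_X _ _.
Notation "p ;; q" := (Seq p q) (at level 90, right associativity).

(** Registers 1 to 8 are constant after initialisation: the number of vertices and its square, the
    size of [S], the code length, the number of possible instructions, the number of codes, [BIG],
    and the size of [K]. *)
Notation rN := 1.
Notation rNN := 2.
Notation rk_ := 3.
Notation rM := 4.
Notation rB := 5.
Notation rLim := 6.
Notation rBig := 7.
Notation rKC := 8.
Notation rOpt := 9.
Notation rBest := 10.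
Notation rW := 11.
Notation rZ := 12.
Notation rJ := 13.
Notation rOp := 14.
Notation rLab := 15.
Notation rRk := 16.
Notation rSp := 17.
Notation rTot := 18.
Notation rX := 19.
Notation rU := 20.
Notation rAcc := 21.
Notation rY := 22.
Notation rCnt := 23.
Notation rSel := 24.
Notation rT := 25.
Notation rSave := 26.
Notation rL := 27.
Notation rXd := 28.
Notation rXt := 29.

(** Terminals, the list of [S], edge weights, distances, digits of the code, profits, served
    vertices, tables of the stack, slot flags of the stack, and scratch space. *)
Notation aK := 0.
Notation aS := 1.
Notation aW := 2.
Notation aD := 3.
Notation aC := 4.
Notation aP := 5.
Notation aU := 6.
Notation aF := 7.
Notation aG := 8.
Notation aT := 9.

(** The Floyd-Warshall algorithm in place, with 0 on the diagonal. The pair of [u] and [v] is the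
    number [u * n + v], so that one counter runs over all pairs. *)
Definition p_dist : prog :=
  For rX rNN
    (Sto aD (Rg rX)
       ((#1 - (Rg rX / Rg rN == (Rg rX mod Rg rN))) * Ld aW (Rg rX)));;
  For rL rN
    (For rX rNN
       (Set_ rY (Ld aD ((Rg rX / Rg rN) * Rg rN + Rg rL)
                 + Ld aD (Rg rL * Rg rN + (Rg rX mod Rg rN)));;
        If (Rg rY < Ld aD (Rg rX)) (Sto aD (Rg rX) (Rg rY)) Skip)).

(** Profits depend on the labels of the whole code, and cuts already need them for ranking; so they
    are computed before the code is run. *)
Definition p_labels : prog :=
  For rT rN (Sto aP (Rg rT) (Rg rBig));;
  For rT rN (Sto aU (Rg rT) #0);;
  Set_ rZ (Rg rW);;
  For rJ rM
    (Sto aC (Rg rJ) (Rg rZ mod Rg rB);;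
     Set_ rZ (Rg rZ / Rg rB);;
     If ((Ld aC (Rg rJ) mod #4) < #2)
       (Set_ rLab (Ld aS ((Ld aC (Rg rJ) / #4) mod Rg rk_));;
        For rT rN
          (If (Ld aD (Rg rLab * Rg rN + Rg rT) < Ld aP (Rg rT))
             (Sto aP (Rg rT) (Ld aD (Rg rLab * Rg rN + Rg rT))) Skip))
       Skip);;
  For rT rN (Sto aP (Rg rT) (Ld aP (Rg rT) * Ld aK (Rg rT))).

Definition x_top u := (Ld aF (Rg rSp * Rg rNN + (Rg rLab * Rg rN + Rg u)))%X.

(** Ranks are found by counting predecessors afresh for every vertex, without any sorting; a rank
    that does not occur leaves the default label in place. *)
Definition p_select : prog :=
  Set_ rSel (Rg rLab);;
  For rT rN
    (Set_ rCnt #0;;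
     For rU rN
       (If ((x_top rU + Ld aP (Rg rT)) * Rg rN + Rg rU
            < (x_top rT + Ld aP (Rg rU)) * Rg rN + Rg rT)
          (Set_ rCnt (Rg rCnt + #1)) Skip);;
     If (Rg rCnt == Rg rRk) (Set_ rSel (Rg rT)) Skip).

Definition p_cut : prog :=
  Set_ rSp (Rg rSp - #1);;
  p_select;;
  Set_ rTot (Rg rTot + x_top rSel);;
  If (Ld aG (Rg rSp)) (Sto aU (Rg rSel) #1) Skip.

Definition p_leaf : prog :=
  For rX rNN (Sto aF (Rg rSp * Rg rNN + Rg rX) (Ld aD ((Rg rX / Rg rN) * Rg rN + Rg rLab)));;
  Sto aG (Rg rSp) #0;;
  Set_ rSp (Rg rSp + #1).

Definition p_slot : prog :=
  For rX rNN (Sto aF (Rg rSp * Rg rNN + Rg rX) (Ld aD (Rg rX)));;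
  Sto aG (Rg rSp) #1;;
  Set_ rSp (Rg rSp + #1).

(** An entry of the result reads a whole column of both tables, so the result is assembled in [aT]
    before it overwrites one of them. *)
Definition p_merge : prog :=
  Set_ rSp (Rg rSp - #1);;
  For rX rNN
    (Set_ rAcc (Rg rBig);;
     For rU rN
       (Set_ rY (Ld aD ((Rg rX / Rg rN) * Rg rN + Rg rU)
                 + Ld aF (Rg rSp * Rg rNN + (Rg rU * Rg rN + (Rg rX mod Rg rN)))
                 + Ld aF ((Rg rSp - #1) * Rg rNN + (Rg rU * Rg rN + (Rg rX mod Rg rN))));;
        If (Rg rY < Rg rAcc) (Set_ rAcc (Rg rY)) Skip);;
     Sto aT (Rg rX) (Rg rAcc));;
  For rX rNN (Sto aF ((Rg rSp - #1) * Rg rNN + Rg rX) (Ld aT (Rg rX)));;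
  Sto aG (Rg rSp - #1) (#0 < (Ld aG (Rg rSp) + Ld aG (Rg rSp - #1))).

(** A digit is the opcode plus 4 times (label index plus [k] times rank), labels being given as
    positions in [aS]. *)
Definition p_instr : prog :=
  Set_ rOp (Ld aC (Rg rJ) mod #4);;
  Set_ rLab (Ld aS ((Ld aC (Rg rJ) / #4) mod Rg rk_));;
  Set_ rRk ((Ld aC (Rg rJ) / #4) / Rg rk_);;
  If (Rg rOp < #2)
    (If ((Rg rOp == #1) * (#0 < Rg rSp)) p_cut Skip;; p_leaf)
    (If (Rg rOp == #2) p_slot (If (#1 < Rg rSp) p_merge Skip)).

Definition p_finish : prog :=
  If (Rg rSp == #1)
    (Set_ rTot (Rg rTot + Ld aF (Rg rLab * Rg rN + Rg rLab));;
     For rT rN (If (Ld aU (Rg rT) == #0) (Set_ rTot (Rg rTot + Ld aP (Rg rT))) Skip);;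
     If (Rg rTot < Rg rBest) (Set_ rBest (Rg rTot)) Skip)
    Skip.

Definition p_guess : prog :=
  p_labels;;
  Set_ rSp #0;;
  Set_ rTot #0;;
  For rJ rM p_instr;;
  p_finish.

(** With at most one terminal and at least one vertex the optimum is 0; otherwise the search starts
    from [BIG], which means that no tree is known. *)
Definition p_value : prog :=
  p_dist;;
  Set_ rBest (Rg rBig * (#1 - (#0 < Rg rN) * (Rg rKC < #2)));;
  For rW rLim p_guess.

(* Euclidean division and powers slow [lia] down. *)
Ltac qlia :=
  repeat match goal with
  | H : context [divn] |- _ => clear H
  | H : context [modn] |- _ => clear H
  | H : context [expn] |- _ => clear H
  end; lia.

(** Deleting an edge amounts to writing [BIG] at its two positions; the old weight is restored if
    the optimum has become worse. *)
Definition p_prune : prog :=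
  For rXd rNN
    (Set_ rSave (Ld aW (Rg rXd));;
     Set_ rXt ((Rg rXd mod Rg rN) * Rg rN + Rg rXd / Rg rN);;
     Sto aW (Rg rXd) (Rg rBig);;
     Sto aW (Rg rXt) (Rg rBig);;
     p_value;;
     If (Rg rOpt < Rg rBest)
       (Sto aW (Rg rXd) (Rg rSave);; Sto aW (Rg rXt) (Rg rSave)) Skip).

(** Without terminals vertex 0 is reported, as a tree must have a vertex. *)
Definition p_output : prog :=
  Out #0 #1;;
  For rT rN
    (Set_ rY (Ld aK (Rg rT) + (Rg rKC == #0) * (Rg rT == #0));;
     For rU rN
       (If (Ld aW (Rg rT * Rg rN + Rg rU) < Rg rBig) (Set_ rY #1) Skip);;
     Out (Rg rT + #1) (#0 < Rg rY));;
  For rX rNN (Out (Rg rN + #1 + Rg rX) (Ld aW (Rg rX) < Rg rBig)).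

Definition p_main : prog :=
  p_value;;
  Set_ rOpt (Rg rBest);;
  If (Rg rOpt < Rg rBig) (p_prune;; p_output) (Out #0 #0).

(** The counters [rKC] and [rk_] are not reset, since registers start at 0. [BIG] is one more than
    the sum of the cost table and thus exceeds the weight of every set of edges. *)
Definition p_init : prog :=
  Set_ rNN (Rg rN * Rg rN);;
  For rT rN
    (In rY (#1 + Rg rT);; Sto aK (Rg rT) (Rg rY);; Set_ rKC (Rg rKC + Rg rY));;
  For rT rN
    (In rY (#1 + (Rg rN + Rg rT));;
     If (Rg rY) (Sto aS (Rg rk_) (Rg rT);; Set_ rk_ (Rg rk_ + #1)) Skip);;
  Set_ rBig #1;;
  For rX rNN
    (In rY (#1 + (Rg rN + (Rg rN + (Rg rNN + Rg rX))));; Set_ rBig (Rg rBig + Rg rY));;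
  For rX rNN
    (In rY (#1 + (Rg rN + (Rg rN + Rg rX)));;
     In rZ (#1 + (Rg rN + (Rg rN + (Rg rNN + Rg rX))));;
     If (Rg rY) (Sto aW (Rg rX) (Rg rZ)) (Sto aW (Rg rX) (Rg rBig)));;
  Set_ rM (#5 * Rg rk_);;
  Set_ rB (#4 * Rg rk_ * Rg rM);;
  Set_ rLim #1;;
  For rJ rM (Set_ rLim (Rg rLim * Rg rB)).

(** * Correctness of the program *)

Section Values.

Variables (n : nat) (cost : {set 'I_n} -> nat) (K S : {set 'I_n}) (BIG : nat).
Variables (lmax M : nat) (env : nat -> nat) (off : nat).

Variables (k m B LIM : nat).

Hypothesis Ek : k = #|S|.
Hypothesis Em : m = 5 * k.
Hypothesis EB : B = 4 * k * m.
Hypothesis ELIM : LIM = B ^ m.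
Hypothesis BIG0 : 0 < BIG.
Hypothesis M_index : n * n + n + m + 8 < M.
(** Room for at most [m] charges, the final entry and [n] profits, and for the sums of a few table
    entries formed on the way. *)
Hypothesis M_big : (m + n + 5) * BIG < M.
Hypothesis M_lim : LIM + B < M.
(** The stack has at most [m] entries before each push, so up to [m.+1] tables of [n * n] cells must
    fit. *)
Hypothesis L_index : m.+1 * (n * n) + n + m + 1 < lmax.
Hypothesis env_n : n <= env rN.
Hypothesis env_nn : n * n <= env rNN.
Hypothesis env_m : m <= env rM.
Hypothesis env_lim : LIM <= env rLim.

Notation wp := (wp off lmax M env).

Definition mat s a (A : 'I_n -> 'I_n -> nat) := forall u v : 'I_n, ar s a (u * n + v) = A u v.

Definition slist : seq nat := [seq val v | v <- enum S].

Record consts s : Prop := Consts {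
  c_n : rg s rN = n;
  c_nn : rg s rNN = n * n;
  c_k : rg s rk_ = k;
  c_m : rg s rM = m;
  c_B : rg s rB = B;
  c_lim : rg s rLim = LIM;
  c_big : rg s rBig = BIG;
  c_kc : rg s rKC = #|K|;
  c_K : forall t : 'I_n, ar s aK t = (t \in K);
  c_S : forall j, j < k -> ar s aS j = nth 0 slist j
}.

Definition safe_consts p := ~~ has (mem (iota 1 8)) (mr p) && ~~ has (mem (iota 0 2)) (ma p).

Lemma consts_frame p s s' : frame p s s' -> safe_consts p -> consts s -> consts s'.
Proof.
case=> fr fa _ /andP[/hasPn hr /hasPn ha] h.
have R r : r \in iota 1 8 -> rg s' r = rg s r by move=> hr'; apply: fr; apply: contraTN hr' => /hr.
have A a i : a \in iota 0 2 -> ar s' a i = ar s a i by move=> hr'; apply: fa; apply: contraTN hr' => /ha.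
by case: h => *; split; rewrite ?R //= => *; rewrite A //; auto.
Qed.

Lemma pairP i : i < n * n -> exists u v : 'I_n, [/\ i = u * n + v, i %/ n = u & i %% n = v].
Proof.
move=> hi; have n0 : 0 < n by case: (n) hi.
have hu : i %/ n < n by rewrite ltn_divLR.
have hv : i %% n < n by rewrite ltn_pmod.
by exists (Ordinal hu), (Ordinal hv); split=> //=; rewrite -divn_eq.
Qed.

Lemma pair_ltn (u v : 'I_n) : u * n + v < n * n.
Proof.
have := ltn_ord u; have := ltn_ord v => hv hu.
by have : u.+1 * n <= n * n; [rewrite leq_mul2r hu orbT|rewrite mulSn; lia].
Qed.

Lemma pair_inj (u v u' v' : 'I_n) : u * n + v = u' * n + v' -> u = u' /\ v = v'.
Proof.
have n0 : 0 < n by case: (n) u => [[]|].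
move=> h; have := congr1 (divn^~ n) h; have := congr1 (modn^~ n) h.
rewrite /= !modnMDl !modn_small ?ltn_ord // !divnMDl // !divn_small ?ltn_ord // !addn0.
by move=> /val_inj -> /val_inj ->.
Qed.

(** The premise about the body also describes array [a] itself, for loops such as the last one of
    [p_labels] that read the array they overwrite. *)
Lemma wp_fill r b a ix e N base (f : nat -> nat) (Q : st -> Prop) s :
  rg s b = N -> N <= env b ->
  (forall i s', i < N -> rg s' r = i -> frame (For r b (Sto a ix e)) s s' ->
     (forall j, ~~ (base <= j < base + i) -> ar s' a j = ar s a j) ->
     [/\ ev s' ix = base + i, ev s' e = f i, base + i < lmax & f i < M]) ->
  (forall s', frame (For r b (Sto a ix e)) s s' ->
     (forall j, ar s' a j = if base <= j < base + N then f (j - base) else ar s a j) -> Q s') ->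
  wp (For r b (Sto a ix e)) Q s.
Proof.
move=> hb hN hB hQ.
apply: (@wp_for _ _ _ _ _ _ _ (fun i s' =>
  forall j, ar s' a j = if base <= j < base + i then f (j - base) else ar s a j)).
- by rewrite hb.
- by move=> j; case: ifP => //; lia.
- move=> i s' hi hx _ hI hf; rewrite hb in hi.
  have [|e1 e2 h1 h2] := hB i s' hi hx hf; first by move=> j /negbTE h; rewrite hI h.
  rewrite /= e1 e2; split=> // j /=; rewrite eqxx /upd hI; case: eqP => [->|ne].
    by rewrite leq_addr addnS ltnSn addKn.
  by congr (if _ then _ else _); lia.
- by move=> s' _ hI hf; apply: hQ => // j; rewrite hI hb.
Qed.

Lemma ltM x : x <= 5 * BIG -> x < M.
Proof.
move=> h; apply: leq_ltn_trans h (leq_ltn_trans _ M_big).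
by rewrite leq_mul2r leq_addl orbT.
Qed.

Lemma wp_set x r e q (Q : st -> Prop) s : ev s e = x -> x < M ->
  wp q Q (setr s r x) -> wp (Set_ r e;; q) Q s.
Proof. by move=> <-. Qed.

Lemma wp_sto j x a i e q (Q : st -> Prop) s : ev s i = j -> ev s e = x ->
  j < lmax -> x < M -> wp q Q (seta s a j x) -> wp (Sto a i e;; q) Q s.
Proof. by move=> <- <-. Qed.

Lemma wp_if e p q (Q : st -> Prop) s : (ev s e != 0 -> wp p Q s) ->
  (ev s e = 0 -> wp q Q s) -> wp (If e p q) Q s.
Proof. by move=> hp hq /=; case: eqP => [/hq|/eqP/hp]. Qed.

Lemma consts_setr s r x : r \notin iota 1 8 -> consts s -> consts (setr s r x).
Proof.
move=> hr; apply: (@consts_frame (Set_ r #0)); last by rewrite /safe_consts /= orbF hr.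
by split=> //= r'; rewrite inE /upd => /negbTE ->.
Qed.

Lemma consts_seta s a i x : a \notin iota 0 2 -> consts s -> consts (seta s a i x).
Proof.
move=> hr; apply: (@consts_frame (Sto a #0 #0)); last by rewrite /safe_consts /= orbF hr.
by split=> //= a' j; rewrite inE /upd => /negbTE ->.
Qed.

(** * The distance matrix *)

Section Distances.

Variable E : {set {set 'I_n}}.
Notation cmat := (cmat E cost BIG).
Notation cheap := (cheap E cost BIG).

Record metric (D : 'I_n -> 'I_n -> nat) : Prop := Metric {
  m_sound : forall u v, cheap (D u v) [set u; v];
  m_refl : forall u, D u u = 0;
  m_tri : forall u v w, D u v <= D u w + D w v;
  m_edge : forall u v, D u v <= cmat u v;
  m_big : forall u v, D u v <= BIG
}.

Lemma p_dist_ok s : consts s -> mat s aW cmat -> (forall u v, cmat u v <= BIG) ->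
  wp p_dist (fun s' => exists D, mat s' aD D /\ metric D) s.
Proof.
move=> hc hW WB; pose D1 (u v : 'I_n) := if u == v then 0 else cmat u v.
have D1B u v : D1 u v <= BIG by rewrite /D1; case: ifP.
apply: (@wp_seq _ _ _ _ _ _ _ (fun s' => mat s' aD D1)).
  apply: (@wp_fill _ _ _ _ _ (n * n) 0 (fun x => (1 - (x %/ n == x %% n)) * ar s aW x)).
  - exact: c_nn.
  - by [].
  - move=> i s' hi hx hf _; have hc' := consts_frame hf erefl hc.
    have [u [v [ei eu ev]]] := pairP hi.
    rewrite /= hx (c_n hc') eu ev ei hW; split=> //; last 2 first.
      by rewrite -ei; qlia.
      apply: ltM; apply: leq_trans (leq_pmull _ _) => //; apply: leq_trans (WB u v).
      by case: eqP; rewrite ?mul0n ?mul1n.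
    by case: hf => _ -> //; rewrite hW.
  - move=> s' hf hD u v; rewrite hD add0n leq0n pair_ltn /= subn0 hW.
    have n0 : 0 < n by case: (n) u => [[]|].
    rewrite divnMDl // divn_small // addn0 modnMDl modn_small // /D1 -val_eqE.
    by case: (_ == _); rewrite ?mul0n ?mul1n.
move=> {hW} s1 hD1 /consts_frame/(_ erefl hc) {}hc.
(* Shortest paths are never mentioned: soundness, a zero diagonal and the triangle inequality
   through the first [l] vertices make up an invariant, and they are what the stack machine needs of
   [D]. *)
pose met l (D : 'I_n -> 'I_n -> nat) := [/\ forall u v, cheap (D u v) [set u; v],
  forall u, D u u = 0, forall u v w : 'I_n, w < l -> D u v <= D u w + D w v,
  forall u v, D u v <= cmat u v & forall u v, D u v <= BIG].
apply: (@wp_for _ _ _ _ _ _ _ (fun l s' => exists D, mat s' aD D /\ met l D)).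
- by rewrite (c_n hc).
- exists D1; split=> //; split=> // u *; rewrite /D1 ?eqxx //.
    by case: eqP => [->|_]; [rewrite setUid; exact: cheap1|exact: cheap_cmat].
  by case: ifP.
- move=> l s' hl hx _ [D [hD [d1 d2 d3 d4 d5]]] hf.
  rewrite (c_n hc) in hl; pose w := Ordinal hl.
  have hc' := consts_frame hf erefl hc.
  pose D' u v := minn (D u v) (D u w + D w v).
  apply: (@wp_conseq _ _ _ _ _ _ (fun s' => mat s' aD D')); last first.
    move=> s2 hD2 _; exists D'; split=> //; split.
    + move=> u v; rewrite /D'; case: leqP => _; first exact: d1.
      apply: cheap_sub (cheap_glue w _ _ (@d1 u w) (@d1 w v)) => //.
      * by apply/subsetP => z; rewrite !inE => /orP[] ->; rewrite ?orbT.
      * by rewrite !inE eqxx orbT.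
      * by rewrite !inE eqxx.
    + by move=> u; rewrite /D' d2 min0n.
    + move=> u v z; rewrite ltnS leq_eqVlt => /orP[/eqP zl|zl].
        have -> : z = w by apply: val_inj.
        rewrite /D' !d2 !addn0 !add0n !minnn; exact: geq_minr.
      rewrite /D'; have := d3 u v z zl; have := d3 u w z zl; have := d3 w v z zl; qlia.
    + by move=> u v; rewrite /D' geq_min d4.
    + by move=> u v; rewrite /D' geq_min d5.
  apply: (@wp_for _ _ _ _ _ _ _ (fun i s' => forall u v : 'I_n,
      ar s' aD (u * n + v) = if u * n + v < i then D' u v else D u v)).
  + by rewrite (c_nn hc').
  + by move=> u v; exact: hD.
  + move=> i s2 hi hx2 _ hI hf2; have hc2 := consts_frame hf2 erefl hc'.
    rewrite (c_nn hc') in hi; have [u [v [ei eu ev]]] := pairP hi.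
    have el : rg s2 rL = w by case: hf2 => -> //.
    (* Row and column of the pivot [w] do not change during its round because [D w w] is 0; hence
       updating in place is safe. *)
    have huw : ar s2 aD (u * n + w) = D u w.
      by rewrite hI /D' d2 addn0 minnn if_same.
    have hwv : ar s2 aD (w * n + v) = D w v.
      by rewrite hI /D' d2 add0n minnn if_same.
    rewrite /= hx2 (c_n hc2) eu ev el huw hwv.
    have duv : ar s2 aD i = D u v by rewrite ei hI -ei ltnn.
    have bb := (d5 u w, d5 w v); split; first by apply: ltM; case: bb; qlia.
    rewrite /upd /= hx2 duv; case: ifP => /= hlt.
      split; [qlia|by apply: ltM; case: bb; qlia|].
      move=> u' v'; case: eqP => [e|ne].
        have e' : u' * n + v' = u * n + v by rewrite e.
        by have [-> ->] := pair_inj e'; rewrite -ei ltnSn /D'; qlia.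
      by rewrite hI; congr (if _ then _ else _); qlia.
    move=> u' v'; rewrite hI; case: (ltngtP (u' * n + v') i) => [h|h|e].
    * by rewrite ltnW.
    * by rewrite ltnS leqNgt h.
    * rewrite e ltnSn; have e' : u' * n + v' = u * n + v by rewrite e.
      by have [-> ->] := pair_inj e'; rewrite /D'; qlia.
  + by move=> s2 _ hI _ u v; rewrite hI (c_nn hc') pair_ltn.
move=> s2 _ [D [hD [d1 d2 d3 d4 d5]]] _; exists D; split=> //; split=> //.
by move=> u v w; apply: d3; rewrite (c_n hc).
Qed.

End Distances.

Definition digit w j := (w %/ B ^ j) %% B.

Definition decodes c (p : ranked n) :=
  [/\ p.1.1 = c %% 4, val p.1.2 = nth 0 slist ((c %/ 4) %% k) & p.2 = c %/ 4 %/ k].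

Definition decoded w (kw : seq (ranked n)) :=
  size kw = m /\ forall j d, j < m -> decodes (digit w j) (nth d kw j).

Lemma slist_ord j : j < k -> exists2 l : 'I_n, val l = nth 0 slist j & l \in S.
Proof.
move=> hj; have : nth 0 slist j \in slist by rewrite mem_nth // size_map -cardE -Ek.
by case/mapP => l; rewrite mem_enum => lS ->; exists l.
Qed.

Lemma k_gt0 : 0 < m -> 0 < k.
Proof. by rewrite Em; case: (k). Qed.

(** Every word is some code, so the loop over all words needs no validity test. *)
Lemma decodable w : exists kw, decoded w kw.
Proof.
suff H i : i <= m -> exists kw, size kw = i /\ forall j d, j < i -> decodes (digit w j) (nth d kw j).
  by apply: H.
elim: i => [_|i IH hi]; first by exists [::].
have [kw [sk hk]] := IH (ltnW hi).
have k0 : 0 < k by apply: k_gt0; case: (m) hi.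
have [l el lS] := slist_ord (ltn_pmod (digit w i %/ 4) k0).
exists (rcons kw ((digit w i %% 4, l), digit w i %/ 4 %/ k)); split; first by rewrite size_rcons sk.
move=> j d; rewrite ltnS nth_rcons sk; case: ltngtP => // [h _|-> _]; first exact: hk.
by split.
Qed.

Lemma encodable (kw : seq (ranked n)) : size kw = m ->
  all (fun p => [&& p.1.1 < 4, p.1.2 \in S & p.2 < m]) kw ->
  exists2 w, w < LIM & decoded w kw.
Proof.
move=> sk hk; suff H i : i <= m -> exists2 w, w < B ^ i &
    forall j d, j < i -> decodes (digit w j) (nth d kw j).
  by have [w hw hd] := H m (leqnn _); exists w; rewrite ?ELIM.
elim: i => [_|i IH hi]; first by exists 0.
have [w hw hd] := IH (ltnW hi).
case: (kw) sk hk hd => [|d0 kw'] sk; first by rewrite -sk in hi.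
move: sk; set kw1 := _ :: _ => sk hk hd; move: (all_nthP d0 hk i).
rewrite sk hi => /(_ isT) /and3P[].
case e : (nth d0 kw1 i) => [[o l] r] /= ho lS hr.
have k0 : 0 < k by rewrite Ek; apply/card_gt0P; exists l.
have lsl : val l \in slist by rewrite map_f // mem_enum.
have il : index (val l) slist < k by rewrite Ek cardE -(size_map val) index_mem.
pose c := o + 4 * (index (val l) slist + k * r).
have c4 : c %% 4 = o by rewrite /c addnC mulnC modnMDl modn_small.
have cd : c %/ 4 = index (val l) slist + k * r.
  by rewrite /c addnC mulnC divnMDl // divn_small // addn0.
have ck : (c %/ 4) %% k = index (val l) slist.
  by rewrite cd addnC mulnC modnMDl modn_small.
have cr : c %/ 4 %/ k = r by rewrite cd addnC mulnC divnMDl // divn_small // addn0.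
have cB : c < B.
  have h1 : k * r.+1 <= k * m by rewrite leq_mul2l hr orbT.
  by rewrite EB /c -mulnA; rewrite mulnS in h1; lia.
have Bi : 0 < B ^ i by rewrite expn_gt0 (leq_ltn_trans _ cB).
exists (w + c * B ^ i).
  by rewrite expnS; have : c.+1 * B ^ i <= B * B ^ i; [rewrite leq_mul2r cB orbT|rewrite mulSn; lia].
move=> j d; rewrite ltnS leq_eqVlt => /orP[/eqP ->|hj].
  have -> : digit (w + c * B ^ i) i = c.
    by rewrite /digit addnC divnMDl // divn_small // addn0 modn_small.
  rewrite (set_nth_default d0) ?sk // e; split=> //=; rewrite ?cr ?c4 //.
  by rewrite ck nth_index.
(* For [j < i] the new summand divided by [B ^ j] is a multiple of [B]. *)
have -> : digit (w + c * B ^ i) j = digit w j; last exact: hd.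
have B0 : 0 < B by apply: leq_ltn_trans cB.
rewrite /digit -(subnKC (ltnW hj)) expnD (mulnC (B ^ j)) mulnA divnDMl ?expn_gt0 ?B0 //.
have : 0 < i - j by rewrite subn_gt0.
case: (i - j) => // i' _.
by rewrite expnS mulnCA mulnC addnC modnMDl.
Qed.

Lemma bigmin_rcons (I : Type) (r : seq I) i b (F : I -> nat) :
  \big[minn/b]_(j <- rcons r i) F j = minn (\big[minn/b]_(j <- r) F j) (F i).
Proof.
elim: r => [|j r IH]; rewrite /= !big_cons; first by rewrite !big_nil minnC.
by rewrite IH minnA.
Qed.

(** * Evaluation of a single guess *)

Section Guess.

Variables (D : 'I_n -> 'I_n -> nat) (w : nat) (kw : seq (ranked n)).
Hypothesis DB : forall u v, D u v <= BIG.
Hypothesis wLIM : w < LIM.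
Hypothesis kwP : decoded w kw.

Notation code := (unzip1 kw).
Notation pi := (profit D BIG K code).

Lemma lab_read s j : consts s -> ar s aC j = digit w j -> j < m ->
  exists p, [/\ forall d, nth d kw j = p, decodes (digit w j) p &
    ar s aS ((digit w j %/ 4) %% k) = p.1.2].
Proof.
case: kwP => sk hk hc hC hj; case E : kw => [|d0 kw']; first by rewrite -sk E in hj.
exists (nth d0 kw j); split.
- by move=> d; rewrite -E; apply: set_nth_default; rewrite sk.
- exact: hk.
- rewrite (c_S hc); first by case: (hk j d0 hj) => _ -> _.
  by rewrite ltn_pmod // k_gt0 //; case: (m) hj.
Qed.

Lemma take_rcons (T : Type) d (l : seq T) j : j < size l ->
  take j.+1 l = rcons (take j l) (nth d l j).
Proof. exact: take_nth. Qed.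

Lemma p_labels_ok s : consts s -> mat s aD D -> rg s rW = w ->
  wp p_labels (fun s' => [/\ forall j, j < m -> ar s' aC j = digit w j,
     forall t : 'I_n, ar s' aP t = pi t & forall t : 'I_n, ar s' aU t = 0]) s.
Proof.
move=> hc hD hw; rewrite /p_labels.
apply: (@wp_seq _ _ _ _ _ _ _ (fun s' => forall t : 'I_n, ar s' aP t = BIG)).
  apply: (@wp_fill _ _ _ _ _ n 0 (fun=> BIG)) => //; first exact: c_n.
    move=> i s' hi hx hf _; have hc' := consts_frame hf erefl hc.
    by rewrite /= hx (c_big hc'); split=> //; [qlia|apply: ltM; qlia].
  by move=> s' _ hP t; rewrite hP /= ltn_ord.
move=> s1 hP1 hf1; have {}hc := consts_frame hf1 erefl hc.
have {}hD : mat s1 aD D by move=> u v; case: hf1 => _ -> //.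
have {}hw : rg s1 rW = w by case: hf1 => -> //.
apply: (@wp_seq _ _ _ _ _ _ _ (fun s' => forall t : 'I_n, ar s' aU t = 0)).
  apply: (@wp_fill _ _ _ _ _ n 0 (fun=> 0)) => //; first exact: c_n.
    move=> i s' hi hx hf _; have hc' := consts_frame hf erefl hc.
    by rewrite /= hx; split=> //; qlia.
  by move=> s' _ hP t; rewrite hP /= ltn_ord.
move=> s2 hU2 hf2; have {}hc := consts_frame hf2 erefl hc.
have {}hD : mat s2 aD D by move=> u v; case: hf2 => _ -> //.
have {}hw : rg s2 rW = w by case: hf2 => -> //.
have {}hP : forall t : 'I_n, ar s2 aP t = BIG by move=> t; case: hf2 => _ -> //.
apply: (@wp_set w) => //; first by apply: ltn_trans wLIM _; qlia.
set s3 := setr _ _ _; have hc3 : consts s3 by apply: consts_setr.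
pose part j (t : 'I_n) := \big[minn/BIG]_(l <- labels (take j code)) D l t.
apply: (@wp_seq _ _ _ _ _ _ _ (fun s' => (forall j, j < m -> ar s' aC j = digit w j) /\
   forall t : 'I_n, ar s' aP t = part m t)).
  apply: (@wp_for _ _ _ _ _ _ _ (fun j s' => [/\ rg s' rZ = w %/ B ^ j,
     forall i, i < j -> ar s' aC i = digit w i & forall t : 'I_n, ar s' aP t = part j t])).
  - by rewrite (c_m hc3).
  - by split=> // [|t]; rewrite /= ?expn0 ?divn1 //= hP /part take0 /labels /= big_nil.
  - move=> j s4 hj hx _ [hz hC hP4] hf4; have hc4 := consts_frame hf4 erefl hc3.
    rewrite (c_m hc3) in hj.
    have dz : rg s4 rZ %% rg s4 rB = digit w j by rewrite hz (c_B hc4).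
    have zM : w %/ B ^ j < M by apply: leq_ltn_trans (leq_div _ _) _; qlia.
    apply: (wp_sto (j := j) (x := digit w j)) => //; [qlia|by apply: leq_ltn_trans (leq_mod _ _) _|].
    apply: (@wp_set (w %/ B ^ j.+1)).
    - by rewrite /= hz (c_B hc4) -divnMA -expnSr.
    - by apply: leq_ltn_trans (leq_div _ _) _; qlia.
    set s5 := setr _ _ _.
    have hc5 : consts s5 by apply: consts_setr => //; apply: consts_seta.
    have hC5 i : i < j.+1 -> ar s5 aC i = digit w i.
      rewrite /s5 /= /upd ltnS leq_eqVlt; case: eqP => [-> //|_] /=; exact: hC.
    have [p [hp hd hl]] := lab_read hc5 (hC5 j (ltnSn j)) hj.
    have cj : nth p.1 code j = p.1 by rewrite (nth_map p) ?hp //; case: kwP => ->.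
    have pS t : part j.+1 t = if p.1.1 < 2 then minn (part j t) (D p.1.2 t) else part j t.
      rewrite /part (take_nth p.1) ?cj; last by rewrite size_map; case: kwP => ->.
      by rewrite /labels filter_rcons; case: ifP => _ //; rewrite map_rcons bigmin_rcons.
    have hx5 : rg s5 rJ = j by rewrite /s5 /= /upd /=.
    have hP5 (t : 'I_n) : ar s5 aP t = part j t by exact: hP4.
    have hD5 : mat s5 aD D.
      by move=> u v; rewrite /s5 /=; case: hf4 => _ -> // _; exact: hD.
    have ec : ar s5 aC (rg s5 rJ) = digit w j by rewrite hx5 hC5.
    have hz5 : rg s5 rZ = w %/ B ^ j.+1 by rewrite /s5 /= /upd /=.
    clearbody s5.
    case: hd => d1 d2 d3.
    apply: wp_if; rewrite [ev _ _]/= ec -d1 => hop.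
      have {}hop : p.1.1 < 2 by case: (p.1.1 < 2) hop.
      apply: (@wp_set p.1.2); first by rewrite /= ec (c_k hc5) hl.
        by have := ltn_ord p.1.2; qlia.
      set s6 := setr _ _ _; have hc6 : consts s6 by apply: consts_setr.
      apply: (@wp_for _ _ _ _ _ _ _ (fun i s' => forall t : 'I_n,
        ar s' aP t = if t < i then part j.+1 t else part j t)).
      + by rewrite (c_n hc6).
      + by move=> t; exact: hP5.
      + move=> i s7 hi hx7 _ hP7 hf7; have hc7 := consts_frame hf7 erefl hc6.
        rewrite (c_n hc6) in hi; pose ti := Ordinal hi.
        have hl7 : rg s7 rLab = p.1.2 by case: hf7 => -> //=; rewrite /s6 /= /upd.
        have hD7 : mat s7 aD D by move=> u v; case: hf7 => _ -> // _; exact: hD5.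
        have hPi : ar s7 aP i = part j ti by rewrite (hP7 ti) /= ltnn.
        rewrite /= hx7 hl7 (c_n hc7) (hD7 p.1.2 ti) hPi.
        case: ifP => h.
          split; [qlia|by apply: ltM; have := DB p.1.2 ti; qlia|].
          move=> t; rewrite /upd /=; case: eqP => [e|ne].
            have -> : t = ti by apply: val_inj.
            by rewrite /= ltnSn pS hop; move: h; rewrite minnC /minn; case: ltnP.
          by rewrite hP7; congr (if _ then _ else _); qlia.
        move=> t; rewrite hP7; case: (eqVneq t ti) => [->|nt].
          rewrite /= ltnn ltnSn pS hop; move: h; rewrite /minn.
          by case: ltngtP => // ->.
        by have : (t : nat) != i := nt; move=> ne; congr (if _ then _ else _); qlia.
      + move=> s7 _ hP7 hf7; split.
        * by rewrite /= /upd /=; case: hf7 => -> //=; rewrite /s6 /= /upd.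
        * by move=> i hi /=; case: hf7 => _ -> // _; exact: hC5.
        * by move=> t; rewrite /= hP7 (c_n hc6) ltn_ord.
    split=> // t; rewrite pS ifF; [exact: hP5|by case: (p.1.1 < 2) hop].
  - by move=> s4 _ [h1 h2 h3] _; split=> [i|t]; rewrite -?(c_m hc3); [exact: h2|exact: h3].
move=> s4 [hC4 hP4] hf4; have hc4 := consts_frame hf4 erefl hc3.
have pE t : pi t = (t \in K) * part m t.
  rewrite /profit /part take_oversize; last by rewrite size_map; case: kwP => ->.
  by case: ifP; rewrite ?mul0n ?mul1n.
apply: (@wp_fill _ _ _ _ _ n 0 (fun x => ar s4 aP x * ar s4 aK x)) => //; first exact: c_n.
  move=> i s5 hi hx hf hA; have hc5 := consts_frame hf erefl hc4.
  pose ti := Ordinal hi.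
  rewrite /= hx; rewrite hA; last by qlia.
  rewrite (c_K hc5 ti) (c_K hc4 ti); split=> //; first qlia.
  apply: ltM; rewrite (hP4 ti); apply: leq_trans (_ : part m ti <= _).
    by case: (ti \in K); rewrite ?muln0 ?muln1.
  by apply: leq_trans (bigmin_le_init _ _ _) _; qlia.
move=> s5 hf hA; split.
- by move=> j hj; case: hf => _ -> // _; exact: hC4.
- by move=> t; rewrite hA /= ltn_ord subn0 hP4 (c_K hc4) pE mulnC.
- by move=> t; case: hf => _ -> // _; case: hf4 => _ -> // _; exact: hU2.
Qed.


Record data s : Prop := Data {
  d_consts : consts s;
  d_D : mat s aD D;
  d_C : forall j, j < m -> ar s aC j = digit w j;
  d_P : forall t : 'I_n, ar s aP t = pi t
}.

Definition safe_data p :=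
  ~~ has (mem (iota 1 8)) (mr p) && ~~ has (mem [:: 0; 1; 3; 4; 5]) (ma p).

Lemma data_frame p s s' : frame p s s' -> safe_data p -> data s -> data s'.
Proof.
move=> hf /andP[hr /hasPn ha] [h1 h2 h3 h4].
have A a i : a \in [:: 0; 1; 3; 4; 5] -> ar s' a i = ar s a i.
  by move=> hr'; case: hf => _ -> //; apply: contraTN hr' => /ha.
split=> [|u v|j hj|t]; rewrite ?A //; try by auto.
apply: consts_frame hf _ h1; rewrite /safe_consts hr /=.
by apply/hasPn => a /ha; apply: contraNN; rewrite !inE => /orP[] ->; rewrite ?orbT.
Qed.

Lemma data_setr s r x : r \notin iota 1 8 -> data s -> data (setr s r x).
Proof.
move=> hr; apply: (@data_frame (Set_ r #0)); last by rewrite /safe_data /= orbF hr.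
by split=> //= r'; rewrite inE /upd => /negbTE ->.
Qed.

Lemma data_seta s a i x : a \notin [:: 0; 1; 3; 4; 5] -> data s -> data (seta s a i x).
Proof.
move=> hr; apply: (@data_frame (Sto a #0 #0)); last by rewrite /safe_data /= orbF hr.
by split=> //= a' j; rewrite inE /upd => /negbTE ->.
Qed.

Lemma frame_ar p s s' a i : frame p s s' -> a \notin ma p -> ar s' a i = ar s a i.
Proof. by case=> _ h _; apply: h. Qed.

Lemma frame_rg p s s' r : frame p s s' -> r \notin mr p -> rg s' r = rg s r.
Proof. by case=> h _ _; apply: h. Qed.

(** The head of the list is the top of the stack, so the length of the tail is the height at which
    an entry is stored. *)
Fixpoint stk s (es : seq (entry n)) : Prop :=
  if es is e :: es' then
    [/\ forall u v : 'I_n, ar s aF (size es' * (n * n) + (u * n + v)) = e.1 u v,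
        forall u v, e.1 u v <= BIG, ar s aG (size es') = e.2 & stk s es']
  else True.

Lemma stk_ext s s' es : stk s es ->
  (forall i, i < size es * (n * n) -> ar s' aF i = ar s aF i) ->
  (forall l, l < size es -> ar s' aG l = ar s aG l) -> stk s' es.
Proof.
elim: es => //= e es IH [h1 h2 h3 h4] hF hG; split=> //.
- by move=> u v; rewrite hF // mulSn addnC ltn_add2r pair_ltn.
- by rewrite hG.
- apply: IH => // [i hi|l hl]; last by apply: hG; rewrite ltnS ltnW.
  by apply: hF; apply: leq_trans hi _; rewrite leq_mul2r leqnSn orbT.
Qed.

Lemma ltL l x : l <= m -> x < n * n -> l * (n * n) + x < lmax.
Proof.
move=> hl hx; have : l * (n * n) <= m * (n * n) by rewrite leq_mul2r hl orbT.
by move: L_index; rewrite mulSn; qlia.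
Qed.

Lemma leaf_like_ok s es b e f : data s -> stk s es -> rg s rSp = size es -> size es <= m ->
  (forall u v, f u v <= BIG) ->
  (forall i s', i < n * n -> rg s' rX = i -> consts s' -> mat s' aD D ->
    rg s' rLab = rg s rLab -> forall u v : 'I_n, i = u * n + v -> i %/ n = u ->
    ev s' e = f u v) ->
  wp (For rX rNN (Sto aF (Rg rSp * Rg rNN + Rg rX) e);;
      Sto aG (Rg rSp) (Cst (nat_of_bool b));; Set_ rSp (Rg rSp + #1))
    (fun s' => stk s' ((f, b) :: es) /\ rg s' rSp = (size es).+1) s.
Proof.
move=> hd hs hsp hm hf hb.
(* [wp_fill] expects the table as a function of the cell number, defined for all numbers. *)
pose g x := if insub (x %/ n) is Some u then if insub (x %% n) is Some v then f u v else 0 else 0.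
have gE (u v : 'I_n) : g (u * n + v) = f u v.
  have n0 : 0 < n by case: (n) u => [[]|].
  by rewrite /g divnMDl // divn_small // addn0 modnMDl modn_small // !valK.
apply: (@wp_seq _ _ _ _ _ _ _ (fun s' => stk s' es /\
   forall u v : 'I_n, ar s' aF (size es * (n * n) + (u * n + v)) = f u v)).
  apply: (@wp_fill _ _ _ _ _ (n * n) (size es * (n * n)) g).
  - exact: c_nn (d_consts hd).
  - by [].
  - move=> i s' hi hx hfr _; have hc := consts_frame hfr erefl (d_consts hd).
    have [u [v [ei eu ev']]] := pairP hi.
    have hsp' : rg s' rSp = size es by rewrite (frame_rg hfr).
    split=> /=; rewrite ?hsp' ?(c_nn hc) ?hx //.
    + rewrite [in RHS]ei gE; apply: (hb i) => //.
      * by move=> u' v'; rewrite (frame_ar _ hfr) // (d_D hd).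
      * by rewrite (frame_rg hfr).
    + exact: ltL.
    + by apply: ltM; rewrite ei gE; have := hf u v; qlia.
  - move=> s' hfr hA; split.
      apply: stk_ext hs _ _ => [i hi|l _]; last by rewrite (frame_ar _ hfr).
      by rewrite hA ifF // leqNgt hi.
    by move=> u v; rewrite hA leq_addr ltn_add2l pair_ltn addKn gE.
move=> s1 [hs1 hF1] hfr1; have hsp1 : rg s1 rSp = size es by rewrite (frame_rg hfr1).
rewrite /= hsp1 /upd /= addn1; split.
- by have := ltL hm; move: L_index; qlia.
- by case: b; qlia.
split; first by qlia.
split=> //; split=> //=; first by rewrite eqxx.
apply: stk_ext hs1 _ _ => //= l hl; rewrite /upd ltn_eqF //.
Qed.

Lemma p_leaf_ok s es l : data s -> stk s es -> rg s rSp = size es -> size es <= m ->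
  rg s rLab = val l ->
  wp p_leaf (fun s' => stk s' ((fun v _ => D v l, false) :: es) /\ rg s' rSp = (size es).+1) s.
Proof.
move=> hd hs hsp hm hl.
apply: (@leaf_like_ok _ _ false _ (fun v _ => D v l)) => // i s' hi hx hc hD hl' u v ei eu.
by rewrite /= hx (c_n hc) hl' hl eu hD.
Qed.

Lemma p_slot_ok s es : data s -> stk s es -> rg s rSp = size es -> size es <= m ->
  wp p_slot (fun s' => stk s' ((D, true) :: es) /\ rg s' rSp = (size es).+1) s.
Proof.
move=> hd hs hsp hm.
apply: (@leaf_like_ok _ _ true _ D) => // i s' hi hx hc hD hl' u v ei eu.
by rewrite /= hx ei hD.
Qed.

Lemma p_merge_ok s e1 e2 es : data s -> stk s (e1 :: e2 :: es) -> rg s rSp = (size es).+2 ->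
  (size es).+1 <= m ->
  wp p_merge (fun s' => stk s' ((mergetab D BIG e1.1 e2.1, e1.2 || e2.2) :: es) /\
                        rg s' rSp = (size es).+1) s.
Proof.
move=> hd [f1 b1 g1 [f2 b2 g2 hs]] hsp hm.
rewrite /p_merge; apply: (@wp_set (size es).+1); first by rewrite /= hsp subn1.
  by qlia.
set s1 := setr _ _ _; have hd1 : data s1 by apply: data_setr.
have hsp1 : rg s1 rSp = (size es).+1 by [].
have f11 : forall u v : 'I_n, ar s1 aF ((size es).+1 * (n * n) + (u * n + v)) = e1.1 u v by [].
have f21 : forall u v : 'I_n, ar s1 aF (size es * (n * n) + (u * n + v)) = e2.1 u v by [].
have g11 : ar s1 aG (size es).+1 = e1.2 by [].
have g21 : ar s1 aG (size es) = e2.2 by [].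
have hs1 : stk s1 es by apply: stk_ext hs _ _.
clearbody s1; clear f1 f2 g1 g2 hs hd hsp s.
pose mt := mergetab D BIG e1.1 e2.1.
have mtB u v : mt u v <= BIG by exact: bigmin_le_init.
apply: (@wp_seq _ _ _ _ _ _ _ (fun s' => forall u v : 'I_n, ar s' aT (u * n + v) = mt u v)).
  apply: (@wp_for _ _ _ _ _ _ _ (fun i s' => forall u v : 'I_n, u * n + v < i ->
     ar s' aT (u * n + v) = mt u v)) => //.
  - by rewrite (c_nn (d_consts hd1)).
  - move=> i s2 hi hx _ hI hf2; rewrite (c_nn (d_consts hd1)) in hi.
    have [v [t [ei ev' et]]] := pairP hi.
    have hd2 := data_frame hf2 erefl hd1; have hc2 := d_consts hd2.
    have hsp2 : rg s2 rSp = (size es).+1 by rewrite (frame_rg hf2).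
    pose part i := \big[minn/BIG]_(u <- take i (enum 'I_n)) (D v u + e1.1 u t + e2.1 u t).
    apply: (@wp_set BIG); [by rewrite /= (c_big hc2)|by apply: ltM; qlia|].
    set s3 := setr _ _ _.
    have hd3 : data s3 by apply: data_setr.
    have hx3 : rg s3 rX = i by [].
    have hsp3 : rg s3 rSp = (size es).+1 by [].
    have F1 (u : 'I_n) : ar s3 aF ((size es).+1 * (n * n) + (u * n + t)) = e1.1 u t.
      by rewrite /= (frame_ar _ hf2).
    have F2 (u : 'I_n) : ar s3 aF (size es * (n * n) + (u * n + t)) = e2.1 u t.
      by rewrite /= (frame_ar _ hf2).
    have T3 (u u' : 'I_n) : u * n + u' < i -> ar s3 aT (u * n + u') = mt u u' by exact: hI.
    have A3 : rg s3 rAcc = BIG by rewrite /s3 /= /upd.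
    clearbody s3; clear hd2 hc2 hsp2 hI hf2 hx.
    apply: (@wp_seq _ _ _ _ _ _ _ (fun s' => rg s' rAcc = mt v t)).
      apply: (@wp_for _ _ _ _ _ _ _ (fun i s' => rg s' rAcc = part i)).
      + by rewrite (c_n (d_consts hd3)).
      + by rewrite /= /upd /= A3 /part take0 big_nil.
      + move=> l s4 hl hu _ hA hf4; have hd4 := data_frame hf4 erefl hd3.
        have hc4 := d_consts hd4; rewrite (c_n (d_consts hd3)) in hl.
        pose u := Ordinal hl.
        have hx4 : rg s4 rX = i by rewrite (frame_rg hf4).
        have hsp4 : rg s4 rSp = (size es).+1 by rewrite (frame_rg hf4).
        have pS : part l.+1 = minn (part l) (D v u + e1.1 u t + e2.1 u t).
          rewrite /part (take_nth u) ?size_enum_ord // bigmin_rcons.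
          by have -> : nth u (enum 'I_n) l = u by apply: val_inj; rewrite /= nth_enum_ord.
        rewrite /= hu hx4 hsp4 (c_n hc4) (c_nn hc4) ev' et subn1 /=.
        have -> : ar s4 aD (v * n + l) = D v u by rewrite -(d_D hd4).
        have -> : ar s4 aF ((size es).+1 * (n * n) + (l * n + t)) = e1.1 u t.
          by rewrite (frame_ar _ hf4) // -F1.
        have -> : ar s4 aF (size es * (n * n) + (l * n + t)) = e2.1 u t.
          by rewrite (frame_ar _ hf4) // -F2.
        set y := D v u + _ + _.
        have yB : y < M.
          by apply: ltM; have := DB v u; have := b1 u t; have := b2 u t; rewrite /y; qlia.
        split=> //; rewrite /upd /= hA; case: (ltnP y (part l)) => h /=.
          split=> //; rewrite pS -/y; apply/esym/minn_idPr; exact: ltnW.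
        by rewrite pS -/y; apply/esym/minn_idPl.
      + move=> s4 _ -> _; rewrite (c_n (d_consts hd3)) /part take_oversize ?size_enum_ord //.
        by rewrite /mt /mergetab [index_enum _]unlock enumT.
    move=> s4 hA hf4; have hx4 : rg s4 rX = i by rewrite (frame_rg hf4).
    rewrite /= hx4 hA; split.
    + by have := ltL (leq0n m) hi; rewrite mul0n.
    + by apply: ltM; have := mtB v t; qlia.
    move=> u' v'; rewrite /upd /= ltnS leq_eqVlt; case: eqP => [e _|ne /= h].
      have e' : u' * n + v' = v * n + t by rewrite e.
      by have [-> ->] := pair_inj e'.
    by rewrite (frame_ar _ hf4) // T3.
  - by move=> s2 _ hI _ u v; apply: hI; rewrite (c_nn (d_consts hd1)) pair_ltn.
move=> s2 hT hf2; have hd2 := data_frame hf2 erefl hd1.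
have hsp2 : rg s2 rSp = (size es).+1 by rewrite (frame_rg hf2).
have hs2 : stk s2 es by apply: stk_ext hs1 _ _ => *; rewrite (frame_ar _ hf2).
have G1 : ar s2 aG (size es).+1 = e1.2 by rewrite (frame_ar _ hf2).
have G2 : ar s2 aG (size es) = e2.2 by rewrite (frame_ar _ hf2).
apply: (@wp_seq _ _ _ _ _ _ _ (fun s' => stk s' es /\
   forall u v : 'I_n, ar s' aF (size es * (n * n) + (u * n + v)) = mt u v)).
  apply: (@wp_fill _ _ _ _ _ (n * n) (size es * (n * n)) (ar s2 aT)).
  - exact: c_nn (d_consts hd2).
  - by [].
  - move=> i s' hi hx hfr _; have hc := consts_frame hfr erefl (d_consts hd2).
    have [u [v [ei eu ev']]] := pairP hi.
    have hsp' : rg s' rSp = (size es).+1 by rewrite (frame_rg hfr).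
    split=> /=; rewrite ?hsp' ?(c_nn hc) ?hx ?subn1 //.
    + by rewrite (frame_ar _ hfr).
    + by apply: ltL => //; exact: ltnW.
    + by apply: ltM; rewrite ei hT; have := mtB u v; qlia.
  - move=> s' hfr hA; split.
      apply: stk_ext hs2 _ _ => [i hi|l _]; last by rewrite (frame_ar _ hfr).
      by rewrite hA ifF // leqNgt hi.
    by move=> u v; rewrite hA leq_addr ltn_add2l pair_ltn addKn hT.
move=> s3 [hs3 hF3] hf3; have hsp3 : rg s3 rSp = (size es).+1 by rewrite (frame_rg hf3).
rewrite /= hsp3 subn1 /= !(frame_ar _ hf3) // G1 G2; split.
- by move: L_index; qlia.
- by case: (e1.2); case: (e2.2); qlia.
split=> //; split=> //=.
- by rewrite /upd eqxx; case: (e1.2); case: (e2.2).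
- by apply: stk_ext hs3 _ _ => //= l hl; rewrite /upd ltn_eqF.
Qed.


Lemma p_select_ok s e es (l : 'I_n) r : data s -> stk s (e :: es) -> rg s rSp = size es ->
  rg s rLab = val l -> rg s rRk = r ->
  wp p_select (fun s' => rg s' rSel = sel pi l (e.1 l) r) s.
Proof.
move=> hd [f1 b1 g1 hs] hsp hl hr; pose g := e.1 l.
rewrite /p_select; apply: (@wp_set l) => //; first by have := ltn_ord l; qlia.
set s1 := setr _ _ _; have hd1 : data s1 by apply: data_setr.
have F1 (u : 'I_n) : ar s1 aF (size es * (n * n) + (l * n + u)) = g u by exact: f1.
have {}hsp : rg s1 rSp = size es by [].
have {}hl : rg s1 rLab = val l by [].
have {}hr : rg s1 rRk = r by [].
have hsel : rg s1 rSel = l by rewrite /s1 /= /upd.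
clearbody s1; clear f1 b1 g1 hs hd s.
apply: (@wp_for _ _ _ _ _ _ _ (fun i s' =>
  (exists t : 'I_n, [/\ t < i, rank pi g t = r & rg s' rSel = t]) \/
  ((forall t : 'I_n, t < i -> rank pi g t <> r) /\ rg s' rSel = l))).
- by rewrite (c_n (d_consts hd1)).
- by right.
- move=> i s2 hi hx _ hI hf2; rewrite (c_n (d_consts hd1)) in hi; pose t := Ordinal hi.
  have hd2 := data_frame hf2 erefl hd1; have hc2 := d_consts hd2.
  apply: (@wp_set 0) => //; first by qlia.
  set s3 := setr _ _ _; have hd3 : data s3 by apply: data_setr.
  have F3 (u : 'I_n) : ar s3 aF (size es * (n * n) + (l * n + u)) = g u.
    by rewrite /= (frame_ar _ hf2).
  have hsp3 : rg s3 rSp = size es by rewrite -hsp -(frame_rg hf2).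
  have hl3 : rg s3 rLab = val l by rewrite -hl -(frame_rg hf2).
  have hr3 : rg s3 rRk = r by rewrite -hr -(frame_rg hf2).
  have hx3 : rg s3 rT = i by [].
  have hsel3 : rg s3 rSel = rg s2 rSel by [].
  have hcnt3 : rg s3 rCnt = 0 by rewrite /s3 /= /upd.
  clearbody s3.
  apply: (@wp_seq _ _ _ _ _ _ _ (fun s' => rg s' rCnt = rank pi g t)).
    apply: (@wp_for _ _ _ _ _ _ _ (fun j s' =>
      rg s' rCnt = #|[set u : 'I_n | prec pi g u t && (u < j)]|)).
    + by rewrite (c_n (d_consts hd3)).
    + rewrite /= /upd /= hcnt3; apply/esym/eqP; rewrite cards_eq0; apply/eqP/setP => u.
      by rewrite !inE andbF.
    + move=> j s4 hj hu _ hC hf4; rewrite (c_n (d_consts hd3)) in hj; pose u := Ordinal hj.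
      have hd4 := data_frame hf4 erefl hd3; have hc4 := d_consts hd4.
      have F4 (v : 'I_n) : ar s4 aF (size es * (n * n) + (l * n + v)) = g v.
        by rewrite (frame_ar _ hf4) // F3.
      have hx4 : rg s4 rT = i by rewrite (frame_rg hf4).
      have hsp4 : rg s4 rSp = size es by rewrite (frame_rg hf4).
      have hl4 : rg s4 rLab = val l by rewrite (frame_rg hf4).
      rewrite /= hx4 hu hsp4 hl4 (c_n hc4) (c_nn hc4) (F4 u) (F4 t) (d_P hd4 u) (d_P hd4 t).
      rewrite -/(prec pi g u t).
      have hS : #|[set v : 'I_n | prec pi g v t && (v < j.+1)]| =
          prec pi g u t + #|[set v : 'I_n | prec pi g v t && (v < j)]|.
        case hp : (prec pi g u t); last first.
          apply: eq_card => v; rewrite !inE ltnS leq_eqVlt.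
          by case: (eqVneq (v : nat) j) => //= e'; rewrite (_ : v = u) ?hp //; apply: val_inj.
        have <- : #|u |: [set v : 'I_n | prec pi g v t && (v < j)]| =
            true + #|[set v : 'I_n | prec pi g v t && (v < j)]|.
          by rewrite cardsU1 !inE /= ltnn andbF.
        apply: eq_card => v; rewrite !inE ltnS leq_eqVlt -val_eqE /=.
        by case: (eqVneq (v : nat) j) => //= e'; rewrite (_ : v = u) ?hp //; apply: val_inj.
      have hcM : #|[set v : 'I_n | prec pi g v t && (v < j)]| + 1 < M.
        by have := max_card [set v : 'I_n | prec pi g v t && (v < j)]; rewrite card_ord; qlia.
      rewrite /upd /= hC hS; case: (prec pi g u t) => //=.
      by rewrite [true + _]addnC.
    + move=> s4 _ hC _; rewrite hC (c_n (d_consts hd3)) /rank.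
      by apply: eq_card => u; rewrite !inE ltn_ord andbT.
  move=> s4 hC hf4; have hx4 : rg s4 rT = i by rewrite (frame_rg hf4).
  have hr4 : rg s4 rRk = r by rewrite (frame_rg hf4).
  have hs4 : rg s4 rSel = rg s2 rSel by rewrite (frame_rg hf4).
  rewrite /= hC hr4 hx4 /upd /= hs4; case: (eqVneq (rank pi g t) r) => hrk /=.
    by split; [qlia|left; exists t].
  case: hI => [[t' [h1 h2 h3]]|[h1 h2]]; first by left; exists t'; split=> //; exact: ltnW.
  right; split=> // t'; rewrite ltnS leq_eqVlt => /orP[/eqP e'|]; last exact: h1.
  by rewrite (_ : t' = t); [exact/eqP|apply: val_inj].
- move=> s2 _ [[t [h1 h2 h3]]|[h1 h2]] _.
    by rewrite h3 -h2 sel_rank.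
  rewrite h2 /sel; case: pickP => //= t /eqP ht; case: (h1 t) => //.
  by rewrite (c_n (d_consts hd1)).
Qed.

Lemma p_cut_ok s e es (l : 'I_n) r (U : 'I_n -> bool) :
  data s -> stk s (e :: es) -> rg s rSp = (size es).+1 -> rg s rLab = val l -> rg s rRk = r ->
  size es <= m -> rg s rTot + BIG < M -> (forall t : 'I_n, ar s aU t = U t) ->
  wp p_cut (fun s' => let x := sel pi l (e.1 l) r in
    [/\ stk s' es, rg s' rSp = size es, rg s' rTot = rg s rTot + e.1 l x
      & forall t : 'I_n, ar s' aU t = U t || (e.2 && (t == x))]) s.
Proof.
move=> hd hst hsp hl hr hm hT hU; rewrite /p_cut.
apply: (@wp_set (size es)); [by rewrite /= hsp subn1|by qlia|].
set s1 := setr _ _ _; have hd1 : data s1 by apply: data_setr.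
have hst1 : stk s1 (e :: es) by apply: stk_ext hst _ _.
have hw : wp p_select (fun s' => rg s' rSel = sel pi l (e.1 l) r) s1.
  exact: (p_select_ok hd1 hst1).
apply: (wp_seq hw) => s2; set x := sel _ _ _ _ => hx hf2; have hd2 := data_frame hf2 erefl hd1.
have hc2 := d_consts hd2.
have [f2 b2 g2 hs2] : stk s2 (e :: es) by apply: stk_ext hst1 _ _ => *; rewrite (frame_ar _ hf2).
have hsp2 : rg s2 rSp = size es by rewrite (frame_rg hf2).
have hl2 : rg s2 rLab = l by rewrite (frame_rg hf2).
have hT2 : rg s2 rTot = rg s rTot by rewrite (frame_rg hf2).
have hU2 (t : 'I_n) : ar s2 aU t = U t by rewrite (frame_ar _ hf2) //; exact: hU.
apply: (@wp_set (rg s rTot + e.1 l x)).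
- by rewrite /= hT2 hsp2 hl2 hx (c_n hc2) (c_nn hc2) f2.
- by have := b2 l x; qlia.
rewrite /= /upd /= hsp2 g2; case he : e.2 => /=.
  rewrite hx; split; [by have := ltn_ord x; qlia|qlia|].
  split=> //; first by apply: stk_ext hs2 _ _.
  by move=> t; rewrite -val_eqE /=; case: (_ == _); rewrite ?orbT ?orbF.
split=> //; first by apply: stk_ext hs2 _ _.
by move=> t; rewrite orbF.
Qed.

Notation cs := (charges D BIG [::] code).
Notation xs := (picks D BIG pi kw).
Notation es j := (foldl (step D BIG) [::] (take j code)).

Lemma size_code : size code = m. Proof. by case: kwP => <- _; rewrite size_map. Qed.
Lemma size_cs : size cs = m. Proof. by rewrite size_charges size_code. Qed.
Lemma size_xs : size xs = m.
Proof. by rewrite size_map size_zip size_cs; case: kwP => -> _; rewrite minnn. Qed.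

Lemma nth_cs p j : j < m -> (forall d, nth d kw j = p) ->
  nth (nocharge n) cs j = charge_of (es j) p.1.
Proof.
move=> hj hp; have hjc : j < size code by rewrite size_code.
rewrite -{1}(cat_take_drop j code) charges_cat nth_cat size_charges.
rewrite (size_takel (ltnW hjc)) ltnn subnn (drop_nth p.1) //=.
by rewrite (nth_map p) ?hp //; case: kwP => ->.
Qed.

Lemma nth_xs p j d : j < m -> (forall d, nth d kw j = p) ->
  nth d xs j = sel pi p.1.2 (charge_of (es j) p.1).1 p.2.
Proof.
move=> hj hp; have sk : size kw = m by case: kwP.
rewrite (nth_map (nocharge n, p)); last by rewrite size_zip size_cs sk minnn.
by rewrite nth_zip ?size_cs ?sk //= (nth_cs hj hp) hp.
Qed.

Lemma es_step p j : j < m -> (forall d, nth d kw j = p) -> es j.+1 = step D BIG (es j) p.1.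
Proof.
move=> hj hp; have sk : size kw = m by case: kwP.
rewrite (take_nth p.1) ?size_code // -cats1 foldl_cat /=.
by rewrite (nth_map p) ?hp ?sk.
Qed.

Lemma charged_step p j : j < m -> (forall d, nth d kw j = p) ->
  let c := charge_of (es j) p.1 in let x := sel pi p.1.2 c.1 p.2 in
  charged (take j.+1 cs) (take j.+1 xs) = charged (take j cs) (take j xs) + c.1 x /\
  served (take j.+1 cs) (take j.+1 xs) =
    served (take j cs) (take j xs) ++ (if c.2 then [:: x] else [::]).
Proof.
move=> hj hp c x.
rewrite (take_nth (nocharge n)) ?size_cs // (take_nth x) ?size_xs // -!cats1.
have st : size (take j cs) = size (take j xs).
  by rewrite !size_takel ?size_cs ?size_xs // ltnW.
rewrite charged_cat ?served_cat //.
rewrite (nth_cs hj hp) (nth_xs x hj hp) -/c -/x {2}/charged {2}/served /= big_seq1.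
by split=> //; case: c.2.
Qed.

(** The bound by [j * BIG] keeps the total within a word, and the label of the last instruction is
    recorded because [p_finish] evaluates the final entry there. *)
Definition progress j s :=
  [/\ stk s (es j) /\ rg s rSp = size (es j), size (es j) <= j,
      rg s rTot = charged (take j cs) (take j xs) /\ rg s rTot <= j * BIG,
      forall t : 'I_n, ar s aU t = (t \in served (take j cs) (take j xs))
    & forall d, 0 < j -> rg s rLab = val (nth d kw j.-1).1.2].

Lemma stepE st i : step D BIG st i =
  if i.1 < 2 then (fun v _ => D v i.2, false) :: (if i.1 == 1 then behead st else st)
  else if i.1 == 2 then (D, true) :: st
  else if st is e1 :: e2 :: st' then (mergetab D BIG e1.1 e2.1, e1.2 || e2.2) :: st'
  else st.
Proof. by []. Qed.

Lemma p_instr_ok j s : data s -> j < m -> rg s rJ = j -> progress j s ->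
  wp p_instr (progress j.+1) s.
Proof.
move=> hd hj hx [[hst hsp] hsz [hT hTB] hU _].
have [p [hp [d1 d2 d3] hl]] := lab_read (d_consts hd) (d_C hd hj) hj.
have eE := es_step hj hp; have [cE sE] := charged_step hj hp.
have jB : j.+1 * BIG <= m * BIG by rewrite leq_mul2r hj orbT.
have jB' : j.+1 * BIG + 5 * BIG < M.
  apply: leq_ltn_trans M_big; rewrite -addnA !mulnDl; qlia.
have lM : val p.1.2 < M by have := ltn_ord p.1.2 => /=; qlia.
rewrite /p_instr; apply: (@wp_set p.1.1).
- by rewrite /= hx (d_C hd hj) d1.
- by rewrite d1; apply: ltn_trans (ltn_pmod _ (isT : 0 < 4)) _; qlia.
apply: (@wp_set p.1.2) => //; first by rewrite /= /upd /= hx (d_C hd hj) (c_k (d_consts hd)) hl.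
apply: (@wp_set p.2).
- by rewrite /= /upd /= hx (d_C hd hj) (c_k (d_consts hd)) d3.
- rewrite d3; apply: leq_ltn_trans (leq_div _ _) _; apply: leq_ltn_trans (leq_div _ _) _.
  apply: leq_ltn_trans (leq_mod _ _) _; apply: leq_ltn_trans (leq_div _ _) _.
  by clear -wLIM M_lim; lia.
set s1 := setr _ _ _.
have hd1 : data s1 by do 3 ! (apply: data_setr => //).
have hst1 : stk s1 (es j) by apply: stk_ext hst _ _.
have hsp1 : rg s1 rSp = size (es j) by [].
have hT1 : rg s1 rTot = charged (take j cs) (take j xs) by [].
have hU1 (t : 'I_n) : ar s1 aU t = (t \in served (take j cs) (take j xs)) by exact: hU.
have hop1 : rg s1 rOp = p.1.1 by rewrite /s1 /= /upd.
have hlab1 : rg s1 rLab = val p.1.2 by rewrite /s1 /= /upd.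
have hrk1 : rg s1 rRk = p.2 by rewrite /s1 /= /upd.
rewrite hT in hTB; clearbody s1; clear hd hst hsp hT hU hx d1 d2 d3 hl.
have labE d s' : rg s' rLab = val p.1.2 -> 0 < j.+1 -> rg s' rLab = val (nth d kw j.+1.-1).1.2.
  by move=> -> _; rewrite /= hp.
rewrite stepE in eE; move: cE sE; rewrite /charge_of; set x := sel _ _ _ _ => cE sE.
apply: wp_if; rewrite [ev _ _]/= hop1.
  case: (ltnP p.1.1 2) => // ho _; rewrite ho in eE.
  pose es' := if p.1.1 == 1 then behead (es j) else es j.
  apply: (@wp_seq _ _ _ _ _ _ _ (fun s' =>
    [/\ stk s' es' /\ rg s' rSp = size es',
      rg s' rTot = charged (take j.+1 cs) (take j.+1 xs) /\ rg s' rTot <= j.+1 * BIG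
    & forall t : 'I_n, ar s' aU t = (t \in served (take j.+1 cs) (take j.+1 xs))])).
    rewrite cE sE /x /es'; apply: wp_if; rewrite [ev _ _]/= hop1 hsp1.
      move=> hz; have [o1 hs0] : p.1.1 = 1 /\ 0 < size (es j).
        by move: hz; case: (eqVneq p.1.1 1) => // ->; case: (0 < size _).
      rewrite o1 eqxx; case eE' : (es j) hs0 => [|e es0] // _.
      rewrite eE' in hst1 hsp1 hsz.
      have hm : size es0 <= m by apply: leq_trans (ltnW hsz) (ltnW hj).
      have hTM : rg s1 rTot + BIG < M by rewrite hT1; move: jB'; rewrite mulSn; qlia.
      have hb : e.1 p.1.2 (sel pi p.1.2 (e.1 p.1.2) p.2) <= BIG by case: hst1.
      apply: wp_conseq (p_cut_ok hd1 hst1 hsp1 hlab1 hrk1 hm hTM hU1) _.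
      move=> s2 [h1 h2 h3 h4] _; split=> //=.
        by rewrite h3 hT1; split=> //; rewrite mulSn; qlia.
      by move=> t; rewrite h4 mem_cat; case: (e.2); rewrite ?inE ?in_nil.
    (* Nothing is cut here: the opcode is 0 or the stack is empty, and in both cases the charge is
       zero and the stack stays. *)
    move=> hz; have [-> ->] : (if p.1.1 == 1 then match es j with [::] => (fun=> 0, false)
        | e :: _ => (e.1 p.1.2, e.2) end else (fun=> 0, false)) = nocharge n /\
        (if p.1.1 == 1 then behead (es j) else es j) = es j.
      by move: hz; case: (eqVneq p.1.1 1) => // _; case: (es j).
    rewrite /= addn0 cats0; split=> //.
    by rewrite hT1; split=> //; apply: leq_trans hTB _; rewrite leq_mul2r leqnSn orbT.
  move=> s2 [[h1 h2] [h3 h3'] h4] hf2; have hd2 := data_frame hf2 erefl hd1.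
  have se : size es' <= j by rewrite /es'; case: ifP; rewrite // size_behead; qlia.
  have hl2 : rg s2 rLab = val p.1.2 by rewrite (frame_rg hf2).
  apply: wp_conseq (p_leaf_ok hd2 h1 h2 (leq_trans se (ltnW hj)) hl2) _.
  move=> s3 [g1 g2] hf3; split; rewrite ?eE //.
  - by rewrite (frame_rg hf3).
  - by move=> t; rewrite (frame_ar _ hf3).
  - by move=> d; apply: labE; rewrite (frame_rg hf3).
case: (ltnP p.1.1 2) => // ho _; rewrite (leq_gtF ho) in eE.
have o1 : (p.1.1 == 1) = false by apply/eqP; qlia.
rewrite o1 /= addn0 cats0 in cE sE eE.
have hTB' : charged (take j cs) (take j xs) <= j.+1 * BIG.
  by apply: leq_trans hTB _; rewrite leq_mul2r leqnSn orbT.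
have fin s2 st : stk s2 st -> rg s2 rSp = size st -> size st <= j.+1 ->
    es j.+1 = st -> rg s2 rTot = rg s1 rTot ->
    (forall t : 'I_n, ar s2 aU t = ar s1 aU t) -> rg s2 rLab = rg s1 rLab -> progress j.+1 s2.
  move=> q1 q2 q3 q4 q5 q6 q7; split; rewrite ?q4 ?q5 ?hT1 ?cE ?sE //.
    by move=> t; rewrite q6.
  by move=> d; apply: labE; rewrite q7.
apply: wp_if; rewrite [ev _ _]/= hop1.
  case: (eqVneq p.1.1 2) => // o2 _; rewrite o2 /= in eE.
  apply: wp_conseq (p_slot_ok hd1 hst1 hsp1 (leq_trans hsz (ltnW hj))) _.
  move=> s2 [h1 h2] hf2; apply: fin h1 h2 _ eE _ _ _; rewrite ?(frame_rg hf2) //.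
  by move=> t; rewrite (frame_ar _ hf2).
case: (eqVneq p.1.1 2) => // /negbTE o2 _; rewrite o2 in eE.
apply: wp_if; rewrite [ev _ _]/= hsp1; case eE' : (es j) eE => [|e1 [|e2 st]] // eE _.
- rewrite eE' in hst1 hsp1 hsz.
  have hm : (size st).+1 <= m by apply: leq_trans (ltnW hsz) (ltnW hj).
  apply: wp_conseq (p_merge_ok hd1 hst1 hsp1 hm) _.
  move=> s2 [h1 h2] hf2; apply: fin h1 h2 _ eE _ _ _; rewrite ?(frame_rg hf2) //.
    by apply: leq_trans (ltnW hsz) (leqnSn _).
  by move=> t; rewrite (frame_ar _ hf2).
- by apply: (fin _ [::]); rewrite ?eE' in hst1 hsp1 *.
- by rewrite eE' in hst1 hsp1; apply: (fin _ [:: e1]).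
Qed.

Definition final_label (x : 'I_n) := last x [seq p.1.2 | p <- kw].

Lemma p_finish_ok s : data s -> progress m s -> rg s rBest <= BIG ->
  wp p_finish (fun s' => [/\ rg s' rBest <= rg s rBest,
    forall e x, foldl (step D BIG) [::] code = [:: e] -> final_label x = x ->
      rg s' rBest <= value D BIG K code xs e x
  & rg s' rBest = rg s rBest \/ exists e x, foldl (step D BIG) [::] code = [:: e] /\
      rg s' rBest = value D BIG K code xs e x]) s.
Proof.
move=> hd [[hst hsp] hsz [hT hTB] hU hlab] hb; have hc := d_consts hd.
have tc : take m code = code by rewrite take_oversize ?size_code.
have tcs : take m cs = cs by rewrite take_oversize ?size_cs.
have txs : take m xs = xs by rewrite take_oversize ?size_xs.
rewrite tc in hst hsp hsz; rewrite tcs txs in hT hU.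
apply: wp_if; rewrite [ev _ _]/= hsp; last first.
  by case E : (foldl _ _ _) => [|e [|? ?]] // _; split=> //; left.
case E : (foldl _ _ _) => [|e [|? ?]] // _.
have m0 : 0 < m by move: hsz; rewrite E.
rewrite E in hst hsp; case: hst => f1 b1 _ _; rewrite /= mul0n in f1.
have [x hx] : exists x : 'I_n, forall d, x = (nth d kw m.-1).1.2.
  case Ek' : kw => [|d kw']; first by case: kwP m0 => <-; rewrite Ek'.
  exists (nth d kw m.-1).1.2 => d'; rewrite -Ek'; congr (_ .1.2).
  by apply: set_nth_default; case: kwP => ->; rewrite prednK.
have hl : rg s rLab = x.
  case Ek' : kw hx => [|d kw']; first by case: kwP m0 => <-; rewrite Ek'.
  by rewrite -Ek' => hx; rewrite (hlab d m0) (hx d).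
have hfx y : final_label y = x.
  rewrite /final_label (last_nth y) size_map; case: kwP => sk _; rewrite sk.
  case: (m) m0 sk hx => // m' _ sk hx.
  case Ek' : kw sk hx => [|d kw'] // sk hx.
  by rewrite -[LHS]/(nth y [seq p.1.2 | p <- d :: kw'] m') (nth_map d) ?sk // (hx d).
have BB : (m + n + 1) * BIG < M.
  by apply: leq_ltn_trans M_big; rewrite leq_mul2r; apply/orP; right; lia.
have hTe : rg s rTot + e.1 x x <= (m + 1) * BIG.
  by have := b1 x x; rewrite mulnDl mul1n; move: hTB; qlia.
apply: (@wp_set (rg s rTot + e.1 x x)); first by rewrite /= hl (c_n hc) f1.
  apply: leq_ltn_trans hTe (leq_ltn_trans _ BB); rewrite leq_mul2r; apply/orP; right; lia.
set s1 := setr _ _ _; have hd1 : data s1 by apply: data_setr.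
have hU1 (t : 'I_n) : ar s1 aU t = (t \in served cs xs) by exact: hU.
have hT1 : rg s1 rTot = rg s rTot + e.1 x x by rewrite /s1 /= /upd.
have hb1 : rg s1 rBest = rg s rBest by [].
clearbody s1.
have piB t : pi t <= BIG by rewrite /profit; case: ifP => // _; exact: bigmin_le_init.
pose part i := \sum_(t <- take i (enum 'I_n) | t \notin served cs xs) pi t.
apply: (@wp_seq _ _ _ _ _ _ _ (fun s' => rg s' rTot = rg s1 rTot + part n)).
  apply: (@wp_for _ _ _ _ _ _ _ (fun i s' => rg s' rTot = rg s1 rTot + part i /\ part i <= i * BIG)).
  - by rewrite (c_n (d_consts hd1)).
  - by rewrite /part take0 big_nil addn0.
  - move=> i s2 hi hx2 _ [hT2 hp2] hf2; rewrite (c_n (d_consts hd1)) in hi; pose t := Ordinal hi.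
    have hd2 := data_frame hf2 erefl hd1.
    have hU2 : ar s2 aU i = (t \in served cs xs) by rewrite (frame_ar _ hf2) // -hU1.
    have hP2 : ar s2 aP i = pi t by rewrite -(d_P hd2).
    have pS : part i.+1 = part i + (if t \notin served cs xs then pi t else 0).
      rewrite /part (take_nth t) ?size_enum_ord // -cats1 big_cat /= big_cons big_nil.
      have -> : nth t (enum 'I_n) i = t by apply: val_inj; rewrite /= nth_enum_ord.
      by case: ifP; rewrite ?addn0.
    have hT2M : rg s2 rTot + pi t < M.
      apply: leq_ltn_trans BB; rewrite hT2 hT1.
      have : i.+1 * BIG <= n * BIG by rewrite leq_mul2r hi orbT.
      have := piB t; rewrite mulSn; move: hTe hp2; rewrite !mulnDl !mul1n; clear; lia.
    have hpS : part i.+1 <= i.+1 * BIG.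
      by rewrite pS mulSn; have := piB t; case: ifP => _; move: hp2; clear; lia.
    rewrite /= hx2 hU2 hP2; move: pS hpS; case: (t \in served cs xs) => /= pS hpS.
      by rewrite /upd /= hT2 pS addn0 in hpS *.
    by split=> //; rewrite /upd /= hT2 pS addnA -pS.
  - by move=> s2 _ [h _] _; rewrite h (c_n (d_consts hd1)).
move=> s2 hT2 hf2; have hb2 : rg s2 rBest = rg s rBest by rewrite (frame_rg hf2).
have vE : rg s2 rTot = value D BIG K code xs e x.
  rewrite hT2 hT1 hT /value; congr (_ + _).
  by rewrite /part take_oversize ?size_enum_ord // [index_enum _]unlock enumT.
have hvM : rg s2 rBest < M by rewrite hb2; apply: ltM; move: hb; clear; lia.
rewrite /= hb2 vE; case: ltnP => /= h; last first.
  split=> //; last by left.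
  by move=> e' x' [<-] <-; rewrite hfx.
rewrite /upd /=; split.
- by apply: ltn_trans hvM; rewrite hb2.
- split.
  + exact: ltnW.
  + by move=> e' x' [<-] <-; rewrite hfx.
  + by right; exists e, x.
Qed.

Lemma p_guess_ok s : consts s -> mat s aD D -> rg s rW = w -> rg s rBest <= BIG ->
  wp p_guess (fun s' => [/\ rg s' rBest <= rg s rBest,
    forall e x, foldl (step D BIG) [::] code = [:: e] -> final_label x = x ->
      rg s' rBest <= value D BIG K code xs e x
  & rg s' rBest = rg s rBest \/ exists e x, foldl (step D BIG) [::] code = [:: e] /\
      rg s' rBest = value D BIG K code xs e x]) s.
Proof.
move=> hc hD hw hb; rewrite /p_guess.
apply: (wp_seq (p_labels_ok hc hD hw)) => s1 [hC hP hU] hf1.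
have hc1 := consts_frame hf1 erefl hc.
have hd1 : data s1 by split=> // u v; rewrite (frame_ar _ hf1).
have hb1 : rg s1 rBest = rg s rBest by rewrite (frame_rg hf1).
rewrite -hb1 in hb *.
apply: (@wp_set 0) => //; first by qlia.
apply: (@wp_set 0) => //; first by qlia.
set s2 := setr _ _ _; have hd2 : data s2 by do 2 ! (apply: data_setr => //).
have p0 : progress 0 s2.
  split; rewrite ?take0 //.
    by rewrite /charged big_nil.
have hb2 : rg s2 rBest = rg s1 rBest by [].
rewrite -hb2 in hb *; clearbody s2.
apply: (@wp_seq _ _ _ _ _ _ _ (progress m)).
  apply: (@wp_for _ _ _ _ _ _ _ progress).
  - by rewrite (c_m (d_consts hd2)).
  - case: p0 => [[h1 h2] h3 h4 h5 h6]; split=> //; split=> //.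
    exact: stk_ext h1 _ _.
  - move=> j s3 hj hx _ hI hf3; rewrite (c_m (d_consts hd2)) in hj.
    have hd3 := data_frame hf3 erefl hd2.
    apply: wp_conseq (p_instr_ok hd3 hj hx hI) _ => s4 [[h1 h2] h3 h4 h5 h6] _.
    split=> //; split=> //; exact: stk_ext h1 _ _.
  - by move=> s3 _; rewrite (c_m (d_consts hd2)).
move=> s3 hp3 hf3; have hd3 := data_frame hf3 erefl hd2.
have hb3 : rg s3 rBest = rg s2 rBest by rewrite (frame_rg hf3).
by rewrite -hb3 in hb *; exact: p_finish_ok.
Qed.

End Guess.

(** As long as trees weigh less than [BIG], this pins [b] down: it is the optimum, or [BIG] if there
    is no tree. *)
Definition value_spec E b := [/\ forall V F, steiner_tree E K V F -> b <= weight cost F,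
  b < BIG -> exists V F, steiner_tree E K V F /\ weight cost F <= b & b <= BIG].

Lemma p_value_ok E s : consts s -> mat s aW (cmat E cost BIG) -> multiway_cut E K S ->
  (forall e, e \in E -> cost e < BIG) ->
  wp p_value (fun s' => value_spec E (rg s' rBest)) s.
Proof.
move=> hc hW cut hE; have WB u v : cmat E cost BIG u v <= BIG.
  by rewrite /cmat; case: ifP => // /hE/ltnW.
apply: (wp_seq (p_dist_ok hc hW WB)) => s1 [D [hD [d1 d2 d3 d4 d5]]] hf1.
have hc1 := consts_frame hf1 erefl hc.
pose b0 := BIG * (1 - (0 < n) * (#|K| < 2)).
have b0B : b0 <= BIG by rewrite /b0 -[leqRHS]muln1 leq_mul2l leq_subr orbT.
apply: (@wp_set b0).
- by rewrite /= (c_big hc1) (c_n hc1) (c_kc hc1).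
- by apply: ltM; move: b0B; clear; lia.
set s2 := setr _ _ _; have hc2 : consts s2 by apply: consts_setr.
have hD2 : mat s2 aD D by exact: hD.
have hb2 : rg s2 rBest = b0 by rewrite /s2 /= /upd.
clearbody s2.
pose val kw e x := value D BIG K (unzip1 kw) (picks D BIG (profit D BIG K (unzip1 kw)) kw) e x.
apply: (@wp_for _ _ _ _ _ _ _ (fun w s' => [/\ rg s' rBest <= b0,
  forall w' kw e x, w' < w -> decoded w' kw -> foldl (step D BIG) [::] (unzip1 kw) = [:: e] ->
    final_label kw x = x -> rg s' rBest <= val kw e x
  & rg s' rBest = b0 \/ exists w' kw e x, [/\ decoded w' kw,
      foldl (step D BIG) [::] (unzip1 kw) = [:: e] & rg s' rBest = val kw e x]])).
- by rewrite (c_lim hc2).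
- have -> : rg (setr s2 rW 0) rBest = b0 by rewrite /= /upd /= hb2.
  by split; [exact: leqnn|move=> ? ? ? ?; rewrite ltn0|left].
- move=> w s3 hw hx _ [h1 h2 h3] hf3; rewrite (c_lim hc2) in hw.
  have hc3 := consts_frame hf3 erefl hc2.
  have hD3 : mat s3 aD D by move=> u v; rewrite (frame_ar _ hf3).
  have [kw kwP] := decodable w.
  apply: wp_conseq (p_guess_ok d5 hw kwP hc3 hD3 hx (leq_trans h1 b0B)) _.
  move=> s4 [g1 g2 g3] _.
  have -> : rg (setr s4 rW w.+1) rBest = rg s4 rBest by rewrite /= /upd.
  split.
  + exact: leq_trans g1 h1.
  + move=> w' kw' e x; rewrite ltnS leq_eqVlt => /orP[/eqP ew|hw'] hd he hl; last first.
      by apply: leq_trans g1 _; apply: h2 hd he hl.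
    (* A word has only one decoding. *)
    have ekw : kw' = kw.
      rewrite {}ew in hd; case: hd => sd hd; case: kwP => sk hk.
      case Ek' : kw sk => [|d kw0] sk; first by apply/eqP; rewrite -size_eq0 sd -sk.
      rewrite -Ek'; apply: (@eq_from_nth _ d); first by rewrite sd Ek' sk.
      move=> j; rewrite sd => hj; have [a1 a2 a3] := hd j d hj; have [c1 c2 c3] := hk j d hj.
      move: a1 a2 a3 c1 c2 c3; case: (nth d kw' j) => [[o l] r]; case: (nth d kw j) => [[o' l'] r'] /=.
      by move=> -> h -> -> h' ->; congr (_, _, _); apply: val_inj; rewrite /= h h'.
    by rewrite ekw in he hl *; apply: g2.
  + case: g3 => [->|[e [x [he hv]]]]; last by right; exists w, kw, e, x.
    exact: h3.
- move=> s3 _ [h1 h2 h3] _; rewrite (c_lim hc2) in h2; split; last exact: leq_trans h1 b0B.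
  + move=> V F VF; case: (ltnP 1 #|K|) => hK; last first.
      suff -> : rg s3 rBest = 0 by [].
      apply/eqP; rewrite -leqn0; apply: leq_trans h1 _; rewrite /b0.
      have n0 : 0 < n.
        by case: VF => _ [/set0Pn[v _] _ _] _; case: (n) v => [[]|].
      by rewrite ltnS hK n0 subnn muln0.
    have DE u v : adj E u v -> D u v <= cost [set u; v].
      by move=> uv; apply: leq_trans (d4 u v) _; rewrite /cmat uv.
    have [kw [e [x [[sk lk] ak rk hv]]]] := complete BIG cut d2 d3 DE VF hK.
    have sm : size kw = m by rewrite sk Em Ek.
    have [w hw hd] := encodable sm ltac:(by rewrite Em Ek).
    by apply: leq_trans hv; apply: h2 hd rk lk.
  + case: h3 => [->|[w [kw [e [x [[sk _] he ->]]]]]] hb.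
      have [n0 hK] : 0 < n /\ #|K| < 2.
        by move: hb; rewrite /b0; case: (0 < n); case: (#|K| < 2); rewrite ?muln1 ?ltnn.
      have [x Kx] : exists x, K \subset [set x].
        case: (set_0Vmem K) => [->|[x xK]]; first by exists (Ordinal n0); rewrite sub0set.
        by exists x; apply/subsetP => y yK; rewrite inE; apply/eqP; apply: (card_le1_eqP hK).
      have [V [F [VF hF]]] :=
        cheap_steiner (@cheap1 n E cost BIG x) BIG0 (set11 x) Kx.
      by exists V, F; split=> //; apply: leq_trans hF _.
    have sp : size (picks D BIG (profit D BIG K (unzip1 kw)) kw) = size (unzip1 kw).
      by rewrite !size_map size_zip size_charges size_map minnn.
    have := cheap_value (K := K) (x := x) d1 sp he; move/cheap_steiner; apply=> //.
    - exact: setU11.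
    - exact: subsetUr.
Qed.

Lemma steiner_sub (E E' : {set {set 'I_n}}) V F :
  E' \subset E -> steiner_tree E' K V F -> steiner_tree E K V F.
Proof. by move=> EE [[FE FV] t KV]; split=> //; split=> //; exact: subset_trans EE. Qed.

Lemma cut_sub (E E' : {set {set 'I_n}}) :
  E' \subset E -> multiway_cut E K S -> multiway_cut E' K S.
Proof.
move=> EE cut u uS; apply: leq_trans (cut u uS); apply: subset_leq_card; apply: setSI.
apply/subsetP => v; rewrite !inE; apply: connect_sub => x y /and3P[xS yS xy].
by apply: connect1; rewrite /adj_minus xS yS (adj_sub EE xy).
Qed.

Lemma set2_eq (a b u v : 'I_n) :
  ([set a; b] == [set u; v]) = ((a == u) && (b == v)) || ((a == v) && (b == u)).
Proof.
apply/eqP/idP => [h|/orP[]/andP[/eqP -> /eqP ->] //]; last by rewrite setUC.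
have ha : a \in [set u; v] by rewrite -h !inE eqxx.
have hb : b \in [set u; v] by rewrite -h !inE eqxx orbT.
have hu : u \in [set a; b] by rewrite h !inE eqxx.
have hv : v \in [set a; b] by rewrite h !inE eqxx orbT.
move: ha hb hu hv; rewrite !inE ![u == _]eq_sym ![v == _]eq_sym.
by do 4 ! case: (_ == _).
Qed.

(** * Extracting an optimal tree by deleting edges *)

Section Pruning.

Variable E : {set {set 'I_n}}.
Hypothesis cutE : multiway_cut E K S.
Hypothesis costE : forall e, e \in E -> cost e < BIG.
Variable opt : nat.
Hypothesis opt_big : opt < BIG.

Definition needed (E' : {set {set 'I_n}}) (u v : 'I_n) :=
  forall V F, steiner_tree (E' :\ [set u; v]) K V F -> opt < weight cost F.

Definition pruned i (E' : {set {set 'I_n}}) := [/\ E' \subset E,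
  exists V F, steiner_tree E' K V F /\ weight cost F <= opt
  & forall u v : 'I_n, u * n + v < i -> adj E' u v -> needed E' u v].

(** A needed edge remains needed when further edges are deleted, so a single pass over all pairs is
    enough. Deletions preserve the multiway cut, hence [p_value] stays applicable. *)
Lemma p_prune_ok s : consts s -> mat s aW (cmat E cost BIG) -> rg s rOpt = opt ->
  (exists V F, steiner_tree E K V F /\ weight cost F <= opt) ->
  wp p_prune (fun s' => exists E', mat s' aW (cmat E' cost BIG) /\ pruned (n * n) E') s.
Proof.
move=> hc hW ho hex; rewrite /p_prune.
apply: (@wp_for _ _ _ _ _ _ _ (fun i s' => exists E', mat s' aW (cmat E' cost BIG) /\ pruned i E')).
- by rewrite (c_nn hc).
- by exists E; split.
- move=> i s1 hi hx _ [E1 [hW1 [E1E ex1 nd1]]] hf1; rewrite (c_nn hc) in hi.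
  have hc1 := consts_frame hf1 erefl hc.
  have ho1 : rg s1 rOpt = opt by rewrite (frame_rg hf1).
  have [u [v [ei eu ev']]] := pairP hi.
  have hij : v * n + u < n * n by exact: pair_ltn.
  have LL j : j < n * n -> j < lmax by move: L_index; rewrite mulSn; clear; lia.
  have CB : cmat E1 cost BIG u v < M.
    by apply: ltM; rewrite /cmat; case: ifP => [/(subsetP E1E)/costE|]; clear; lia.
  apply: (@wp_set (cmat E1 cost BIG u v)); [by rewrite /= hx ei hW1|by []|].
  apply: (@wp_set (v * n + u)).
  - by rewrite /= /upd /= hx (c_n hc1) eu ev'.
  - by move: hij M_index; clear; lia.
  apply: (@wp_sto i BIG); [by rewrite /= /upd /= hx|by rewrite /= /upd /= (c_big hc1)|exact: LL|by apply: ltM; clear; lia|].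
  apply: (@wp_sto (v * n + u) BIG); [by []|by rewrite /= /upd /= (c_big hc1)|exact: LL|by apply: ltM; clear; lia|].
  set s2 := seta _ _ _ _.
  have hc2 : consts s2 by do 2 ! (apply: consts_seta => //); do 2 ! (apply: consts_setr => //).
  pose E2 := E1 :\ [set u; v].
  have cm2 a b : cmat E2 cost BIG a b =
      if ((a == v) && (b == u)) || ((a == u) && (b == v)) then BIG else cmat E1 cost BIG a b.
    rewrite /cmat /adj /E2 in_setD1 set2_eq orbC.
    by case: (_ || _).
  have pe (a b c d : 'I_n) : (a * n + b == c * n + d) = (a == c) && (b == d).
    by apply/eqP/andP => [/pair_inj[-> ->]|[/eqP -> /eqP ->]].
  have hW2 : mat s2 aW (cmat E2 cost BIG).
    move=> a b; rewrite /s2 /= /upd ei !pe cm2 hW1.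
    by case: (_ && _) => //=.
  have hx2 : rg s2 rXd = i by rewrite /s2 /= /upd.
  have hxt2 : rg s2 rXt = v * n + u by rewrite /s2 /= /upd.
  have hsv2 : rg s2 rSave = cmat E1 cost BIG u v by rewrite /s2 /= /upd.
  have ho2 : rg s2 rOpt = opt by rewrite /s2 /= /upd.
  clearbody s2.
  have E21 : E2 \subset E1 by exact: subsetDl.
  have E2E := subset_trans E21 E1E.
  apply: (wp_seq (p_value_ok hc2 hW2 (cut_sub E2E cutE) _)).
    by move=> e /(subsetP E2E)/costE.
  move=> s3 [b1 b2 b3] hf3.
  have hx3 : rg s3 rXd = i by rewrite (frame_rg hf3).
  have hxt3 : rg s3 rXt = v * n + u by rewrite (frame_rg hf3).
  have hsv3 : rg s3 rSave = cmat E1 cost BIG u v by rewrite (frame_rg hf3).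
  have ho3 : rg s3 rOpt = opt by rewrite (frame_rg hf3).
  have hW3 : mat s3 aW (cmat E2 cost BIG) by move=> a b; rewrite (frame_ar _ hf3).
  apply: wp_if; rewrite [ev _ _]/= ho3; case: (ltnP opt (rg s3 rBest)) => // hlt _.
    rewrite /= hx3 hxt3 hsv3; split; [exact: LL|by []|split; [exact: LL|by []|]].
    exists E1; split.
      move=> a b; rewrite /= /upd ei !pe hW3 cm2 /=.
      case: (boolP ((a == v) && (b == u))) => [/andP[/eqP -> /eqP ->]|_]; first exact: cmatC.
      by case: (boolP ((a == u) && (b == v))) => [/andP[/eqP -> /eqP ->]|_].
    split=> // a b; rewrite ltnS leq_eqVlt => /orP[|/nd1]; last by [].
    rewrite ei pe => /andP[/eqP -> /eqP ->] _ V F /b1; exact: leq_trans.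
  exists E2; split; first exact: hW3.
  split=> //.
    have [V [F [VF hF]]] := b2 (leq_ltn_trans hlt opt_big).
    by exists V, F; split=> //; exact: leq_trans hlt.
  move=> a b; rewrite ltnS leq_eqVlt => /orP[hab|hab] ab.
    move: hab ab; rewrite ei pe => /andP[/eqP -> /eqP ->].
    by rewrite /adj !inE eqxx.
  move=> V F VF; apply: (nd1 a b hab (adj_sub E21 ab)); apply: steiner_sub VF.
  exact: setSD.
- by move=> s1 _; rewrite (c_nn hc).
Qed.


Hypothesis graphE : is_graph E.
Hypothesis opt_min : forall V F, steiner_tree E K V F -> opt <= weight cost F.

(** In a tree with at least two vertices every vertex has an edge, so the vertex set can be read off
    the edges; the other clauses cover trees with a single vertex. *)
Definition out_verts (E' : {set {set 'I_n}}) : {set 'I_n} :=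
  [set t : 'I_n | [|| t \in K, (#|K| == 0) && (t == 0 :> nat) | [exists u, adj E' t u]]].

Lemma steiner_single (E' : {set {set 'I_n}}) x : K \subset [set x] -> steiner_tree E' K [set x] set0.
Proof.
move=> Kx; split=> //; first by split; [exact: sub0set|move=> e; rewrite inE].
split.
- by apply/set0Pn; exists x; rewrite inE.
- by move=> u v; rewrite !inE => /eqP -> /eqP ->.
- by move=> [|a [|b p]] // _ /andP[/= /andP[]]; rewrite /adj inE.
Qed.

(** An optimal tree of the remaining graph uses every remaining edge, since without a needed edge
    all trees are heavier than [opt]. *)
Lemma pruned_min E' : pruned (n * n) E' -> min_steiner_tree E cost K (out_verts E') E'.
Proof.
case=> E'E [V [F [VF hF]]] nd.
have need e : e \in E' -> forall V' F', steiner_tree (E' :\ e) K V' F' -> opt < weight cost F'.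
  move=> eE'; have /eqP/cards2P[u [v [_ ee]]] := graphE (subsetP E'E _ eE').
  by rewrite ee; apply: nd; rewrite ?pair_ltn // /adj -ee.
have FE' : F = E'.
  case: (VF) => [[FE FV] tV KV]; apply/eqP; rewrite eqEsubset FE /=.
  apply/subsetP => e eE'; apply: contraT => eF.
  have : steiner_tree (E' :\ e) K V F.
    split=> //; split=> //; apply/subsetP => f fF; rewrite !inE (subsetP FE) // andbT.
    by apply: contraNneq eF => <-.
  by move/(need e eE'); rewrite ltnNge hF.
suff VE : steiner_tree E' K (out_verts E') E'.
  split; first exact: steiner_sub VE.
  by move=> V' F' /opt_min; apply: leq_trans; rewrite -FE'.
rewrite {}FE' {F} in VF hF; case: (ltnP 1 #|K|) => hK.
  suff -> : out_verts E' = V by [].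
  case: VF => [[FE FV] [V0 Vc _] KV].
  apply/setP => t; rewrite inE (gtn_eqF (ltnW hK)) /=; apply/orP/idP.
    case=> [/(subsetP KV)//|/existsP[u tu]].
    by apply: (subsetP (FV _ tu)); rewrite !inE eqxx.
  move=> tV; right; have /card_gt1P[a [b [aK bK ab]]] := hK.
  have [z zV zt] : exists2 z, z \in V & z != t.
    case: (eqVneq a t) => [at_|]; last by exists a; rewrite ?(subsetP KV).
    by exists b; rewrite ?(subsetP KV) // -at_ eq_sym.
  have /connectP[[|y p] /= pth e] := Vc t z tV zV; first by rewrite e eqxx in zt.
  by apply/existsP; exists y; case/andP: pth.
have [x Kx] : exists x, K \subset [set x].
  case: (set_0Vmem K) => [->|[x xK]].
    case: VF => _ [/set0Pn[v _] _ _] _.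
    by exists v; rewrite sub0set.
  by exists x; apply/subsetP => y yK; rewrite inE; apply/eqP; apply: (card_le1_eqP hK).
have E0 : E' = set0.
  apply/setP => e; rewrite inE; apply/negP => eE'.
  by have := need e eE' _ _ (steiner_single _ Kx); rewrite /weight big_set0.
have n0 : 0 < n by case: (n) x {Kx} => [[]|].
suff [y Vy] : exists2 y, K \subset [set y] & out_verts E' = [set y].
  by move=> ->; rewrite E0; exact: steiner_single.
case: (set_0Vmem K) => [K0|[y yK]].
  exists (Ordinal n0); first by rewrite K0 sub0set.
  apply/setP => t; rewrite !inE K0 inE cards0 /= -val_eqE /=.
  by rewrite orb_idr // => /existsP[u]; rewrite /adj E0 inE.
have Ky : K = [set y].
  apply/eqP; rewrite eqEsubset sub1set yK andbT; apply/subsetP => z zK.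
  by rewrite inE; apply/eqP; apply: (card_le1_eqP hK).
exists y; first by rewrite Ky.
apply/setP => t; rewrite !inE Ky cards1 inE /=.
by rewrite orb_idr // => /existsP[u]; rewrite /adj E0 inE.
Qed.

End Pruning.

Lemma nth_allpairs_row (T1 T2 : Type) (f : T1 -> T2 -> nat) s t i j x y :
  i < size s -> j < size t ->
  nth 0 [seq f a b | a <- s, b <- t] (i * size t + j) = f (nth x s i) (nth y t j).
Proof.
elim: s i => //= a s IH [|i] hi hj; rewrite nth_cat size_map.
  by rewrite mul0n add0n hj (nth_map y).
by rewrite mulSn -addnA ltnNge leq_addr /= addKn IH.
Qed.

Lemma nth_pairs (f : 'I_n -> 'I_n -> nat) (u v : 'I_n) :
  nth 0 [seq f a b | a <- enum 'I_n, b <- enum 'I_n] (u * n + v) = f u v.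
Proof.
have := @nth_allpairs_row _ _ f (enum 'I_n) (enum 'I_n) u v u v.
by rewrite size_enum_ord !nth_ord_enum; apply.
Qed.

Lemma size_pairs (f : 'I_n -> 'I_n -> nat) :
  size [seq f a b | a <- enum 'I_n, b <- enum 'I_n] = n * n.
Proof. by rewrite size_allpairs size_enum_ord. Qed.

Lemma size_vertex_table (A : {set 'I_n}) : size (vertex_table A) = n.
Proof. by rewrite size_map size_enum_ord. Qed.

Lemma nth_vertex_table (A : {set 'I_n}) (t : 'I_n) : nth 0 (vertex_table A) t = (t \in A).
Proof. by rewrite (nth_map t) ?size_enum_ord // nth_ord_enum. Qed.

(** The output overwrites the input, which has been copied to the arrays by then. *)
Hypothesis off_out : 1 + n + n * n <= off.

Lemma p_output_ok (E : {set {set 'I_n}}) s : consts s -> mat s aW (cmat E cost BIG) ->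
  (forall e, e \in E -> cost e < BIG) ->
  wp p_output (fun s' => forall i, i < size (encode_tree (out_verts E) E) ->
    rw s' i = nth 0 (encode_tree (out_verts E) E) i) s.
Proof.
move=> hc hW hE; have WE u v : (cmat E cost BIG u v < BIG) = adj E u v.
  by rewrite /cmat; case: ifP => [/hE ->//|]; rewrite ltnn.
rewrite /p_output; apply: (@wp_seq _ _ _ _ _ _ _ (fun s' => rw s' 0 = 1)).
  by rewrite /=; split=> //; [move: off_out; clear; lia|move: M_index; clear; lia].
move=> s1 h1 hf1; have hc1 := consts_frame hf1 erefl hc.
have hW1 : mat s1 aW (cmat E cost BIG) by move=> u v; rewrite (frame_ar _ hf1).
apply: (@wp_seq _ _ _ _ _ _ _ (fun s' => rw s' 0 = 1 /\
   forall t : 'I_n, rw s' t.+1 = (t \in out_verts E))).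
  apply: (@wp_for _ _ _ _ _ _ _ (fun i s' => rw s' 0 = 1 /\
     forall t : 'I_n, t < i -> rw s' t.+1 = (t \in out_verts E))).
  - by rewrite (c_n hc1).
  - by [].
  - move=> i s2 hi hx _ [h2 hv2] hf2; rewrite (c_n hc1) in hi; pose t := Ordinal hi.
    have hc2 := consts_frame hf2 erefl hc1.
    have hW2 : mat s2 aW (cmat E cost BIG) by move=> u v; rewrite (frame_ar _ hf2).
    pose y0 : nat := (t \in K) + (#|K| == 0) * (i == 0).
    have y02 : y0 < M.
      by move: M_index; rewrite /y0; case: (_ \in _); case: (_ == _); case: (_ == _); clear; lia.
    apply: (@wp_set y0) => //; first by rewrite /= hx (c_K hc2 t) (c_kc hc2).
    set s3 := setr _ _ _; have hc3 : consts s3 by apply: consts_setr.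
    have hW3 : mat s3 aW (cmat E cost BIG) by exact: hW2.
    have hx3 : rg s3 rT = i by rewrite /s3 /= /upd.
    have hy3 : rg s3 rY = y0 by rewrite /s3 /= /upd.
    have hr3 : rw s3 =1 rw s2 by [].
    clearbody s3.
    apply: (@wp_seq _ _ _ _ _ _ _ (fun s' => (0 < rg s' rY) = (t \in out_verts E))).
      apply: (@wp_for _ _ _ _ _ _ _ (fun j s' =>
         (0 < rg s' rY) = (0 < y0) || [exists u : 'I_n, adj E t u && (u < j)])).
      + by rewrite (c_n hc3).
      + rewrite /= /upd /= hy3; case: (0 < y0) => //=; apply/esym/existsP => -[u].
        by rewrite andbF.
      + move=> j s4 hj hu _ hy hf4; rewrite (c_n hc3) in hj; pose u := Ordinal hj.
        have hc4 := consts_frame hf4 erefl hc3.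
        have hx4 : rg s4 rT = i by rewrite (frame_rg hf4).
        have hW4 : ar s4 aW (i * n + j) = cmat E cost BIG t u.
          by rewrite (frame_ar _ hf4) // -hW3.
        have hS : [exists u0 : 'I_n, adj E t u0 && (u0 < j.+1)] =
            adj E t u || [exists u0 : 'I_n, adj E t u0 && (u0 < j)].
          apply/existsP/orP => [[u0 /andP[a1 a2]]|[a1|/existsP[u0 /andP[a1 a2]]]].
          - move: a2; rewrite ltnS leq_eqVlt => /orP[/eqP e|a2].
              by left; rewrite (_ : u = u0) //; apply: val_inj; rewrite /= e.
            by right; apply/existsP; exists u0; rewrite a1.
          - by exists u; rewrite a1 /=.
          - by exists u0; rewrite a1 ltnW.
        apply: wp_if; rewrite [ev _ _]/= hx4 hu (c_n hc4) hW4 (c_big hc4) WE.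
          case: (boolP (adj E t u)) => // tu _; rewrite /= /upd /=.
          by rewrite hS tu orbT; split=> //; move: M_index; clear; lia.
        by move=> /eqP; rewrite eqb0 => /negbTE tu; rewrite /= /upd /= hy hS tu.
      + move=> s4 _ -> _; rewrite (c_n hc3) inE /y0 orbA; congr (_ || _).
          by case: (_ \in _); case: (_ == _); case: (_ == _).
        by apply: eq_existsb => u; rewrite ltn_ord andbT.
    move=> s4 hy hf4; have hx4 : rg s4 rT = i by rewrite (frame_rg hf4).
    have hr4 j : rw s4 j = rw s2 j by case: hf4 => _ _ ->.
    rewrite /= hx4 hy addn1; split.
    + by have := hi; have := off_out; clear; lia.
    + by case: (_ \in _); move: M_index; clear; lia.
    split; first by rewrite /upd /= hr4.
    move=> t'; rewrite /upd eqSS ltnS leq_eqVlt; case: (eqVneq (t' : nat) i) => [e _|_ /= h].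
      by rewrite (_ : t' = t) //; apply: val_inj.
    by rewrite hr4 hv2.
  - by move=> s2 _ [h2 hv2] _; split=> // t; apply: hv2; rewrite (c_n hc1) ltn_ord.
move=> s2 [h2 hv2] hf2; have hc2 := consts_frame hf2 erefl hc1.
have hW2 : mat s2 aW (cmat E cost BIG) by move=> u v; rewrite (frame_ar _ hf2).
apply: (@wp_for _ _ _ _ _ _ _ (fun i s' => [/\ rw s' 0 = 1,
   forall t : 'I_n, rw s' t.+1 = (t \in out_verts E)
   & forall u v : 'I_n, u * n + v < i -> rw s' (n + 1 + (u * n + v)) = adj E u v])).
- by rewrite (c_nn hc2).
- by [].
- move=> i s3 hi hx _ [h3 hv3 he3] hf3; rewrite (c_nn hc2) in hi.
  have hc3 := consts_frame hf3 erefl hc2; have [u [v [ei eu ev']]] := pairP hi.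
  have hW3 : mat s3 aW (cmat E cost BIG) by move=> a b; rewrite (frame_ar _ hf3).
  have hv : (ar s3 aW i < BIG) = adj E u v by rewrite ei hW3 WE.
  rewrite /= hx (c_n hc3) (c_big hc3) hv; split.
  + by move: off_out hi; clear; lia.
  + by case: (adj _ _ _); move: M_index; clear; lia.
  split.
  + by rewrite /upd ifF ?h3 //; apply/eqP; clear; lia.
  + by move=> t; rewrite /upd ifF ?hv3 //; apply/eqP; have := ltn_ord t; clear; lia.
  + move=> a b; rewrite /upd eqn_add2l ltnS leq_eqVlt; case: eqP => [e _|_ /= h]; last exact: he3.
    by rewrite ei in e; have [-> ->] := pair_inj e.
- move=> s3 _ [h3 hv3 he3] _ i; rewrite (c_nn hc2) in he3.
  rewrite /encode_tree /= size_cat size_vertex_table size_pairs.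
  case: i => // i hi; case: (ltnP i n) => hin.
    rewrite /= nth_cat size_vertex_table hin.
    by rewrite (hv3 (Ordinal hin)) -nth_vertex_table.
  have hj : i - n < n * n by move: hi hin; clear; lia.
  have [u [v [ei _ _]]] := pairP hj.
  rewrite /= nth_cat size_vertex_table ltnNge hin /= ei nth_pairs -he3 ?pair_ltn //.
  by congr (rw s3 _); rewrite -ei; move: hin; clear; lia.
Qed.

Lemma p_main_ok (E : {set {set 'I_n}}) s : is_graph E -> multiway_cut E K S ->
  weight cost E < BIG -> consts s -> mat s aW (cmat E cost BIG) ->
  wp p_main (fun s' =>
    (exists V F, min_steiner_tree E cost K V F /\
       forall i, i < size (encode_tree V F) -> rw s' i = nth 0 (encode_tree V F) i) \/
    ((forall V F, ~ steiner_tree E K V F) /\ rw s' 0 = 0)) s.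
Proof.
move=> gE cut wE hc hW.
have hE e : e \in E -> cost e < BIG.
  move=> eE; apply: leq_ltn_trans wE; rewrite /weight (big_setD1 e) //=; exact: leq_addr.
apply: (wp_seq (p_value_ok hc hW cut hE)) => s1 [v1 v2 v3] hf1.
have hc1 := consts_frame hf1 erefl hc.
have hW1 : mat s1 aW (cmat E cost BIG) by move=> u v; rewrite (frame_ar _ hf1).
apply: (@wp_set (rg s1 rBest)) => //; first by apply: ltM; move: v3; clear; lia.
set s2 := setr _ _ _; have hc2 : consts s2 by apply: consts_setr.
have hW2 : mat s2 aW (cmat E cost BIG) by exact: hW1.
have ho2 : rg s2 rOpt = rg s1 rBest by rewrite /s2 /= /upd.
clearbody s2; set opt := rg s1 rBest in v1 v2 v3 ho2.
apply: wp_if; rewrite [ev _ _]/= ho2 (c_big hc2); case: ltnP => // hb _; last first.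
  rewrite /=; split; [by move: off_out; clear; lia|by move: M_index; clear; lia|right; split=> //].
  (* Every tree weighs less than [BIG], so a lower bound of [BIG] excludes all of them. *)
  move=> V F VF; have := leq_trans hb (v1 V F VF); rewrite leqNgt => /negP; apply.
  by apply: leq_ltn_trans wE; apply: weight_sub; case: VF => [[]].
apply: (wp_seq (p_prune_ok cut hE hb hc2 hW2 ho2 (v2 hb))) => s3 [E' [hW3 hp]] hf3.
have hc3 := consts_frame hf3 erefl hc2.
have hE' e : e \in E' -> cost e < BIG by case: hp => h _ _ /(subsetP h)/hE.
apply: wp_conseq (p_output_ok hc3 hW3 hE') _ => s4 h4 _; left.
by exists (out_verts E'), E'; split=> //; exact: (pruned_min gE v1 hp).
Qed.


Lemma frame_rw p s s' i : frame p s s' -> ~~ mo p -> rw s' i = rw s i.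
Proof. by case=> _ _ h /h. Qed.

(** * Reading the input *)

Section Init.

Variable E : {set {set 'I_n}}.
Notation input := (encode_input E cost K S).
Notation costs := (cost_table E cost).

Hypothesis BIG_def : BIG = (sumn costs).+1.
Hypothesis off_def : off = size input.

Lemma size_input : size input = (n + (n + (n * n + n * n))).+1.
Proof. by rewrite /= !size_cat !size_vertex_table !size_pairs. Qed.

Lemma input_K (t : 'I_n) : nth 0 input (1 + t) = (t \in K).
Proof. by rewrite /= nth_cat size_vertex_table ltn_ord nth_vertex_table. Qed.

Lemma nth_skip (l1 l2 : seq nat) a i : size l1 = a -> nth 0 (l1 ++ l2) (a + i) = nth 0 l2 i.
Proof. by move=> <-; rewrite nth_cat ltnNge leq_addr /= addKn. Qed.

Lemma input_tail i : nth 0 input (1 + (n + i)) =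
  nth 0 (vertex_table S ++ edge_table E ++ costs) i.
Proof. exact: nth_skip (size_vertex_table K). Qed.

Lemma input_tables i : nth 0 input (1 + (n + (n + i))) = nth 0 (edge_table E ++ costs) i.
Proof. by rewrite input_tail (nth_skip _ _ (size_vertex_table S)). Qed.

Lemma input_S (t : 'I_n) : nth 0 input (1 + (n + t)) = (t \in S).
Proof. by rewrite input_tail nth_cat size_vertex_table ltn_ord nth_vertex_table. Qed.

Lemma input_edge (u v : 'I_n) : nth 0 input (1 + (n + (n + (u * n + v)))) = adj E u v.
Proof. by rewrite input_tables nth_cat size_pairs pair_ltn nth_pairs. Qed.

Lemma input_cost i : nth 0 input (1 + (n + (n + (n * n + i)))) = nth 0 costs i.
Proof. rewrite input_tables; exact: nth_skip (size_pairs _). Qed.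

Lemma sumn_take_le (l : seq nat) i : sumn (take i l) <= sumn l.
Proof. by rewrite -{2}(cat_take_drop i l) sumn_cat leq_addr. Qed.

Lemma nth_sumn_le (l : seq nat) i : nth 0 l i <= sumn l.
Proof. by elim: l i => [|x l IH] [|i] //=; [exact: leq_addr|have := IH i; clear; lia]. Qed.

Lemma sumn_take_nth (l : seq nat) i : i < size l ->
  sumn (take i.+1 l) = sumn (take i l) + nth 0 l i.
Proof. by move=> h; rewrite (take_nth 0) // sumn_rcons. Qed.

(** The contents of [aS] once the first [i] vertices have been scanned. *)
Definition members i : seq nat :=
  [seq j <- iota 0 i | if insub j is Some v then v \in S else false].

Lemma membersS (i : nat) (t : 'I_n) : i = t ->
  members i.+1 = if t \in S then rcons (members i) i else members i.
Proof.
move=> ->; rewrite /members -addn1 iotaD filter_cat add0n /= valK.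
by case: ifP; rewrite ?cats1 ?cats0.
Qed.

Lemma members_all : members n = slist.
Proof.
rewrite /members -val_enum_ord filter_map /slist; congr map.
have -> : enum S = [seq v <- enum 'I_n | v \in S] by rewrite enumT.
by apply: eq_filter => v /=; rewrite valK.
Qed.

Lemma p_init_ok s : rg s rN = n -> rg s rKC = 0 -> rg s rk_ = 0 ->
  (forall i, rw s i = nth 0 input i) ->
  wp p_init (fun s' => consts s' /\ mat s' aW (cmat E cost BIG)) s.
Proof.
move=> hn hkc hk hin; have osz := size_input; rewrite -off_def in osz.
rewrite /p_init; apply: (@wp_set (n * n)); [by rewrite /= hn|by move: M_index; clear; lia|].
set s1 := setr _ _ _.
have n1 : rg s1 rN = n by [].
have nn1 : rg s1 rNN = n * n by rewrite /s1 /= /upd.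
have kc1 : rg s1 rKC = 0 by [].
have k1 : rg s1 rk_ = 0 by [].
have in1 i : rw s1 i = nth 0 input i by exact: hin.
clearbody s1.
apply: (@wp_seq _ _ _ _ _ _ _ (fun s' => rg s' rKC = #|K| /\
  forall t : 'I_n, ar s' aK t = (t \in K))).
  apply: (@wp_for _ _ _ _ _ _ _ (fun i s' => rg s' rKC = #|[set t in K | t < i]| /\
    forall t : 'I_n, t < i -> ar s' aK t = (t \in K))).
  - by rewrite n1.
  - split=> //; rewrite /= /upd /= kc1; apply/esym/eqP; rewrite cards_eq0; apply/eqP/setP => t.
    by rewrite !inE andbF.
  - move=> i s2 hi hx _ [h1 h2] hf2; rewrite n1 in hi; pose t := Ordinal hi.
    have hr : rw s2 (1 + i) = (t \in K) by rewrite (frame_rw _ hf2) // in1 -input_K.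
    have hS : #|[set t in K | t < i.+1]| = #|[set t in K | t < i]| + (t \in K).
      case tK : (t \in K); last first.
        rewrite addn0; apply: eq_card => v; rewrite !inE ltnS leq_eqVlt.
        by case: (eqVneq (v : nat) i) => //= e; rewrite (_ : v = t) ?tK //; apply: val_inj.
      have <- : #|t |: [set t in K | t < i]| = #|[set t in K | t < i]| + true.
        by rewrite cardsU1 !inE /= ltnn andbF addnC.
      apply: eq_card => v; rewrite !inE ltnS leq_eqVlt -val_eqE /=.
      by case: (eqVneq (v : nat) i) => //= e; rewrite (_ : v = t) ?tK //; apply: val_inj.
    have hc : #|[set t in K | t < i]| + 1 < M.
      by have := max_card [set t in K | t < i]; rewrite card_ord; move: M_index; clear; lia.
    rewrite [wp _ _ _]/= hx hr /upd /= h1 hx; split; first by have := hi; move: osz; clear; lia.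
    have bM (b : bool) : b < M by move: M_index; case: b; clear; lia.
    split=> //; first by have := hi; have := L_index; clear; lia.
    split; first by move: hc; case: (t \in K); clear; lia.
    split; first by rewrite hS.
    move=> t'; rewrite ltnS leq_eqVlt; case: (eqVneq (t' : nat) i) => [e _|_ /= h]; last exact: h2.
    by rewrite (_ : t' = t) //; apply: val_inj.
  - move=> s2 _ [h1 h2] _; rewrite n1 in h1 h2; split=> [|t]; last by rewrite h2.
    by rewrite h1; apply: eq_card => t; rewrite !inE ltn_ord andbT.
move=> s2 [kc2 K2] hf2.
have n2 : rg s2 rN = n by rewrite (frame_rg hf2).
have nn2 : rg s2 rNN = n * n by rewrite (frame_rg hf2).
have k2 : rg s2 rk_ = 0 by rewrite (frame_rg hf2).
have in2 i : rw s2 i = nth 0 input i by rewrite (frame_rw _ hf2).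
apply: (@wp_seq _ _ _ _ _ _ _ (fun s' => rg s' rk_ = size slist /\
  forall j, j < size slist -> ar s' aS j = nth 0 slist j)).
  apply: (@wp_for _ _ _ _ _ _ _ (fun i s' => rg s' rk_ = size (members i) /\
    forall j, j < size (members i) -> ar s' aS j = nth 0 (members i) j)).
  - by rewrite n2.
  - by [].
  - move=> i s3 hi hx _ [h1 h2] hf3; rewrite n2 in hi; pose t := Ordinal hi.
    have hr : rw s3 (1 + (n + i)) = (t \in S) by rewrite (frame_rw _ hf3) // in2 -input_S.
    have n3 : rg s3 rN = n by rewrite (frame_rg hf3).
    have sz : size (members i) <= i by rewrite size_filter (leq_trans (count_size _ _)) ?size_iota.
    rewrite [wp _ _ _]/= n3 hx hr (@membersS i t) //; split; first by have := hi; move: osz; clear; lia.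
    case: (t \in S) => /=; rewrite /upd /= ?h1 ?hx //.
    split; [by have := hi; have := L_index; move: sz; clear; lia
           |by have := hi; move: M_index; clear; lia|].
    split; first by have := hi; move: M_index sz; clear; lia.
    rewrite size_rcons addn1; split=> // j; rewrite ltnS leq_eqVlt nth_rcons.
    by case: (ltngtP j (size (members i))) => //= h _; apply: h2.
  - by move=> s3 _; rewrite n2 members_all.
move=> s3 [k3 S3] hf3.
have n3 : rg s3 rN = n by rewrite (frame_rg hf3).
have nn3 : rg s3 rNN = n * n by rewrite (frame_rg hf3).
have kc3 : rg s3 rKC = #|K| by rewrite (frame_rg hf3).
have K3 (t : 'I_n) : ar s3 aK t = (t \in K) by rewrite (frame_ar _ hf3).
have in3 i : rw s3 i = nth 0 input i by rewrite (frame_rw _ hf3).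
have szk : size slist = k by rewrite /slist size_map -cardE Ek.
rewrite {}szk in k3 S3.
apply: (@wp_set 1) => //; first by move: M_index; clear; lia.
set s4 := setr _ _ _.
have n4 : rg s4 rN = n by [].
have nn4 : rg s4 rNN = n * n by [].
have kc4 : rg s4 rKC = #|K| by [].
have k4 : rg s4 rk_ = k by [].
have K4 (t : 'I_n) : ar s4 aK t = (t \in K) by exact: K3.
have S4 j : j < k -> ar s4 aS j = nth 0 slist j by exact: S3.
have in4 i : rw s4 i = nth 0 input i by exact: in3.
have b4 : rg s4 rBig = 1 by rewrite /s4 /= /upd.
clearbody s4.
have szc : size costs = n * n by exact: size_pairs.
have BM : BIG < M by apply: ltM; clear; lia.
apply: (@wp_seq _ _ _ _ _ _ _ (fun s' => rg s' rBig = BIG)).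
  apply: (@wp_for _ _ _ _ _ _ _ (fun i s' => rg s' rBig = (sumn (take i costs)).+1)).
  - by rewrite nn4.
  - by rewrite /= /upd /= b4 take0.
  - move=> i s5 hi hx _ hb hf5; rewrite nn4 in hi.
    have n5 : rg s5 rN = n by rewrite (frame_rg hf5).
    have nn5 : rg s5 rNN = n * n by rewrite (frame_rg hf5).
    have hr : rw s5 (1 + (n + (n + (n * n + i)))) = nth 0 costs i.
      by rewrite (frame_rw _ hf5) // in4 input_cost.
    have hS := @sumn_take_nth costs i; rewrite szc in hS; have {}hS := hS hi.
    rewrite [wp _ _ _]/= n5 nn5 hx hr /upd /= hb; split.
      by have := hi; move: osz; clear; lia.
    rewrite addSn -hS; split=> //.
    by apply: leq_ltn_trans BM; rewrite BIG_def ltnS sumn_take_le.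
  - by move=> s5 _; rewrite nn4 -szc take_size -BIG_def.
move=> s5 b5 hf5.
have n5 : rg s5 rN = n by rewrite (frame_rg hf5).
have nn5 : rg s5 rNN = n * n by rewrite (frame_rg hf5).
have kc5 : rg s5 rKC = #|K| by rewrite (frame_rg hf5).
have k5 : rg s5 rk_ = k by rewrite (frame_rg hf5).
have K5 (t : 'I_n) : ar s5 aK t = (t \in K) by rewrite (frame_ar _ hf5).
have S5 j : j < k -> ar s5 aS j = nth 0 slist j by move=> h; rewrite (frame_ar _ hf5) // S4.
have in5 i : rw s5 i = nth 0 input i by rewrite (frame_rw _ hf5).
apply: (@wp_seq _ _ _ _ _ _ _ (fun s' => mat s' aW (cmat E cost BIG))).
  apply: (@wp_for _ _ _ _ _ _ _ (fun i s' => forall u v : 'I_n, u * n + v < i ->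
    ar s' aW (u * n + v) = cmat E cost BIG u v)).
  - by rewrite nn5.
  - by [].
  - move=> i s6 hi hx _ hI hf6; rewrite nn5 in hi.
    have n6 : rg s6 rN = n by rewrite (frame_rg hf6).
    have nn6 : rg s6 rNN = n * n by rewrite (frame_rg hf6).
    have b6 : rg s6 rBig = BIG by rewrite (frame_rg hf6).
    have [u [v [ei eu ev']]] := pairP hi.
    have hr1 : rw s6 (1 + (n + (n + i))) = adj E u v.
      by rewrite (frame_rw _ hf6) // in5 ei input_edge.
    have hr2 : rw s6 (1 + (n + (n + (n * n + i)))) = nth 0 costs i.
      by rewrite (frame_rw _ hf6) // in5 input_cost.
    have hc : nth 0 costs i = if adj E u v then cost [set u; v] else 0.
      by rewrite ei nth_pairs.
    have cM : nth 0 costs i < M.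
      by apply: leq_ltn_trans BM; rewrite BIG_def; apply: leq_trans (nth_sumn_le _ _) _.
    have iL : i < lmax by move: L_index; rewrite mulSn; move: hi; clear; lia.
    have upd_ok x : x = cmat E cost BIG u v ->
        forall u' v' : 'I_n, u' * n + v' < i.+1 ->
        upd (ar s6 aW) i x (u' * n + v') = cmat E cost BIG u' v'.
      move=> -> u' v'; rewrite /upd ltnS leq_eqVlt; case: eqP => [e _|_ /= h]; last exact: hI.
      by rewrite ei in e; have [-> ->] := pair_inj e.
    rewrite [wp _ _ _]/= ?n6 ?nn6 ?hx ?hr1 /upd /= ?n6 ?nn6 ?hx ?hr2 ?b6; split.
      by have := hi; move: osz; clear; lia.
    split; first by have := hi; move: osz; clear; lia.
    case: ifP => huv /=; split=> //; apply: upd_ok.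
      by rewrite hc /cmat; case: (adj E u v) huv.
    by rewrite /cmat; case: (adj E u v) huv.
  - by move=> s6 _ hI _ u v; apply: hI; rewrite nn5 pair_ltn.
move=> s6 W6 hf6.
have n6 : rg s6 rN = n by rewrite (frame_rg hf6).
have nn6 : rg s6 rNN = n * n by rewrite (frame_rg hf6).
have kc6 : rg s6 rKC = #|K| by rewrite (frame_rg hf6).
have k6 : rg s6 rk_ = k by rewrite (frame_rg hf6).
have b6 : rg s6 rBig = BIG by rewrite (frame_rg hf6).
have K6 (t : 'I_n) : ar s6 aK t = (t \in K) by rewrite (frame_ar _ hf6).
have S6 j : j < k -> ar s6 aS j = nth 0 slist j by move=> h; rewrite (frame_ar _ hf6) // S5.
apply: (@wp_set m); [by rewrite /= k6 Em|by move: M_index; clear; lia|].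
apply: (@wp_set B); [by rewrite /= /upd /= k6 EB|by move: M_lim; clear; lia|].
apply: (@wp_set 1) => //; first by move: M_index; clear; lia.
set s7 := setr _ _ _.
have m7 : rg s7 rM = m by rewrite /s7 /= /upd.
have B7 : rg s7 rB = B by rewrite /s7 /= /upd.
have l7 : rg s7 rLim = 1 by rewrite /s7 /= /upd.
apply: (@wp_for _ _ _ _ _ _ _ (fun i s' => rg s' rLim = B ^ i)).
- by rewrite m7.
- by rewrite /= /upd /=.
- move=> i s8 hi hx _ hl hf8; rewrite m7 in hi.
  have B8 : rg s8 rB = B by rewrite (frame_rg hf8).
  rewrite /= B8 hl /upd /= -expnSr; split=> //.
  apply: leq_ltn_trans (leq_ltn_trans (leq_addr B LIM) M_lim); rewrite ELIM.
  have k0 : 0 < k by apply: k_gt0; case: (m) hi.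
  by apply: leq_pexp2l => //; rewrite EB Em !muln_gt0 k0.
move=> s8 _ hl hf8; rewrite m7 -ELIM in hl; split; last first.
  by move=> u v; rewrite (frame_ar _ hf8) //; exact: W6.
split=> //; rewrite ?(frame_rg hf8) //.
- by move=> t; rewrite (frame_ar _ hf8) //; exact: K6.
- by move=> j hj; rewrite (frame_ar _ hf8) //; exact: S6.
Qed.

(** Each edge has an entry in the cost table. [f] collects the entries belonging to one edge, and
    exchanging the sums turns them into the whole table. *)
Lemma weight_lt_big : is_graph E -> weight cost E < BIG.
Proof.
move=> gE; rewrite BIG_def ltnS sumnE big_allpairs_dep /=.
pose f e := \sum_(u : 'I_n) \sum_(v : 'I_n) (if [set u; v] == e then cost e else 0).
apply: (@leq_trans (\sum_(e in E) f e)).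
  apply: leq_sum => e eE; have /eqP/cards2P[u [v [_ ee]]] := gE _ eE.
  by rewrite /f (bigD1 u) //= (bigD1 v) //= -ee eqxx -!addnA leq_addr.
rewrite /f exchange_big /= !big_enum /=; apply: leq_sum => u _.
rewrite exchange_big /= !big_enum /=; apply: leq_sum => v _.
rewrite -big_mkcondr /adj; case: ifP => uv.
  rewrite (big_pred1 [set u; v]) // => e /=.
  by case: (eqVneq [set u; v] e) => [<-|]; rewrite ?uv ?andbF //= eq_sym => /negbTE ->.
by rewrite big1 // => e /andP[eE /eqP euv]; rewrite euv eE in uv.
Qed.

End Init.
End Values.

(** * Resource bounds *)

Lemma poly_bound_ge c x : c <= poly_bound c x.
Proof. exact: leq_addl. Qed.

Lemma poly_bound_mono c c' x : c <= c' -> poly_bound c x <= poly_bound c' x.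
Proof.
case: c => [//|c] h; rewrite /poly_bound; apply: leq_add => //; apply: leq_mul => //.
case: x => [|x]; first by rewrite exp0n.
exact: leq_pexp2l.
Qed.

Lemma poly_bound_add a b x : poly_bound a x + poly_bound b x <= poly_bound (a + b) x.
Proof.
have ha := poly_bound_mono x (leq_addr b a); have hb := poly_bound_mono x (leq_addl a b).
case: a ha hb => [|a] ha hb; first by rewrite add0n in hb *.
case: b ha hb => [|b] _ _; first by rewrite addn0 /poly_bound !mul0n !addn0.
rewrite /poly_bound mulnDl addnACA leq_add2r.
case: x => [|x]; first by rewrite !exp0n.
by apply: leq_add; rewrite leq_mul2l leq_pexp2l ?orbT // ?leq_addr ?leq_addl.
Qed.

(** For a positive argument the constant term is at most the leading one; this costs a factor 2 for
    each polynomial, whence the 4. *)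
Lemma poly_bound_mul a b x :
  poly_bound a x * poly_bound b x <= poly_bound (4 * (a * b) + a + b) x.
Proof.
set c := _ + _ + _; case: x => [|x].
  apply: leq_trans (_ : 4 * (a * b) <= _); last first.
    by apply: leq_trans (poly_bound_ge c 0); rewrite /c; lia.
  rewrite /poly_bound; case: a {c} => [|a]; case: b => [|b] //; rewrite ?muln0 //.
  by rewrite !exp0n // !muln0 !add0n leq_pmull.
have h y : poly_bound y x.+1 <= 2 * y * x.+1 ^ y.
  by rewrite /poly_bound; have : 0 < x.+1 ^ y by [rewrite expn_gt0]; nia.
apply: leq_trans (leq_mul (h a) (h b)) _.
have -> : 2 * a * x.+1 ^ a * (2 * b * x.+1 ^ b) = 4 * (a * b) * x.+1 ^ (a + b).
  by rewrite expnD; move: (x.+1 ^ a) (x.+1 ^ b) => X Y; lia.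
apply: leq_trans (leq_addr _ _); apply: leq_mul; first by rewrite /c; lia.
by apply: leq_pexp2l => //; rewrite /c; lia.
Qed.

Definition log_size k := k * trunc_log 2 k.

Lemma time_bound_mono c c' k n : c <= c' -> time_bound c k n <= time_bound c' k n.
Proof.
move=> h; apply: leq_mul; last exact: poly_bound_mono.
by apply: leq_pexp2l => //; rewrite leq_mul2r h orbT.
Qed.

(** Closed under sums and products, so the running time of the program can be bounded along its
    syntax without computing constants. The condition [k <= n] is available as [k] is the size of
    [S]. *)
Definition timely (f : nat -> nat -> nat) :=
  exists c, forall k n, k <= n -> f k n <= time_bound c k n.

Lemma timely_le f g : timely g -> (forall k n, k <= n -> f k n <= g k n) -> timely f.
Proof. by case=> c h fg; exists c => k n kn; apply: leq_trans (h k n kn); exact: fg. Qed.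

Lemma timely_const a : timely (fun _ _ => a).
Proof.
exists a => k n _; apply: leq_trans (poly_bound_ge a n) _.
by rewrite leq_pmull // expn_gt0.
Qed.

Lemma timely_n : timely (fun _ n => n).
Proof.
exists 1 => k n _; apply: leq_trans (_ : poly_bound 1 n <= _).
  by rewrite /poly_bound expn1 mul1n leq_addr.
by rewrite leq_pmull // expn_gt0.
Qed.

Lemma timely_add f g : timely f -> timely g -> timely (fun k n => f k n + g k n).
Proof.
case=> a ha [b hb]; exists (a + b) => k n kn.
apply: leq_trans (leq_add (ha k n kn) (hb k n kn)) _.
rewrite /time_bound; apply: leq_trans (_ : 2 ^ ((a + b) * (k * trunc_log 2 k)) *
  (poly_bound a n + poly_bound b n) <= _); last by rewrite leq_mul2l poly_bound_add orbT.
by rewrite mulnDr; apply: leq_add; apply: leq_mul => //; apply: leq_pexp2l => //;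
  rewrite leq_mul2r ?leq_addr ?leq_addl orbT.
Qed.

Lemma timely_mul f g : timely f -> timely g -> timely (fun k n => f k n * g k n).
Proof.
case=> a ha [b hb]; exists (4 * (a * b) + a + b) => k n kn.
apply: leq_trans (leq_mul (ha k n kn) (hb k n kn)) _.
rewrite /time_bound mulnACA -expnD; apply: leq_mul; last exact: poly_bound_mul.
by apply: leq_pexp2l => //; rewrite -mulnDl leq_mul2r; apply/orP; right; lia.
Qed.

Lemma timely_k : timely (fun k _ => k).
Proof. by apply: timely_le timely_n _. Qed.

Lemma timely_tm p (env : nat -> nat -> nat -> nat) :
  (forall r, timely (fun k n => env k n r)) -> timely (fun k n => tm (env k n) p).
Proof.
move=> he; elim: p => [|r e|a i e|r i|i e|p IHp q IHq|e p IHp q IHq|r b p IHp] /=;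
  try exact: timely_const.
- exact: timely_add.
- apply: (@timely_le _ (fun k n => (eval_time (cex e)).+1 + (tm (env k n) p + tm (env k n) q))).
    by apply: timely_add; [exact: timely_const|exact: timely_add].
  by [].
- apply: timely_add; first exact: timely_const.
  apply: timely_mul => //; apply: timely_add => //; exact: timely_const.
Qed.

Definition guesses k := (4 * k * (5 * k)) ^ (5 * k).

(** For [k >= 2] the rounded logarithm [l] is at least 1, so 20 k ^ 2 is at most 2 ^ 5 * 2 ^ (2 l +
    2) and hence at most 2 ^ (9 l); the exponent 5 k turns 9 into 45. For smaller [k] the term k log
    k vanishes, and the polynomial factor has to absorb the guesses. *)
Lemma timely_guesses : timely (fun k _ => guesses k).
Proof.
(* The number is 20 ^ 5; naming it keeps it from being evaluated in unary. *)
have [a ea] : exists a, a = guesses 1 by eexists.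
exists (45 + a) => k n kn.
case: (posnP k) => [->|k0].
  rewrite /guesses !muln0 expn0 /time_bound muln_gt0 expn_gt0 /=.
  by apply: leq_trans (poly_bound_ge _ _).
case: (eqVneq k 1) => [->|k1].
  rewrite -ea /time_bound; apply: leq_trans (leq_pmull _ _); last by rewrite expn_gt0.
  by apply: leq_trans (poly_bound_ge _ _); rewrite leq_addl.
have k2 : 1 < k by lia.
apply: leq_trans (_ : 2 ^ (45 * (k * trunc_log 2 k)) <= _); last first.
  rewrite /time_bound -[leqLHS]muln1; apply: leq_mul.
    by apply: leq_pexp2l => //; rewrite leq_mul2r leq_addr orbT.
  by apply: leq_trans (poly_bound_ge _ _).
set l := trunc_log 2 k.
have l0 : 0 < l by rewrite trunc_log_gt0.
have kl : k <= 2 ^ l.+1 by apply: ltnW; apply: trunc_log_ltn.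
have -> : 45 * (k * l) = 9 * l * (5 * k) by lia.
rewrite /guesses [2 ^ _]expnM leq_exp2r ?muln_gt0 //.
apply: (@leq_trans (2 ^ 5 * (2 ^ l.+1 * 2 ^ l.+1))).
  rewrite (_ : 4 * k * (5 * k) = 20 * (k * k)); last by lia.
  by apply: leq_mul => //; exact: leq_mul.
by rewrite -!expnD; apply: leq_pexp2l => //; lia.
Qed.

Lemma guesses_word k : guesses k <= 2 ^ (4 * k * (5 * k) * (5 * k)).
Proof.
rewrite /guesses [2 ^ _]expnM; case: (posnP k) => [->|k0]; first by rewrite !muln0.
by rewrite leq_exp2r ?muln_gt0 // ltnW // ltn_expl.
Qed.

Definition polynomial (f : nat -> nat -> nat) :=
  exists c, forall k n, k <= n -> f k n <= poly_bound c n.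

Lemma polynomial_const a : polynomial (fun _ _ => a).
Proof. by exists a => k n _; exact: poly_bound_ge. Qed.

Lemma polynomial_n : polynomial (fun _ n => n).
Proof. by exists 1 => k n _; rewrite /poly_bound expn1 mul1n leq_addr. Qed.

Lemma polynomial_k : polynomial (fun k _ => k).
Proof. by have [c h] := polynomial_n; exists c => k n kn; apply: leq_trans kn (h n n _). Qed.

Lemma polynomial_add f g : polynomial f -> polynomial g ->
  polynomial (fun k n => f k n + g k n).
Proof.
case=> a ha [b hb]; exists (a + b) => k n kn.
exact: leq_trans (leq_add (ha k n kn) (hb k n kn)) (poly_bound_add a b n).
Qed.

Lemma polynomial_mul f g : polynomial f -> polynomial g ->
  polynomial (fun k n => f k n * g k n).
Proof.
case=> a ha [b hb]; exists (4 * (a * b) + a + b) => k n kn.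
exact: leq_trans (leq_mul (ha k n kn) (hb k n kn)) (poly_bound_mul a b n).
Qed.

(* Words of polynomially many times [b] bits. *)
Definition wordy (f : nat -> nat -> nat -> nat) :=
  exists c, forall k n b, k <= n -> 0 < b -> f k n b <= 2 ^ (poly_bound c n * b).

Lemma wordy_exp g f : polynomial g -> (forall k n b, f k n b <= 2 ^ (g k n * b)) -> wordy f.
Proof.
case=> c h fg; exists c => k n b kn b0; apply: leq_trans (fg k n b) _.
by apply: leq_pexp2l => //; rewrite leq_mul2r h ?orbT.
Qed.

Lemma wordy_poly g : polynomial g -> wordy (fun k n _ => g k n).
Proof.
case=> c h; exists c => k n b kn b0; apply: leq_trans (ltnW (ltn_expl _ (isT : 1 < 2))) _.
by apply: leq_pexp2l => //; apply: leq_trans (h k n kn) (leq_pmulr _ b0).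
Qed.

Lemma wordy_mul f g : wordy f -> wordy g -> wordy (fun k n b => f k n b * g k n b).
Proof.
case=> a ha [c hc]; exists (a + c) => k n b kn b0.
apply: leq_trans (leq_mul (ha k n b kn b0) (hc k n b kn b0)) _.
rewrite -expnD -mulnDl; apply: leq_pexp2l => //.
by rewrite leq_mul2r poly_bound_add orbT.
Qed.

Lemma wordy_add f g : wordy f -> wordy g -> wordy (fun k n b => f k n b + g k n b).
Proof.
case=> a ha [c hc]; exists (a + c + 1) => k n b kn b0.
apply: leq_trans (leq_add (ha k n b kn b0) (hc k n b kn b0)) _.
have two x y : 2 ^ x + 2 ^ y <= 2 ^ (x + y + 1).
  rewrite expnD expn1 muln2 -addnn; apply: leq_add; apply: leq_pexp2l => //.
    exact: leq_addr.
  exact: leq_addl.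
apply: leq_trans (two _ _) _; apply: leq_pexp2l => //.
apply: leq_trans (_ : (poly_bound a n + poly_bound c n + 1) * b <= _).
  by rewrite !mulnDl leq_add2l mul1n.
rewrite leq_mul2r; apply/orP; right.
apply: leq_trans (poly_bound_add (a + c) 1 n); apply: leq_add; last exact: poly_bound_ge.
exact: poly_bound_add.
Qed.

(** Registers 1, 2, 4 and 6 are [rN], [rNN], [rM] and [rLim], the bounds of all loops. *)
Definition steps (k n r : nat) : nat :=
  match r with 1 => n | 2 => n * n | 4 => 5 * k | 6 => guesses k | _ => 0 end.

Definition addresses (k n : nat) : nat := (5 * k).+1 * (n * n) + n + 5 * k + 2.

Definition space (k n : nat) : nat :=
  (n + (n + (n * n + n * n))).+1 + narr * addresses k n.

(** An upper bound for [BIG], one more than a sum of [n * n] weights of at most [b] bits. *)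
Definition big_of (n b : nat) := n * n * 2 ^ b + 1.

(** A common upper bound for what the correctness proof requires to fit into a word. *)
Definition word_max (k n b : nat) : nat :=
  2 * (n * n + n) + 5 * k + 9 + (5 * k + n + 5) * big_of n b + guesses k + 4 * k * (5 * k).

Lemma timely_steps r : timely (fun k n => steps k n r).
Proof.
have t5 : timely (fun k _ => 5 * k).
  by apply: timely_mul; [exact: timely_const|exact: timely_k].
case: r => [|[|[|[|[|[|[|r]]]]]]] /=; try exact: timely_const; try exact: timely_n.
- by apply: timely_mul; exact: timely_n.
- exact: t5.
- exact: timely_guesses.
Qed.

Lemma polynomial_space : polynomial space.
Proof.
have pn := polynomial_n; have pk := polynomial_k; have pc := polynomial_const.
have pnn := polynomial_mul pn pn; have p5 := polynomial_mul (pc 5) pk.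
have p5' := polynomial_add (pc 1) p5.
have pa := polynomial_add (polynomial_add (polynomial_add (polynomial_mul p5' pnn) pn) p5) (pc 2).
have pi := polynomial_add (pc 1) (polynomial_add pn (polynomial_add pn (polynomial_add pnn pnn))).
exact: polynomial_add pi (polynomial_mul (pc narr) pa).
Qed.

Lemma wordy_max : wordy word_max.
Proof.
have pn := polynomial_n; have pk := polynomial_k; have pc := polynomial_const.
have pnn := polynomial_mul pn pn; have p5 := polynomial_mul (pc 5) pk.
have pB := polynomial_mul (polynomial_mul (pc 4) pk) p5.
have wB : wordy (fun _ n b => big_of n b).
  apply: wordy_add (wordy_poly (pc 1)); apply: wordy_mul (wordy_poly pnn) _.
  by apply: (wordy_exp (pc 1)) => k n b; rewrite mul1n.
have wg : wordy (fun k _ _ => guesses k).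
  have [c h] := polynomial_mul pB p5; exists c => k n b kn b0.
  apply: leq_trans (guesses_word k) _; apply: leq_pexp2l => //.
  exact: leq_trans (h k n kn) (leq_pmulr _ b0).
have p1 := polynomial_add (polynomial_add (polynomial_mul (pc 2) (polynomial_add pnn pn)) p5) (pc 9).
have p2 := polynomial_add (polynomial_add p5 pn) (pc 5).
exact: wordy_add (wordy_add (wordy_add (wordy_poly p1) (wordy_mul (wordy_poly p2) wB)) wg)
  (wordy_poly pB).
Qed.

(** Two raw commands precede the compiled program: one loads [n] into [rN], the other sets register
    0 to the length of the input, as a structured program may not assign that register. *)
Definition program : cmd :=
  CSeq (CSet 1 (ELoad (EConst 0)))
   (CSeq (CSet 0 (EBin OpAdd (EConst 1) (EBin OpAdd (EReg 1) (EBin OpAdd (EReg 1)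
           (EBin OpAdd (EBin OpMul (EReg 1) (EReg 1)) (EBin OpMul (EReg 1) (EReg 1)))))))
      (to_cmd (Seq p_init p_main))).

Lemma sumn_costs n (E : {set {set 'I_n}}) cost :
  sumn (cost_table E cost) <= n * n * 2 ^ weight_bits E cost.
Proof.
have h x : x \in cost_table E cost -> x <= 2 ^ weight_bits E cost.
  case/allpairsP => -[u v] /= [_ _ ->]; case: ifP => // uv; apply: ltnW.
  apply: leq_ltn_trans (trunc_log_ltn _ (isT : 1 < 2)).
  exact: (@leq_bigmax_cond _ (mem E) cost [set u; v]).
rewrite -(size_pairs (fun u v : 'I_n => if adj E u v then cost [set u; v] else 0)) -/(cost_table E cost).
elim: (cost_table E cost) h => //= x l IH h; rewrite mulSn; apply: leq_add.
  by apply: h; rewrite mem_head.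
by apply: IH => y yl; apply: h; rewrite inE yl orbT.
Qed.

Theorem theorem1 :
  exists (P : cmd) (c : nat),
    forall (n : nat) (E : {set {set 'I_n}}) (cost : {set 'I_n} -> nat)
           (K S : {set 'I_n}),
      is_graph E ->
      multiway_cut E K S ->
      exists (t : nat) (s : state),
        [/\ runs (cell_bound c n) (word_bound c E cost) P
                 (encode_input E cost K S) t s,
            t <= time_bound c #|S| n
          & outputs_min_steiner_tree E cost K (ram s)].
Proof.
have [ct ht] : timely (fun k n => 20 + tm (steps k n) (Seq p_init p_main)).
  by apply: timely_add; [exact: timely_const|apply: timely_tm; exact: timely_steps].
have [cs hs] := polynomial_space; have [cw hw] := wordy_max.
(* One constant serves time, number of cells and word length, since all three bounds are monotone in
   it. *)
exists program, (ct + cs + cw) => n E cost K S gE cut; set c := ct + cs + cw.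
set k := #|S|; have kn : k <= n by rewrite -[leqRHS]card_ord max_card.
set b := weight_bits E cost; pose M := word_max k n b.
pose BIG := (sumn (cost_table E cost)).+1.
set input := encode_input E cost K S; set off := size input.
set cells := cell_bound c n; set bits := word_bound c E cost.
have offE : off = (n + (n + (n * n + n * n))).+1 by exact: size_input.
have BIGle : BIG <= big_of n b by rewrite /BIG /big_of addn1 ltnS; exact: sumn_costs.
have hM : M <= 2 ^ bits.
  apply: leq_trans (hw k n b kn _) _ => //; apply: leq_pexp2l => //.
  by rewrite leq_mul2r poly_bound_mono ?orbT // leq_addl.
have hcells : off + narr * addresses k n <= cells.
  rewrite offE; apply: leq_trans (hs k n kn) _; apply: poly_bound_mono.
  by rewrite /c -addnA addnCA leq_addr.
have Mbig : (5 * k + n + 5) * BIG + 2 * (n * n + n) + 5 * k + 9 + guesses k + 4 * k * (5 * k) <= M.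
  have : (5 * k + n + 5) * BIG <= (5 * k + n + 5) * big_of n b by rewrite leq_mul2l BIGle orbT.
  by rewrite /M /word_max; move: ((_ + _) * BIG) ((_ + _) * big_of n b) (guesses k); clear; lia.
have BIGM : BIG <= M.
  apply: leq_trans Mbig; rewrite -!addnA; apply: leq_trans (leq_addr _ _).
  by apply: leq_pmull; clear; lia.
have n_lt : 2 * (n * n + n) + 5 * k + 9 <= M.
  by apply: leq_trans Mbig; move: (_ * BIG) (guesses k); clear; lia.
have inM i : nth 0 input i < 2 ^ bits.
  apply: leq_trans hM; case: i => [|i]; first by move: n_lt; rewrite /=; clear; lia.
  have tabs : all (fun x => x <= BIG) (behead input).
    rewrite /= !all_cat; apply/and4P; split; apply/allP => x.
    - by case/mapP => v _ ->; case: (_ \in _).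
    - by case/mapP => v _ ->; case: (_ \in _).
    - by case/allpairsP => -[u v] /= [_ _ ->]; case: (adj _ _ _).
    - by move=> /(nthP 0)[j _ <-]; apply: leq_trans (nth_sumn_le _ _) (leqnSn _).
  have hx : nth 0 input i.+1 <= BIG.
    rewrite -[nth _ _ _]/(nth 0 (behead input) i).
    by have [hi|hi] := ltnP i (size (behead input)); [exact: (allP tabs _ (mem_nth _ hi))|rewrite nth_default].
  apply: leq_ltn_trans hx _; apply: leq_trans Mbig; rewrite -!addnA.
  have : BIG <= (5 * k + (n + 5)) * BIG by apply: leq_pmull; clear; lia.
  by move: (_ * BIG) (guesses k); clear; lia.
have fit0 : fits cells bits (init_state input).
  split=> /= [a ha|//|r]; last by rewrite expn_gt0.
  by rewrite nth_default //; apply: leq_trans ha; apply: leq_trans hcells; exact: leq_addr.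
pose s1 := State (upd (fun=> 0) 1 n) (nth 0 input).
have fit1 : fits cells bits s1.
  case: fit0 => f1 f2 f3; split=> //= r; rewrite /upd; case: ifP => _; last by rewrite expn_gt0.
  by apply: leq_trans hM; move: n_lt; clear; lia.
pose s2 := State (upd (upd (fun=> 0) 1 n) 0 off) (nth 0 input).
have fit2 : fits cells bits s2.
  case: fit1 => f1 f2 f3; split=> //= r; rewrite /upd; case: ifP => _; last exact: f3.
  by apply: leq_trans hM; rewrite offE; move: n_lt; clear; lia.
(* The abstract state is read off the concrete one, so the two are similar by definition. *)
pose d := St (regs s2) (fun a i => ram s2 (off + (narr * i + a))) (ram s2).
have simd : sim off d s2 by [].
have Em : 5 * k = 5 * #|S| by [].
have BIG0 : 0 < BIG by [].
have M1 : n * n + n + 5 * k + 8 < M by move: n_lt; clear; lia.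
have M2 : (5 * k + n + 5) * BIG < M.
  by apply: leq_trans Mbig; move: (_ * BIG) (guesses k); clear; lia.
have M3 : guesses k + 4 * k * (5 * k) < M.
  by apply: leq_trans Mbig; move: (_ * BIG) (guesses k); clear; lia.
have L1 : (5 * k).+1 * (n * n) + n + 5 * k + 1 < addresses k n.
  by rewrite /addresses addn2 addn1.
have off1 : 1 + n + n * n <= off by rewrite offE; clear; lia.
have w : wp off (addresses k n) M (steps k n) (Seq p_init p_main) (fun s' =>
    (exists V F, min_steiner_tree E cost K V F /\
       forall i, i < size (encode_tree V F) -> rw s' i = nth 0 (encode_tree V F) i) \/
    ((forall V F, ~ steiner_tree E K V F) /\ rw s' 0 = 0)) d.
  apply: (wp_seq (p_init_ok (erefl k) (erefl _) (erefl _) (erefl _) BIG0 M1 M2 M3 L1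
    (leqnn _) (leqnn _) (leqnn _) (leqnn _) (erefl BIG) (erefl off) _ _ _ _)) => //.
  move=> s' [hc hW] _.
  exact: (p_main_ok (erefl k) (erefl _) (erefl _) (erefl _) BIG0 M1 M2 M3 L1
    (leqnn _) (leqnn _) (leqnn _) (leqnn _) off1 gE cut (weight_lt_big (erefl BIG) gE) hc hW).
have ok : okp (Seq p_init p_main) by [].
have [t [s' [d' [x tle [sr1 sr2 sr3 sr4] _ post]]]] := to_cmd_ok hM hcells ok w simd fit2.
(* 3 and 14 are the times of the two leading assignments, covered by the 20 in the time bound. *)
exists (3 + (14 + t)), s'; split.
- split; first exact: fit0.
  apply: exec_seq; first exact: (@exec_set _ _ (init_state input) 1 (ELoad (EConst 0))).
  apply: exec_seq x.
  have -> : s2 = State (upd (regs s1) 0 (1 + (n + (n + (n * n + n * n))))) (ram s1).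
    by rewrite /s2 offE add1n.
  apply: (@exec_set _ _ s1 0 _); rewrite /= add1n -offE; exact: fit2.
- apply: leq_trans (leq_trans (ht k n kn) _); first by move: tle; clear; lia.
  by apply: time_bound_mono; rewrite /c -addnA leq_addr.
case: post => [[V [F [mVF hout]]]|[no h0]]; [left|right].
  exists V, F; split=> // i hi; rewrite sr3 ?hout //; apply: leq_trans hi (leq_trans _ off1).
  by rewrite /= size_cat size_vertex_table size_pairs.
by split=> //; rewrite sr3 // offE.
Qed.
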